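(* Let $S$ be either of the following operators: (FI) $S:\Phi\to C$, $Sf=\left(-i\frac{\mathrm{d}}{\mathrm{d}x}\right)^3f=i f'''$, with $\Phi=\{f\in C^\infty[0,1]:f(0)=f(1)=f'(1)=0\}$, $C=C^\infty[0,1]$, $I=(0,1)$; (HL) $S:\Phi\to C$, $Sf=\left(-i\frac{\mathrm{d}}{\mathrm{d}x}\right)^3f=i f'''$, with $\Phi=\{f\in\mathcal{E}[0,\infty):f(0)=0\}$, $C=\mathcal{S}[0,\infty)$, $I=(0,\infty)$. Then $S$ can be diagonalised by a complete system of its type II augmented eigenfunctions, in the following sense. Let $\{F_\lambda:\lambda\in\Gamma^+\cup\Gamma^-\}$ be the corresponding family of functionals defined in the context. This family is a family of type II augmented eigenfunctions of $S$ up to integration along $\Gamma^+\cup\Gamma^-$, with eigenvalues $z(\lambda)=\lambda^3$; it is complete, i.e. if $f\in\Phi$ and $F_\lambda(f)=0$ for all $\lambda\in\Gamma^+\cup\Gamma^-$ then $f=0$; and for all $f\in\Phi$ and all $x\in I$ both integrals below converge and $$\int_{\Gamma^+\cup\Gamma^-}e^{i\lambda x}\frac{1}{\lambda^3}F_\lambda(Sf)\,\mathrm{d}\lambda=\int_{\Gamma^+\cup\Gamma^-}e^{i\lambda x}F_\lambda(f)\,\mathrm{d}\lambda.$$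
   Context: Notation: $\alpha=e^{2\pi i/3}$; $\mathbb{C}^+$ and $\mathbb{C}^-$ are the open upper and lower half-planes. The boundary of a domain is oriented so that the domain lies to its left. Integrals along unbounded contours are improper integrals, and $\int_{\Gamma^+\cup\Gamma^-}=\int_{\Gamma^+}+\int_{\Gamma^-}$. Type II augmented eigenfunctions. Let $I$ be an open real interval, $C$ a space of functions on the closure of $I$ with sufficient smoothness and decay conditions, $C'$ its dual, $\Phi\subseteq C$, and $L:\Phi\to C$ a linear operator. Let $\gamma$ be an oriented contour in $\mathbb{C}$. A family $\{E_\lambda:\lambda\in\gamma\}$ of functionals $E_\lambda\in C'$ is a family of type II augmented eigenfunctions of $L$ up to integration along $\gamma$, with eigenvalues $z(\lambda)$, if there are remainder functionals $R_\lambda\in C'$ with $$E_\lambda(L\phi)=z(\lambda)E_\lambda(\phi)+R_\lambda(\phi)\quad\text{for all }\phi\in\Phi,\ \lambda\in\gamma,$$ and $$\int_\gamma\frac{e^{i\lambda x}}{z(\lambda)}R_\lambda(\phi)\,\mathrm{d}\lambda=0\quad\text{for all }\phi\in\Phi,\ x\in I.$$ Function spaces. $\mathcal{S}[0,\infty)$ is the Schwartz class of rapidly decaying smooth functions restricted to the half-line $[0,\infty)$. For some fixed arbitrarily small $\epsilon>0$, $\mathcal{E}[0,\infty)=\{f\in\mathcal{S}[0,\infty):f(x)=O(e^{-\epsilon x})\text{ as }x\to\infty\}$. The family for (FI). $\Gamma^{\pm}$ is the oriented boundary of $\{\lambda\in\mathbb{C}^{\pm}:\operatorname{Im}(\lambda^3)>0,\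 |\lambda|>1\}$. Put $\Delta(\lambda)=e^{-i\lambda}+\alpha e^{-i\alpha\lambda}+\alpha^2e^{-i\alpha^2\lambda}$, $$\phi^+(x,\lambda)=\frac{1}{2\pi\Delta(\lambda)}\left[e^{-i\lambda x}(\alpha e^{-i\alpha\lambda}+\alpha^2e^{-i\alpha^2\lambda})-(\alpha e^{-i\alpha\lambda x}+\alpha^2e^{-i\alpha^2\lambda x})e^{-i\lambda}\right],$$ $$\phi^-(x,\lambda)=\frac{-e^{-i\lambda}}{2\pi\Delta(\lambda)}\left[e^{-i\lambda x}+\alpha e^{-i\alpha\lambda x}+\alpha^2e^{-i\alpha^2\lambda x}\right],$$ and $F_\lambda(f)=\int_0^1\phi^{\pm}(x,\lambda)f(x)\,\mathrm{d}x$ for $\lambda\in\Gamma^{\pm}$. The family for (HL). $\Gamma^+$ is the oriented boundary of $\{\lambda\in\mathbb{C}^+:\operatorname{Re}(-i\lambda^3)<0,\ |\lambda|>1\}$. $\Gamma^-$ is $\mathbb{R}$, traversed from $-\infty$ to $+\infty$, but perturbed away from $0$ along a small semicircular arc in $\mathbb{C}^+$ centred at $0$, of radius less than $\epsilon$. Put $$\phi^+(x,\lambda)=\frac{1}{2\pi}\left[\alpha e^{-i\alpha\lambda x}+\alpha^2e^{-i\alpha^2\lambda x}\right],\qquad\phi^-(x,\lambda)=\frac{1}{2\pi}e^{-i\lambda x},$$ and $F_\lambda(f)=\int_0^\infty\phi^{\pm}(x,\lambda)f(x)\,\mathrm{d}x$ for $\lambda\in\Gamma^{\pm}$.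
   Formalization: In (HL), for λ on the small arc of Γ⁻, F_λ is not defined on all of C=S[0,∞); there it is only required to be in the dual of {f∈C: e^{(Im λ)x}f∈C}, which contains Φ and SΦ. The arc radius is also taken less than 1, so that Γ⁺ and Γ⁻ are disjoint. *)

(* Defs.v *)
From Stdlib Require Import Reals Lra Lia List ClassicalEpsilon.
From Coquelicot Require Import Coquelicot.

Open Scope R_scope.

Definition Cexp (z : C) : C := (exp (Re z) * cos (Im z), exp (Re z) * sin (Im z)).

Definition polar (r theta : R) : C := (r * cos theta, r * sin theta).

Definition alpha : C := Cexp (Ci * RtoC (2 * PI / 3)).

(** A function on an interval [J] is represented by a total function [R -> C]
    of which only the values on [J] matter: derivatives are taken relative to
    [J], hence one-sided at the endpoints that belong to [J], and equality is
    equality on [J]. *)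

Definition is_derive_on (J : R -> Prop) (f : R -> C) (x : R) (l : C) : Prop :=
  filterlim (fun y => (f y - f x) / RtoC (y - x))%C
            (within (fun y => J y /\ y <> x) (locally x)) (locally l).

Definition Derive_on (J : R -> Prop) (f : R -> C) (x : R) : C :=
  epsilon (inhabits (RtoC 0)) (is_derive_on J f x).

Fixpoint Derive_on_n (J : R -> Prop) (n : nat) (f : R -> C) : R -> C :=
  match n with
  | O => f
  | S m => Derive_on J (Derive_on_n J m f)
  end.

Definition smooth_on (J : R -> Prop) (f : R -> C) : Prop :=
  forall n x, J x -> exists l, is_derive_on J (Derive_on_n J n f) x l.

Definition schwartz_on (J : R -> Prop) (f : R -> C) : Prop :=
  smooth_on J f /\
  forall j k : nat, exists M : R, forall x, J x ->
    Rabs x ^ j * Cmod (Derive_on_n J k f x) <= M.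

Definition unit_interval (x : R) : Prop := 0 <= x <= 1.
Definition half_line (x : R) : Prop := 0 <= x.

(** The Schwartz class of the real line, restricted to the half-line. *)
Definition schwartz_half (f : R -> C) : Prop :=
  exists g : R -> C,
    schwartz_on (fun _ => True) g /\ forall x, half_line x -> f x = g x.

(** [semi_le V n B f] says that the [n]-th seminorm of [f] is at most [B]; in
    the spaces below the seminorms increase with [n], so that a functional is
    continuous iff it is controlled by a single one of them. *)

Record fspace := {
  dom : R -> Prop;
  mem : (R -> C) -> Prop;
  semi_le : nat -> R -> (R -> C) -> Prop
}.

Definition dual (V : fspace) (T : (R -> C) -> C) : Prop :=
  (forall (a b : C) f g, mem V f -> mem V g ->
     T (fun x => a * f x + b * g x)%C = (a * T f + b * T g)%C) /\
  exists (n : nat) (M : R), forall f B,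
    mem V f -> semi_le V n B f -> Cmod (T f) <= M * B.

Definition linear_operator (Phi : (R -> C) -> Prop) (V : fspace)
    (L : (R -> C) -> R -> C) : Prop :=
  (forall f, Phi f -> mem V (L f)) /\
  forall (a b : C) f g, Phi f -> Phi g ->
    Phi (fun x => a * f x + b * g x)%C /\
    forall x, dom V x ->
      L (fun y => a * f y + b * g y)%C x = (a * L f x + b * L g x)%C.

Definition smooth_unit_space : fspace := {|
  dom := unit_interval;
  mem := smooth_on unit_interval;
  semi_le := fun n B f => forall k x, (k <= n)%nat -> unit_interval x ->
    Cmod (Derive_on_n unit_interval k f x) <= B
|}.

Definition schwartz_half_semi_le (n : nat) (B : R) (f : R -> C) : Prop :=
  forall j k x, (j <= n)%nat -> (k <= n)%nat -> half_line x ->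
    x ^ j * Cmod (Derive_on_n half_line k f x) <= B.

Definition schwartz_half_space : fspace := {|
  dom := half_line;
  mem := schwartz_half;
  semi_le := schwartz_half_semi_le
|}.

(** The functions [f] of the Schwartz class such that [e^{sigma x} f] is again
    in that class, with the topology transported from there. *)
Definition exp_weight (sigma : R) (f : R -> C) : R -> C :=
  fun x => (RtoC (exp (sigma * x)) * f x)%C.

Definition weighted_half_space (sigma : R) : fspace := {|
  dom := half_line;
  mem := fun f => schwartz_half f /\ schwartz_half (exp_weight sigma f);
  semi_le := fun n B f => schwartz_half_semi_le n B (exp_weight sigma f)
|}.

(** An oriented contour is a finite family of paths, each parametrized by the
    whole real line. *)
Definition contour := list (R -> C).

Definition on_contour (G : contour) (lambda : C) : Prop :=
  exists gamma t, In gamma G /\ gamma t = lambda.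

Definition path_deriv (gamma : R -> C) (t : R) : C :=
  (Derive (fun u => Re (gamma u)) t, Derive (fun u => Im (gamma u)) t).

(** The two ends of every path are sent to infinity independently. *)
Fixpoint is_contour_int (G : contour) (g : C -> C) (v : C) : Prop :=
  match G with
  | nil => v = RtoC 0
  | gamma :: G' => exists v1 v2 : C,
      @is_RInt_gen C_R_NormedModule
        (fun t => g (gamma t) * path_deriv gamma t)%C
        (Rbar_locally m_infty) (Rbar_locally p_infty) v1 /\
      is_contour_int G' g v2 /\
      v = (v1 + v2)%C
  end.

(** The boundary of [{r e^{i theta} : r > rho, a < theta < b}] with that region
    on its left: inwards along [theta = b], clockwise along the arc [r = rho],
    outwards along [theta = a]. *)
Definition sector_path (rho a b : R) (t : R) : C :=
  if Rle_dec t (- rho) then polar (- t) b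
  else if Rle_dec rho t then polar t a
  else polar rho ((a + b) / 2 - t / rho * ((b - a) / 2)).

(** [D lambda] is the space in whose dual [E lambda] is required to be.  It is
    [V] itself, except where the functional [E lambda] is only defined on a
    subspace [D lambda] of [V]; that subspace has to contain [Phi] and [L Phi]. *)

Definition type_II_augmented (I : R -> Prop) (V : fspace) (D : C -> fspace)
    (Phi : (R -> C) -> Prop) (L : (R -> C) -> R -> C) (G : contour)
    (E : C -> (R -> C) -> C) (z : C -> C) : Prop :=
  (forall phi, Phi phi -> mem V phi) /\
  linear_operator Phi V L /\
  (forall lambda, on_contour G lambda ->
     (forall f, mem (D lambda) f -> mem V f) /\
     (forall phi, Phi phi -> mem (D lambda) phi /\ mem (D lambda) (L phi)) /\
     dual (D lambda) (E lambda)) /\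
  exists Rem : C -> (R -> C) -> C,
    (forall lambda, on_contour G lambda -> dual V (Rem lambda)) /\
    (forall lambda phi, on_contour G lambda -> Phi phi ->
       E lambda (L phi) = (z lambda * E lambda phi + Rem lambda phi)%C) /\
    (forall phi x, Phi phi -> I x ->
       is_contour_int G
         (fun lambda => Cexp (Ci * lambda * RtoC x) / z lambda * Rem lambda phi)%C
         (RtoC 0)).

Definition complete_system (V : fspace) (Phi : (R -> C) -> Prop) (G : contour)
    (E : C -> (R -> C) -> C) : Prop :=
  forall f, Phi f -> (forall lambda, on_contour G lambda -> E lambda f = RtoC 0) ->
    forall x, dom V x -> f x = RtoC 0.

Definition diagonalised_by (I : R -> Prop) (V : fspace) (D : C -> fspace)
    (Phi : (R -> C) -> Prop) (L : (R -> C) -> R -> C) (G : contour)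
    (E : C -> (R -> C) -> C) (z : C -> C) : Prop :=
  type_II_augmented I V D Phi L G E z /\
  complete_system V Phi G E /\
  forall f x, Phi f -> I x ->
    exists v : C,
      is_contour_int G
        (fun lambda => Cexp (Ci * lambda * RtoC x) * (1 / z lambda) * E lambda (L f))%C v /\
      is_contour_int G
        (fun lambda => Cexp (Ci * lambda * RtoC x) * E lambda f)%C v.

(** [S f = (-i d/dx)^3 f = i f''']. *)
Definition S_op (J : R -> Prop) (f : R -> C) : R -> C :=
  fun x => (Ci * Derive_on_n J 3 f x)%C.

Definition cube (lambda : C) : C := (lambda ^ 3)%C.

Definition I_FI (x : R) : Prop := 0 < x < 1.

Definition Phi_FI (f : R -> C) : Prop :=
  smooth_on unit_interval f /\
  f 0 = RtoC 0 /\ f 1 = RtoC 0 /\ Derive_on unit_interval f 1 = RtoC 0.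

Definition D_FI_plus (lambda : C) : Prop :=
  0 < Im lambda /\ 0 < Im (lambda ^ 3)%C /\ 1 < Cmod lambda.

Definition D_FI_minus (lambda : C) : Prop :=
  Im lambda < 0 /\ 0 < Im (lambda ^ 3)%C /\ 1 < Cmod lambda.

(** Shown below to be the oriented boundaries of [D_FI_plus] and [D_FI_minus]. *)
Definition Gamma_FI_plus : contour :=
  sector_path 1 0 (PI / 3) :: sector_path 1 (2 * PI / 3) PI :: nil.

Definition Gamma_FI_minus : contour :=
  sector_path 1 (4 * PI / 3) (5 * PI / 3) :: nil.

Definition Gamma_FI : contour := Gamma_FI_plus ++ Gamma_FI_minus.

(** [e^{-i mu x}] *)
Definition em (mu : C) (x : R) : C := Cexp (- Ci * mu * RtoC x).

Definition Delta_FI (lambda : C) : C :=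
  (em lambda 1 + alpha * em (alpha * lambda) 1
   + alpha ^ 2 * em (alpha ^ 2 * lambda) 1)%C.

Definition phi_FI_plus (x : R) (lambda : C) : C :=
  (1 / (RtoC (2 * PI) * Delta_FI lambda) *
   (em lambda x * (alpha * em (alpha * lambda) 1 + alpha ^ 2 * em (alpha ^ 2 * lambda) 1)
    - (alpha * em (alpha * lambda) x + alpha ^ 2 * em (alpha ^ 2 * lambda) x)
      * em lambda 1))%C.

Definition phi_FI_minus (x : R) (lambda : C) : C :=
  (- em lambda 1 / (RtoC (2 * PI) * Delta_FI lambda) *
   (em lambda x + alpha * em (alpha * lambda) x
    + alpha ^ 2 * em (alpha ^ 2 * lambda) x))%C.

Definition F_FI (lambda : C) (f : R -> C) : C :=
  @RInt C_R_CompleteNormedModule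
    (fun x => (if excluded_middle_informative (on_contour Gamma_FI_plus lambda)
               then phi_FI_plus x lambda else phi_FI_minus x lambda) * f x)%C 0 1.

Definition I_HL (x : R) : Prop := 0 < x.

Definition exp_decay_half (eps : R) (f : R -> C) : Prop :=
  schwartz_half f /\
  exists M X : R, forall x, half_line x -> X <= x -> Cmod (f x) <= M * exp (- eps * x).

Definition Phi_HL (eps : R) (f : R -> C) : Prop :=
  exp_decay_half eps f /\ f 0 = RtoC 0.

Definition D_HL_plus (lambda : C) : Prop :=
  0 < Im lambda /\ Re (- Ci * lambda ^ 3)%C < 0 /\ 1 < Cmod lambda.

(** Shown below to be the oriented boundary of [D_HL_plus]. *)
Definition Gamma_HL_plus : contour := sector_path 1 (PI / 3) (2 * PI / 3) :: nil.

(** The real line from [-oo] to [+oo], with [(-delta, delta)] replaced by the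
    semicircle of radius [delta] about [0] in the upper half-plane. *)
Definition Gamma_HL_minus (delta : R) : contour := sector_path delta 0 PI :: nil.

Definition Gamma_HL (delta : R) : contour := Gamma_HL_plus ++ Gamma_HL_minus delta.

Definition phi_HL_plus (x : R) (lambda : C) : C :=
  (1 / RtoC (2 * PI) *
   (alpha * em (alpha * lambda) x + alpha ^ 2 * em (alpha ^ 2 * lambda) x))%C.

Definition phi_HL_minus (x : R) (lambda : C) : C :=
  (1 / RtoC (2 * PI) * em lambda x)%C.

Definition integrand_HL (lambda : C) (f : R -> C) (x : R) : C :=
  ((if excluded_middle_informative (on_contour Gamma_HL_plus lambda)
    then phi_HL_plus x lambda else phi_HL_minus x lambda) * f x)%C.

Definition F_HL (lambda : C) (f : R -> C) : C :=
  @RInt_gen C_R_CompleteNormedModule (integrand_HL lambda f)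
    (at_point 0) (Rbar_locally p_infty).

(** On the small semicircle [|e^{-i lambda x}| = e^{x Im lambda}] is unbounded,
    so that [F_HL lambda] is not defined on the whole Schwartz class there. *)
Definition space_HL (lambda : C) : fspace :=
  if excluded_middle_informative (on_contour Gamma_HL_plus lambda \/ Im lambda = 0)
  then schwartz_half_space
  else weighted_half_space (Im lambda).

(** The parametrized contours above run, exactly once and with the domain on
    the left, through the topological boundaries of the domains. *)

Definition frontier (D : C -> Prop) (lambda : C) : Prop :=
  (forall P, locally lambda P -> exists w, P w /\ D w) /\
  (forall P, locally lambda P -> exists w, P w /\ ~ D w).

Definition oriented_boundary (D : C -> Prop) (G : contour) : Prop :=
  (forall lambda, on_contour G lambda <-> frontier D lambda) /\
  (forall i j s t, (i < length G)%nat -> (j < length G)%nat ->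
     nth i G (fun _ => RtoC 0) s = nth j G (fun _ => RtoC 0) t -> i = j /\ s = t) /\
  (forall gamma, In gamma G ->
     (forall t, continuous gamma t) /\
     exists corners : list R, forall t, ~ In t corners ->
       ex_derive (fun u => Re (gamma u)) t /\
       ex_derive (fun u => Im (gamma u)) t /\
       path_deriv gamma t <> RtoC 0 /\
       exists eta, 0 < eta /\ forall s, 0 < s < eta ->
         D (gamma t + RtoC s * (Ci * path_deriv gamma t))%C /\
         ~ D (gamma t - RtoC s * (Ci * path_deriv gamma t))%C).

Lemma Cmod_polar r th : 0 <= r -> Cmod (polar r th) = r.
Proof.
intros Hr; unfold Cmod, polar; simpl.
replace (r * cos th * (r * cos th * 1) + r * sin th * (r * sin th * 1))
  with (r * r * (Rsqr (sin th) + Rsqr (cos th))) by (unfold Rsqr; ring).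
rewrite sin2_cos2, Rmult_1_r; apply sqrt_square, Hr.
Qed.

Lemma polar_mul r s a b : (polar r a * polar s b)%C = polar (r * s) (a + b).
Proof.
unfold polar, Cmult; simpl; rewrite cos_plus, sin_plus; f_equal; ring.
Qed.

Lemma polar_cube r th : (polar r th ^ 3)%C = polar (r ^ 3) (3 * th).
Proof.
simpl; rewrite Cmult_1_r, !polar_mul; f_equal; ring.
Qed.

Lemma cos_eq_1_small x : - (2 * PI) < x < 2 * PI -> cos x = 1 -> x = 0.
Proof.
intros Hx Hc.
assert (Hs : sin (x / 2) = 0).
{ replace x with (2 * (x / 2)) in Hc by field.
  rewrite cos_2a_sin in Hc; nra. }
destruct (Rtotal_order x 0) as [H | [H | H]]; try easy.
- assert (0 < sin (- (x / 2))) by (apply sin_gt_0; lra).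
  rewrite sin_neg in *; lra.
- assert (0 < sin (x / 2)) by (apply sin_gt_0; lra); lra.
Qed.

Lemma polar_inj r s a b : 0 < r -> 0 < s -> 0 <= a < 2 * PI -> 0 <= b < 2 * PI ->
  polar r a = polar s b -> r = s /\ a = b.
Proof.
intros Hr Hs Ha Hb E.
assert (r = s).
{ rewrite <- (Cmod_polar r a), <- (Cmod_polar s b), E by lra; easy. }
subst s; split; [easy |].
injection E as E1 E2.
apply Rmult_eq_reg_l in E1; [| lra]; apply Rmult_eq_reg_l in E2; [| lra].
enough (a - b = 0) by lra.
apply cos_eq_1_small; [lra |].
rewrite cos_minus, E1, E2.
generalize (sin2_cos2 b); unfold Rsqr; lra.
Qed.

Lemma polar_ex (w : C) : w <> RtoC 0 ->
  exists r th, 0 < r /\ 0 <= th < 2 * PI /\ w = polar r th.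
Proof.
intros Hw; destruct w as [x y].
assert (Hr : 0 < Cmod (x, y)) by (apply Cmod_gt_0, Hw).
set (r := Cmod (x, y)) in *.
assert (E : r * r = x * x + y * y).
{ unfold r, Cmod; simpl; rewrite sqrt_sqrt; nra. }
assert (Hx : -1 <= x / r <= 1).
{ assert (x / r * r = x) by (field; lra).
  split; apply Rmult_le_reg_r with r; nra. }
assert (Hp := PI_RGT_0); assert (Hb := acos_bound (x / r)).
assert (Hs : r * sqrt (1 - Rsqr (x / r)) = Rabs y).
{ rewrite <- (sqrt_square r) at 1 by lra.
  rewrite <- sqrt_mult_alt by nra.
  rewrite <- sqrt_Rsqr_abs; f_equal; unfold Rsqr.
  replace (r * r * (1 - x / r * (x / r))) with (r * r - x * x) by (field; lra).
  lra. }
assert (Hc : r * cos (acos (x / r)) = x) by (rewrite cos_acos by lra; field; lra).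
assert (Hs' : r * sin (acos (x / r)) = Rabs y) by (rewrite sin_acos by lra; exact Hs).
destruct (Rle_dec 0 y) as [Hy | Hy].
- exists r, (acos (x / r)); repeat split; try lra.
  unfold polar; rewrite Hc, Hs', Rabs_pos_eq; easy.
- exists r, (2 * PI - acos (x / r)).
  assert (acos (x / r) <> 0).
  { intros E0; rewrite E0, sin_0, Rabs_left in Hs'; lra. }
  repeat split; try lra.
  unfold polar.
  replace (2 * PI - acos (x / r)) with (- acos (x / r) + 2 * INR 1 * PI) by (simpl; ring).
  rewrite cos_period, sin_period, cos_neg, sin_neg, Hc.
  f_equal; rewrite Rabs_left in Hs'; lra.
Qed.

Lemma sin_3_sign_0 th : 0 < th < PI / 3 -> 0 < sin (3 * th).
Proof. intros H; apply sin_gt_0; lra. Qed.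

Lemma sin_3_shift th : sin (3 * th) = - sin (3 * (th - PI / 3)).
Proof.
replace (3 * th) with (3 * (th - PI / 3) + PI) by field.
apply neg_sin.
Qed.

Lemma sin_3_shift2 th : sin (3 * th) = sin (3 * (th - 2 * PI / 3)).
Proof. rewrite sin_3_shift, (sin_3_shift (th - PI / 3)), Ropp_involutive; do 2 f_equal; field. Qed.

Lemma locally_C_near (w : C) (P : C -> Prop) : locally w P ->
  exists eps, 0 < eps /\ forall v : C,
    Rabs (Re v - Re w) < eps -> Rabs (Im v - Im w) < eps -> P v.
Proof.
intros [e He]; exists e; split; [apply cond_pos |].
intros v H1 H2; apply He; split; easy.
Qed.

Lemma continuous_C (g : R -> C) t :
  continuous (fun u => Re (g u)) t -> continuous (fun u => Im (g u)) t -> continuous g t.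
Proof.
intros H1 H2 P [e He].
assert (K1 := H1 _ (locally_ball (Re (g t)) e)).
assert (K2 := H2 _ (locally_ball (Im (g t)) e)).
unfold filtermap in *.
generalize (filter_and _ _ K1 K2); apply filter_imp.
intros u [U1 U2]; apply He; split; easy.
Qed.

Lemma sector_path_1 a b t : sector_path 1 a b t =
  if Rle_dec t (-1) then polar (- t) b
  else if Rle_dec 1 t then polar t a
  else polar 1 ((a + b) / 2 - t * ((b - a) / 2)).
Proof.
unfold sector_path; destruct (Rle_dec t (- (1))), (Rle_dec t (-1)); try lra; try easy.
destruct (Rle_dec 1 t); [easy |]; f_equal; field.
Qed.

(** One sector of opening [PI / 3], bounded by two rays of a domain [D] of
    [{|lambda| > 1}] beyond which [D] does not extend. *)
Definition sector_of (D : C -> Prop) (a b : R) : Prop :=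
  0 <= a /\ b = a + PI / 3 /\ b < 2 * PI /\
  (forall w, D w -> 1 < Cmod w) /\
  (forall r th, 1 < r -> a < th < b -> D (polar r th)) /\
  (forall r th, 0 < r -> a - PI / 3 < th <= a -> ~ D (polar r th)) /\
  (forall r th, 0 < r -> b <= th < b + PI / 3 -> ~ D (polar r th)).

Lemma sector_path_polar a b t : a < b -> exists r th,
  1 <= r /\ a <= th <= b /\ sector_path 1 a b t = polar r th /\
  (r = 1 \/ th = a \/ th = b) /\
  (t <= -1 -> th = b /\ r = - t) /\ (1 <= t -> th = a /\ r = t) /\
  (-1 <= t <= 1 -> r = 1 /\ th = (a + b) / 2 - t * ((b - a) / 2)).
Proof.
intros Hab; rewrite sector_path_1.
destruct (Rle_dec t (-1)).
{ exists (- t), b; repeat split; auto; try lra.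
  assert (t = -1) by lra; subst t; lra. }
destruct (Rle_dec 1 t).
{ exists t, a; repeat split; auto; try lra.
  assert (t = 1) by lra; subst t; lra. }
exists 1, ((a + b) / 2 - t * ((b - a) / 2)); repeat split; auto; try nra; lra.
Qed.

Lemma sector_path_onto a b r th : a < b -> 1 <= r -> a <= th <= b ->
  (r = 1 \/ th = a \/ th = b) -> exists t, sector_path 1 a b t = polar r th.
Proof.
intros Hab Hr Hth [E | [E | E]].
- exists (((a + b) / 2 - th) / ((b - a) / 2)).
  set (t := _ / _).
  assert (Et : t * ((b - a) / 2) = (a + b) / 2 - th) by (unfold t; field; lra).
  rewrite sector_path_1.
  destruct (Rle_dec t (-1)) as [H | H].
  + assert (t = -1) by nra. rewrite H0 in *. f_equal; lra.
  + destruct (Rle_dec 1 t) as [H' | H'].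
    * assert (t = 1) by nra. rewrite H0 in *. f_equal; lra.
    * rewrite E; f_equal. rewrite Et; ring.
- exists r; rewrite sector_path_1.
  destruct (Rle_dec r (-1)); [lra |]. destruct (Rle_dec 1 r); [| lra]. rewrite E; easy.
- exists (- r); rewrite sector_path_1.
  destruct (Rle_dec (- r) (-1)); [| lra]. rewrite E; f_equal; ring.
Qed.

Lemma sector_path_inj a b a' b' s t : a < b -> a' < b' -> 0 <= a -> 0 <= a' ->
  b < 2 * PI -> b' < 2 * PI ->
  sector_path 1 a b s = sector_path 1 a' b' t ->
  (b < a' -> False) /\ (b' < a -> False) /\ (a = a' -> b = b' -> s = t).
Proof.
intros Hab Hab' Ha Ha' Hb Hb' E.
destruct (sector_path_polar a b s Hab) as (r & th & Hr & Hth & E1 & _ & S1 & S2 & S3).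
destruct (sector_path_polar a' b' t Hab') as (r' & th' & Hr' & Hth' & E2 & _ & T1 & T2 & T3).
rewrite E1, E2 in E.
apply polar_inj in E; try lra.
destruct E as [<- <-].
split; [lra |]. split; [lra |].
intros <- <-.
destruct (Rle_dec s (-1)) as [Hs | Hs], (Rle_dec t (-1)) as [Ht | Ht].
- generalize (S1 Hs) (T1 Ht); lra.
- generalize (S1 Hs); intros [? ?].
  destruct (Rle_dec 1 t) as [Ht' | Ht'].
  + generalize (T2 Ht'); lra.
  + assert (K : -1 <= t <= 1) by lra; generalize (T3 K); intros [? ?]; nra.
- generalize (T1 Ht); intros [? ?].
  destruct (Rle_dec 1 s) as [Ht' | Ht'].
  + generalize (S2 Ht'); lra.
  + assert (K : -1 <= s <= 1) by lra; generalize (S3 K); intros [? ?]; nra.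
- destruct (Rle_dec 1 s) as [Hs' | Hs'], (Rle_dec 1 t) as [Ht' | Ht'].
  + generalize (S2 Hs') (T2 Ht'); lra.
  + assert (K : -1 <= t <= 1) by lra; generalize (T3 K) (S2 Hs'); intros [? ?] [? ?]; nra.
  + assert (K : -1 <= s <= 1) by lra; generalize (S3 K) (T2 Ht'); intros [? ?] [? ?]; nra.
  + assert (K : -1 <= s <= 1) by lra; assert (K' : -1 <= t <= 1) by lra.
    generalize (S3 K) (T3 K'); intros [? ?] [? ?]; nra.
Qed.

Lemma sector_path_unfold a b t :
  sector_path 1 a b t =
  polar (Rmax 1 (Rabs t)) ((a + b) / 2 - Rmax (-1) (Rmin 1 t) * ((b - a) / 2)).
Proof.
rewrite sector_path_1.
destruct (Rle_dec t (-1)).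
{ rewrite Rabs_left, Rmax_right, Rmin_right, (Rmax_left (-1)) by lra. f_equal; lra. }
destruct (Rle_dec 1 t).
{ rewrite Rabs_pos_eq, Rmax_right, Rmin_left, (Rmax_right (-1)) by lra. f_equal; lra. }
assert (Rabs t <= 1) by (apply Rabs_le; lra).
rewrite Rmax_left, Rmin_right, (Rmax_right (-1)) by lra. f_equal; lra.
Qed.

Lemma continuous_Rmax (f g : R -> R) t :
  continuous f t -> continuous g t -> continuous (fun u => Rmax (f u) (g u)) t.
Proof.
intros Hf Hg.
apply continuous_ext with (fun u => (f u + g u + Rabs (f u - g u)) / 2).
{ intros u; unfold Rmax; destruct (Rle_dec (f u) (g u)).
  - rewrite Rabs_left1 by lra; simpl; lra.
  - rewrite Rabs_pos_eq by lra; simpl; lra. }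
apply (continuous_mult (K := R_AbsRing)); [| apply continuous_const].
apply (continuous_plus (V := R_NormedModule)).
- apply (continuous_plus (V := R_NormedModule)); easy.
- apply continuous_comp; [| apply continuous_Rabs].
  apply (continuous_minus (V := R_NormedModule)); easy.
Qed.

Lemma continuous_sector_path a b t : continuous (sector_path 1 a b) t.
Proof.
apply continuous_ext with (fun t =>
  polar (Rmax 1 (Rabs t)) ((a + b) / 2 - Rmax (-1) (Rmin 1 t) * ((b - a) / 2))).
{ intros u; rewrite sector_path_unfold; easy. }
assert (Hr : continuous (fun t => Rmax 1 (Rabs t)) t).
{ apply continuous_Rmax; [apply continuous_const | apply continuous_Rabs]. }
assert (Ht : continuous (fun t => (a + b) / 2 - Rmax (-1) (Rmin 1 t) * ((b - a) / 2)) t).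
{ apply (continuous_minus (V := R_NormedModule)); [apply continuous_const |].
  apply (continuous_mult (K := R_AbsRing)); [| apply continuous_const].
  apply continuous_Rmax; [apply continuous_const |].
  apply continuous_ext with (fun u => - Rmax (-1) (- u)).
  { intros u. unfold Rmax, Rmin; destruct (Rle_dec (-1) (- u)), (Rle_dec 1 u); lra. }
  apply (continuous_opp (V := R_NormedModule)), continuous_Rmax; [apply continuous_const |].
  apply (continuous_opp (V := R_NormedModule)), continuous_id. }
apply continuous_C; unfold polar; simpl.
- apply (continuous_mult (K := R_AbsRing)); [easy |].
  apply continuous_comp; [easy | apply continuous_cos].
- apply (continuous_mult (K := R_AbsRing)); [easy |].
  apply continuous_comp; [easy | apply continuous_sin].
Qed.

Lemma sector_frontier D a b t : sector_of D a b -> frontier D (sector_path 1 a b t).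
Proof.
intros (Ha & Hb & Hb2 & H1 & Hin & Hl & Hr).
assert (Hpi := PI_RGT_0).
destruct (sector_path_polar a b t) as (r & th & Gr & Gth & -> & Hbd & _); [lra |].
split.
- intros P HP.
  set (g := fun s => polar (r + s) (th + s * ((a + b) / 2 - th))).
  assert (Cg : continuous g 0).
  { assert (C1 : continuous (fun s => r + s) 0).
    { apply (continuous_plus (V := R_NormedModule)); [apply continuous_const | apply continuous_id]. }
    assert (C2 : continuous (fun s => th + s * ((a + b) / 2 - th)) 0).
    { apply (continuous_plus (V := R_NormedModule)); [apply continuous_const |].
      apply (continuous_mult (K := R_AbsRing)); [apply continuous_id | apply continuous_const]. }
    apply continuous_C; unfold g, polar; simpl.
    - apply (continuous_mult (K := R_AbsRing)); [easy |].
      apply continuous_comp; [easy | apply continuous_cos].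
    - apply (continuous_mult (K := R_AbsRing)); [easy |].
      apply continuous_comp; [easy | apply continuous_sin]. }
  assert (Eg : g 0 = polar r th) by (unfold g; f_equal; ring).
  rewrite <- Eg in HP.
  destruct (Cg P HP) as [e He].
  assert (He0 := cond_pos e).
  set (s := Rmin (e / 2) (1 / 2)).
  assert (Hs : 0 < s /\ s < e /\ s < 1).
  { unfold s; split; [apply Rmin_glb_lt; lra |].
    generalize (Rmin_l (e / 2) (1 / 2)) (Rmin_r (e / 2) (1 / 2)); lra. }
  exists (g s); split.
  + apply He; change (Rabs (s - 0) < e); rewrite Rminus_0_r, Rabs_pos_eq; lra.
  + apply Hin; [lra |]; split; nra.
- intros P HP; exists (polar r th); split; [apply locally_singleton, HP |].
  intros HD; destruct Hbd as [E | [E | E]].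
  + apply H1 in HD; rewrite Cmod_polar in HD; lra.
  + revert HD; apply Hl; lra.
  + revert HD; apply Hr; lra.
Qed.

Lemma path_deriv_val (g : R -> C) (t x y : R) :
  is_derive (fun u => Re (g u)) t x -> is_derive (fun u => Im (g u)) t y ->
  path_deriv g t = (x, y).
Proof.
intros H1 H2; unfold path_deriv.
exact (f_equal2 pair (is_derive_unique _ _ _ H1) (is_derive_unique _ _ _ H2)).
Qed.

Lemma polar_side a t s : 0 < t ->
  (polar t a + RtoC s * (Ci * polar 1 a))%C
  = polar (sqrt (t * t + s * s)) (a + atan (s / t)).
Proof.
intros Ht.
assert (Hq : 0 < sqrt (t * t + s * s)) by (apply sqrt_lt_R0; nra).
assert (Hq2 : sqrt (t * t + s * s) = t * sqrt (1 + Rsqr (s / t))).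
{ replace (t * t + s * s) with (t * t * (1 + Rsqr (s / t))) by (unfold Rsqr; field; lra).
  rewrite sqrt_mult_alt, sqrt_square by nra; easy. }
assert (Hq3 : 0 < sqrt (1 + Rsqr (s / t))).
{ apply sqrt_lt_R0; generalize (Rle_0_sqr (s / t)); lra. }
unfold polar; rewrite cos_plus, sin_plus, cos_atan, sin_atan, Hq2.
unfold Cplus, Cmult, Ci, RtoC; simpl; f_equal; field; lra.
Qed.

Lemma atan_side t : 1 < t -> exists eta, 0 < eta /\ forall s, 0 < s < eta ->
  0 < atan (s / t) < PI / 3.
Proof.
intros Ht; exists 1; split; [lra |].
intros s Hs.
assert (0 < s / t) by (apply Rdiv_lt_0_compat; lra).
assert (s / t < 1) by (apply Rlt_div_l; lra).
assert (Hpi := PI_RGT_0).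
split.
- rewrite <- atan_0; apply atan_increasing; easy.
- apply Rlt_trans with (PI / 4); [rewrite <- atan_1; apply atan_increasing; easy | lra].
Qed.

Lemma sector_left D a b : sector_of D a b ->
  forall t, ~ In t (-1 :: 1 :: nil) ->
  let gamma := sector_path 1 a b in
       ex_derive (fun u => Re (gamma u)) t /\
       ex_derive (fun u => Im (gamma u)) t /\
       path_deriv gamma t <> RtoC 0 /\
       exists eta, 0 < eta /\ forall s, 0 < s < eta ->
         D (gamma t + RtoC s * (Ci * path_deriv gamma t))%C /\
         ~ D (gamma t - RtoC s * (Ci * path_deriv gamma t))%C.
Proof.
intros (Ha & Hb & Hb2 & H1 & Hin & Hl & Hr) t Ht gamma.
assert (Hpi := PI_RGT_0).
assert (t <> -1) by (intros E; apply Ht; rewrite E; simpl; auto).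
assert (t <> 1) by (intros E; apply Ht; rewrite E; simpl; auto).
assert (K : forall r th dr dth,
  locally t (fun u => gamma u = polar (r u) (th u)) ->
  is_derive r t dr -> is_derive th t dth ->
  is_derive (fun u => Re (gamma u)) t (dr * cos (th t) - r t * dth * sin (th t)) /\
  is_derive (fun u => Im (gamma u)) t (dr * sin (th t) + r t * dth * cos (th t))).
{ intros r th dr dth HL D1 D2.
  assert (E1 := is_derive_unique _ _ _ D1); assert (E2 := is_derive_unique _ _ _ D2).
  assert (X1 : ex_derive r t) by (eexists; exact D1).
  assert (X2 : ex_derive th t) by (eexists; exact D2).
  split.
  - apply is_derive_ext_loc with (fun u => r u * cos (th u)).
    { revert HL; apply filter_imp; intros u ->; easy. }
    auto_derive; [easy |].
    replace (Derive (fun x => r x) t) with dr by (symmetry; exact E1).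
    replace (Derive (fun x => th x) t) with dth by (symmetry; exact E2). ring.
  - apply is_derive_ext_loc with (fun u => r u * sin (th u)).
    { revert HL; apply filter_imp; intros u ->; easy. }
    auto_derive; [easy |].
    replace (Derive (fun x => r x) t) with dr by (symmetry; exact E1).
    replace (Derive (fun x => th x) t) with dth by (symmetry; exact E2). ring. }
destruct (Rlt_dec t (-1)) as [T1 | T1]; [| destruct (Rlt_dec 1 t) as [T2 | T2]].
- destruct (K (fun u => - u) (fun _ => b) (-1) 0) as [D1 D2].
  { generalize (open_lt (-1) t T1); apply filter_imp; intros u Hu.
    unfold gamma; rewrite sector_path_1; destruct (Rle_dec u (-1)); [easy | lra]. }
  { auto_derive; [easy | ring]. }
  { auto_derive; easy. }
  assert (E : path_deriv gamma t = (- polar 1 b)%C).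
  { rewrite (path_deriv_val _ _ _ _ D1 D2); unfold polar, Copp; simpl; f_equal; ring. }
  assert (G : gamma t = polar (- t) b).
  { unfold gamma; rewrite sector_path_1; destruct (Rle_dec t (-1)); [easy | lra]. }
  split; [eexists; exact D1 |]. split; [eexists; exact D2 |].
  rewrite E, G; split.
  { intros F.
    assert (Cmod (- polar 1 b) = 0) by (rewrite F; apply Cmod_0).
    rewrite Cmod_opp, Cmod_polar in *; lra. }
  destruct (atan_side (- t)) as [eta [He HA]]; [lra |].
  exists eta; split; [easy |]; intros s Hs; specialize (HA s Hs).
  assert (Hsq : forall s, 1 < sqrt (- t * - t + s * s)).
  { intros s'; rewrite <- sqrt_1 at 1; apply sqrt_lt_1_alt; nra. }
  split.
  + replace (polar (- t) b + RtoC s * (Ci * - polar 1 b))%C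
      with (polar (- t) b + RtoC (- s) * (Ci * polar 1 b))%C by (rewrite RtoC_opp; ring).
    rewrite polar_side by lra.
    apply Hin; [apply Hsq |].
    unfold Rdiv in *; rewrite Ropp_mult_distr_l_reverse, atan_opp; lra.
  + replace (polar (- t) b - RtoC s * (Ci * - polar 1 b))%C
      with (polar (- t) b + RtoC s * (Ci * polar 1 b))%C by ring.
    rewrite polar_side by lra.
    apply Hr; [generalize (Hsq s); lra | lra].
- destruct (K (fun u => u) (fun _ => a) 1 0) as [D1 D2].
  { generalize (open_gt 1 t T2); apply filter_imp; intros u Hu.
    unfold gamma; rewrite sector_path_1; destruct (Rle_dec u (-1)); [lra |].
    destruct (Rle_dec 1 u); [easy | lra]. }
  { auto_derive; easy. }
  { auto_derive; easy. }
  assert (E : path_deriv gamma t = polar 1 a).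
  { rewrite (path_deriv_val _ _ _ _ D1 D2); unfold polar; simpl; f_equal; ring. }
  assert (G : gamma t = polar t a).
  { unfold gamma; rewrite sector_path_1; destruct (Rle_dec t (-1)); [lra |].
    destruct (Rle_dec 1 t); [easy | lra]. }
  split; [eexists; exact D1 |]. split; [eexists; exact D2 |].
  rewrite E, G; split.
  { intros F.
    assert (Cmod (polar 1 a) = 0) by (rewrite F; apply Cmod_0).
    rewrite Cmod_polar in *; lra. }
  destruct (atan_side t) as [eta [He HA]]; [lra |].
  exists eta; split; [easy |]; intros s Hs; specialize (HA s Hs).
  assert (Hsq : forall s, 1 < sqrt (t * t + s * s)).
  { intros s'; rewrite <- sqrt_1 at 1; apply sqrt_lt_1_alt; nra. }
  split.
  + rewrite polar_side by lra.
    apply Hin; [apply Hsq | lra].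
  + replace (polar t a - RtoC s * (Ci * polar 1 a))%C
      with (polar t a + RtoC (- s) * (Ci * polar 1 a))%C by (rewrite RtoC_opp; ring).
    rewrite polar_side by lra.
    apply Hl; [generalize (Hsq (- s)); lra |].
    unfold Rdiv in *; rewrite Ropp_mult_distr_l_reverse, atan_opp; lra.
- set (k := (b - a) / 2).
  set (th := fun u => (a + b) / 2 - u * k).
  assert (Hk : 0 < k) by (unfold k; lra).
  destruct (K (fun u => 1) th 0 (- k)) as [D1 D2].
  { assert (Ho : locally t (fun u => -1 < u /\ u < 1)).
    { apply filter_and; [apply open_gt; lra | apply open_lt; lra]. }
    revert Ho; apply filter_imp; intros u Hu.
    unfold gamma; rewrite sector_path_1; destruct (Rle_dec u (-1)); [lra |].
    destruct (Rle_dec 1 u); [lra | easy]. }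
  { auto_derive; easy. }
  { unfold th; auto_derive; [easy | field]. }
  assert (E : path_deriv gamma t = (- (RtoC k * (Ci * polar 1 (th t))))%C).
  { rewrite (path_deriv_val _ _ _ _ D1 D2); unfold polar, Copp, Cmult, Ci, RtoC; simpl; f_equal; ring. }
  assert (G : gamma t = polar 1 (th t)).
  { unfold gamma; rewrite sector_path_1; destruct (Rle_dec t (-1)); [lra |].
    destruct (Rle_dec 1 t); [lra | easy]. }
  assert (Hth : a < th t < b) by (unfold th, k; split; nra).
  assert (Em : forall r, (RtoC r * polar 1 (th t))%C = polar r (th t)).
  { intros r; unfold polar, Cmult, RtoC; simpl; f_equal; ring. }
  split; [eexists; exact D1 |]. split; [eexists; exact D2 |].
  rewrite E, G; split.
  { intros F.
    assert (F' : Cmod (- (RtoC k * (Ci * polar 1 (th t)))) = 0) by (rewrite F; apply Cmod_0).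
    rewrite Cmod_opp, !Cmod_mult, Cmod_R, Cmod_polar in F' by lra.
    replace (Cmod Ci) with 1 in F'.
    - rewrite Rabs_pos_eq in F'; lra.
    - unfold Cmod, Ci; simpl. replace (0 * (0 * 1) + 1 * (1 * 1)) with 1 by ring.
      symmetry; apply sqrt_1. }
  exists (1 / k).
  split; [apply Rdiv_lt_0_compat; lra |].
  intros s [Hs Hs2].
  assert (s * k < 1) by (apply Rlt_div_r; easy).
  assert (0 < s * k) by nra.
  assert (Ci2 : (Ci * Ci)%C = (- RtoC 1)%C).
  { unfold Ci, Cmult, Copp, RtoC; simpl; f_equal; ring. }
  split.
  + replace (polar 1 (th t) + RtoC s * (Ci * - (RtoC k * (Ci * polar 1 (th t)))))%C
      with (RtoC (1 + s * k) * polar 1 (th t))%C.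
    2: { rewrite RtoC_plus, RtoC_mult.
         transitivity (polar 1 (th t) - (Ci * Ci) * (RtoC s * RtoC k * polar 1 (th t)))%C;
           [rewrite Ci2 |]; ring. }
    rewrite Em; apply Hin; lra.
  + replace (polar 1 (th t) - RtoC s * (Ci * - (RtoC k * (Ci * polar 1 (th t)))))%C
      with (RtoC (1 - s * k) * polar 1 (th t))%C.
    2: { rewrite RtoC_minus, RtoC_mult.
         transitivity (polar 1 (th t) + (Ci * Ci) * (RtoC s * RtoC k * polar 1 (th t)))%C;
           [rewrite Ci2 |]; ring. }
    rewrite Em; intros HD; apply H1 in HD; rewrite Cmod_polar in HD; lra.
Qed.

Lemma frontier_closed D (g : C -> R) w :
  (forall v, continuous g v) -> (forall v, D v -> 0 <= g v) -> frontier D w -> 0 <= g w.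
Proof.
intros Cg Hg [F _].
destruct (Rle_lt_dec 0 (g w)) as [H | H]; [easy |].
destruct (F (fun v => g v < 0)) as [v [H1 H2]].
- apply (Cg w (fun y => y < 0)). apply open_lt, H.
- apply Hg in H2; lra.
Qed.

Lemma frontier_open D (g1 g2 g3 : C -> R) w :
  (forall v, continuous g1 v) -> (forall v, continuous g2 v) -> (forall v, continuous g3 v) ->
  (forall v, 0 < g1 v -> 0 < g2 v -> 0 < g3 v -> D v) -> frontier D w ->
  ~ (0 < g1 w /\ 0 < g2 w /\ 0 < g3 w).
Proof.
intros C1 C2 C3 HD [_ F] (H1 & H2 & H3).
destruct (F (fun v => 0 < g1 v /\ 0 < g2 v /\ 0 < g3 v)) as [v [H4 H5]].
- apply filter_and; [| apply filter_and].
  + apply (C1 w (fun y => 0 < y)), open_gt, H1.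
  + apply (C2 w (fun y => 0 < y)), open_gt, H2.
  + apply (C3 w (fun y => 0 < y)), open_gt, H3.
- apply H5, HD; easy.
Qed.

Lemma frontier_polar D (g1 g2 : C -> R) w :
  (forall v, continuous g1 v) -> (forall v, continuous g2 v) ->
  (forall v, D v <-> 0 < g1 v /\ 0 < g2 v /\ 1 < Cmod v) -> frontier D w ->
  exists r th, 1 <= r /\ 0 <= th < 2 * PI /\ w = polar r th /\
    0 <= g1 w /\ 0 <= g2 w /\ (r = 1 \/ g1 w = 0 \/ g2 w = 0).
Proof.
intros C1 C2 HD F.
assert (C3 : forall v : C, continuous (fun v => Cmod v - 1) v).
{ intros v; apply (continuous_minus (V := R_NormedModule)); [| apply continuous_const].
  apply (filterlim_norm (K := C_AbsRing) (V := C_NormedModule)). }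
assert (P1 : 0 <= g1 w).
{ apply (frontier_closed D); try easy; intros v Hv; apply HD in Hv; lra. }
assert (P2 : 0 <= g2 w).
{ apply (frontier_closed D); try easy; intros v Hv; apply HD in Hv; lra. }
assert (P3 : 0 <= Cmod w - 1).
{ apply (frontier_closed D (fun v => Cmod v - 1)); try easy; intros v Hv; apply HD in Hv; lra. }
destruct (polar_ex w) as (r & th & Hr & Hth & E).
{ intros E; rewrite E, Cmod_0 in P3; lra. }
exists r, th.
assert (Em : Cmod w = r) by (rewrite E; apply Cmod_polar; lra).
repeat split; try easy; try lra.
assert (N := frontier_open D g1 g2 (fun v => Cmod v - 1) w C1 C2 C3).
destruct (Req_dec r 1); [auto |].
destruct (Req_dec (g1 w) 0); [auto |].
destruct (Req_dec (g2 w) 0); [auto |].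
exfalso; apply N; [| easy |].
- intros v ? ? ?; apply HD; lra.
- rewrite Em; lra.
Qed.

Definition cubic_factor (w : C) : R := 3 * (Re w * Re w) - Im w * Im w.

Lemma Im_cube (w : C) : Im (w ^ 3)%C = Im w * cubic_factor w.
Proof.
destruct w as [x y]; unfold cubic_factor, Im, Re; simpl; ring.
Qed.

Lemma Re_mi_cube (w : C) : Re (- Ci * w ^ 3)%C = Im w * cubic_factor w.
Proof.
destruct w as [x y]; unfold cubic_factor, Im, Re; simpl; ring.
Qed.

Lemma polar_factor r th : r * sin th * cubic_factor (polar r th) = r ^ 3 * sin (3 * th).
Proof.
change (Im (polar r th) * cubic_factor (polar r th) = Im (polar (r ^ 3) (3 * th))).
rewrite <- Im_cube, polar_cube; easy.
Qed.

Lemma continuous_Im (v : C) : continuous (fun w : C => Im w) v.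
Proof. apply (continuous_snd (U := R_UniformSpace) (V := R_UniformSpace)). Qed.

Lemma continuous_factor (v : C) : continuous cubic_factor v.
Proof.
assert (H : continuous (fun w : C => Re w) v).
{ apply (continuous_fst (U := R_UniformSpace) (V := R_UniformSpace)). }
assert (H' := continuous_Im v).
apply (continuous_minus (V := R_NormedModule)).
- apply (continuous_mult (K := R_AbsRing)); [apply continuous_const |].
  apply (continuous_mult (K := R_AbsRing)); easy.
- apply (continuous_mult (K := R_AbsRing)); easy.
Qed.

Lemma continuous_Ropp (g : C -> R) v : continuous g v -> continuous (fun w => - g w) v.
Proof. intros H; apply (continuous_opp (V := R_NormedModule)), H. Qed.

Lemma sin3_pos th :
  - (2 * PI / 3) < th < - (PI / 3) \/ 0 < th < PI / 3 \/ 2 * PI / 3 < th < PI \/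
  4 * PI / 3 < th < 5 * PI / 3 -> 0 < sin (3 * th).
Proof.
assert (Hpi := PI_RGT_0).
intros [H | [H | [H | H]]].
- rewrite <- (Ropp_involutive th) in H |- *.
  replace (3 * - - th) with (- (3 * - th)) by ring.
  rewrite sin_neg, sin_3_shift.
  assert (0 < sin (3 * (- th - PI / 3))) by (apply sin_3_sign_0; lra); lra.
- apply sin_3_sign_0, H.
- rewrite sin_3_shift2; apply sin_3_sign_0; lra.
- rewrite sin_3_shift2, sin_3_shift2; apply sin_3_sign_0; lra.
Qed.

Lemma sin3_neg th :
  - (PI / 3) < th < 0 \/ PI / 3 < th < 2 * PI / 3 \/ PI < th < 4 * PI / 3 \/
  5 * PI / 3 < th < 2 * PI -> sin (3 * th) < 0.
Proof.
assert (Hpi := PI_RGT_0).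
intros H; rewrite sin_3_shift.
assert (0 < sin (3 * (th - PI / 3))) by (apply sin3_pos; lra); lra.
Qed.

Lemma sin3_0 th : th = 0 \/ th = PI / 3 \/ th = 2 * PI / 3 \/ th = PI \/
  th = 4 * PI / 3 \/ th = 5 * PI / 3 -> sin (3 * th) = 0.
Proof.
assert (S0 : sin (3 * 0) = 0) by (rewrite Rmult_0_r; apply sin_0).
assert (S1 : sin (3 * (PI / 3)) = 0) by (replace (3 * (PI / 3)) with PI by field; apply sin_PI).
intros [H | [H | [H | [H | [H | H]]]]]; subst th; try easy; rewrite sin_3_shift2;
  [ replace (2 * PI / 3 - 2 * PI / 3) with 0 by field
  | replace (PI - 2 * PI / 3) with (PI / 3) by field
  | rewrite sin_3_shift2; replace (4 * PI / 3 - 2 * PI / 3 - 2 * PI / 3) with 0 by field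
  | rewrite sin_3_shift2; replace (5 * PI / 3 - 2 * PI / 3 - 2 * PI / 3) with (PI / 3) by field ];
  easy.
Qed.

Lemma cube_polar r th : Im (polar r th ^ 3)%C = r ^ 3 * sin (3 * th).
Proof. rewrite polar_cube; easy. Qed.

Lemma mi_cube_polar r th : Re (- Ci * polar r th ^ 3)%C = r ^ 3 * sin (3 * th).
Proof. rewrite Re_mi_cube, <- Im_cube; apply cube_polar. Qed.

Lemma sector_FI_1 : sector_of D_FI_plus 0 (PI / 3).
Proof.
assert (Hpi := PI_RGT_0).
repeat split; try lra.
- intros w Hw; apply Hw.
- simpl; apply Rmult_lt_0_compat; [lra | apply sin_gt_0; lra].
- rewrite cube_polar; apply Rmult_lt_0_compat; [apply pow_lt; lra | apply sin3_pos; lra].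
- rewrite Cmod_polar; lra.
- intros r th Hr Hth (H & _); simpl in H.
  assert (sin th <= 0).
  { destruct (Req_dec th 0) as [-> | ?]; [rewrite sin_0; lra |].
    apply Rlt_le, sin_lt_0_var; lra. }
  nra.
- intros r th Hr Hth (_ & H & _); rewrite cube_polar in H.
  assert (0 < r ^ 3) by (apply pow_lt; lra).
  assert (sin (3 * th) <= 0).
  { destruct (Req_dec th (PI / 3)) as [-> | ?]; [rewrite sin3_0; lra |].
    apply Rlt_le, sin3_neg; lra. }
  nra.
Qed.

Lemma sector_FI_2 : sector_of D_FI_plus (2 * PI / 3) PI.
Proof.
assert (Hpi := PI_RGT_0).
repeat split; try lra.
- intros w Hw; apply Hw.
- simpl; apply Rmult_lt_0_compat; [lra | apply sin_gt_0; lra].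
- rewrite cube_polar; apply Rmult_lt_0_compat; [apply pow_lt; lra | apply sin3_pos; lra].
- rewrite Cmod_polar; lra.
- intros r th Hr Hth (_ & H & _); rewrite cube_polar in H.
  assert (0 < r ^ 3) by (apply pow_lt; lra).
  assert (sin (3 * th) <= 0).
  { destruct (Req_dec th (2 * PI / 3)) as [-> | ?]; [rewrite sin3_0; lra |].
    apply Rlt_le, sin3_neg; lra. }
  nra.
- intros r th Hr Hth (H & _); simpl in H.
  assert (sin th <= 0).
  { destruct (Req_dec th PI) as [-> | ?]; [rewrite sin_PI; lra |].
    apply Rlt_le, sin_lt_0; lra. }
  nra.
Qed.

Lemma sector_FI_3 : sector_of D_FI_minus (4 * PI / 3) (5 * PI / 3).
Proof.
assert (Hpi := PI_RGT_0).
assert (K : forall r th, 0 < r -> D_FI_minus (polar r th) -> 0 < sin (3 * th)).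
{ intros r th Hr (_ & H & _); rewrite cube_polar in H.
  assert (0 < r ^ 3) by (apply pow_lt; lra). nra. }
repeat split; try lra.
- intros w Hw; apply Hw.
- simpl; assert (sin th < 0) by (apply sin_lt_0; lra). nra.
- rewrite cube_polar; apply Rmult_lt_0_compat; [apply pow_lt; lra | apply sin3_pos; lra].
- rewrite Cmod_polar; lra.
- intros r th Hr Hth H; apply K in H; [| easy].
  destruct (Req_dec th (4 * PI / 3)) as [-> | ?]; [rewrite sin3_0 in H; lra |].
  assert (sin (3 * th) < 0) by (apply sin3_neg; lra); lra.
- intros r th Hr Hth H; apply K in H; [| easy].
  destruct (Req_dec th (5 * PI / 3)) as [-> | ?]; [rewrite sin3_0 in H; lra |].
  assert (sin (3 * th) < 0) by (apply sin3_neg; lra); lra.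
Qed.

Lemma sector_HL : sector_of D_HL_plus (PI / 3) (2 * PI / 3).
Proof.
assert (Hpi := PI_RGT_0).
assert (K : forall r th, 0 < r -> D_HL_plus (polar r th) -> sin (3 * th) < 0).
{ intros r th Hr (_ & H & _); rewrite mi_cube_polar in H.
  assert (0 < r ^ 3) by (apply pow_lt; lra). nra. }
unfold sector_of; repeat match goal with |- _ /\ _ => split end; try lra.
- intros w Hw; apply Hw.
- intros r th Hr Hth; unfold D_HL_plus; rewrite mi_cube_polar, Cmod_polar by lra.
  assert (0 < r ^ 3) by (apply pow_lt; lra).
  assert (sin (3 * th) < 0) by (apply sin3_neg; lra).
  repeat split; [| nra | lra].
  simpl; apply Rmult_lt_0_compat; [lra | apply sin_gt_0; lra].
- intros r th Hr Hth H; apply K in H; [| easy].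
  destruct (Req_dec th (PI / 3)) as [-> | ?]; [rewrite sin3_0 in H; lra |].
  assert (0 < sin (3 * th)).
  { destruct (Rle_dec th 0); [| apply sin3_pos; lra].
    apply sin3_pos; lra. }
  lra.
- intros r th Hr Hth H; apply K in H; [| easy].
  destruct (Req_dec th (2 * PI / 3)) as [-> | ?]; [rewrite sin3_0 in H; lra |].
  assert (0 < sin (3 * th)) by (apply sin3_pos; lra); lra.
Qed.

Lemma factor_sign r th : 0 < r -> 0 <= th < 2 * PI ->
  let q := cubic_factor (polar r th) in
  let s := r * sin th in
  (th = 0 /\ s = 0 /\ 0 < q) \/ (0 < th < PI / 3 /\ 0 < s /\ 0 < q) \/
  (th = PI / 3 /\ 0 < s /\ q = 0) \/ (PI / 3 < th < 2 * PI / 3 /\ 0 < s /\ q < 0) \/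
  (th = 2 * PI / 3 /\ 0 < s /\ q = 0) \/ (2 * PI / 3 < th < PI /\ 0 < s /\ 0 < q) \/
  (th = PI /\ s = 0 /\ 0 < q) \/ (PI < th < 4 * PI / 3 /\ s < 0 /\ 0 < q) \/
  (th = 4 * PI / 3 /\ s < 0 /\ q = 0) \/
  (4 * PI / 3 < th < 5 * PI / 3 /\ s < 0 /\ q < 0) \/
  (th = 5 * PI / 3 /\ s < 0 /\ q = 0) \/ (5 * PI / 3 < th /\ s < 0 /\ 0 < q).
Proof.
intros Hr Hth q s.
assert (Hpi := PI_RGT_0).
assert (E : s * q = r ^ 3 * sin (3 * th)) by (apply polar_factor).
assert (Hr3 : 0 < r ^ 3) by (apply pow_lt; lra).
assert (Sp : 0 < th < PI -> 0 < s).
{ intros H; apply Rmult_lt_0_compat; [easy | apply sin_gt_0; lra]. }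
assert (Sn : PI < th < 2 * PI -> s < 0).
{ intros H; unfold s; assert (sin th < 0) by (apply sin_lt_0; lra); nra. }
assert (H3p := sin3_pos th); assert (H3n := sin3_neg th); assert (H30 := sin3_0 th).
assert (Q0 : forall c, cos th = c -> sin th = 0 -> c * c = 1 -> s = 0 /\ 0 < q).
{ intros c Hc Hs Hcc; unfold s, q, cubic_factor, polar; simpl.
  rewrite Hs, Hc; split; [ring | nra]. }
destruct (Req_dec th 0) as [H0 | H0].
{ left; split; [easy |]; apply (Q0 1); [rewrite H0; apply cos_0 | rewrite H0; apply sin_0 | ring]. }
destruct (Req_dec th PI) as [H1 | H1].
{ do 6 right; left; split; [easy |].
  apply (Q0 (-1)); [rewrite H1; apply cos_PI | rewrite H1; apply sin_PI | ring]. }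
assert (Cp : s > 0 -> 0 < sin (3 * th) -> 0 < q) by (intros; nra).
assert (Cn : s > 0 -> sin (3 * th) < 0 -> q < 0) by (intros; nra).
assert (Cp' : s < 0 -> 0 < sin (3 * th) -> q < 0) by (intros; nra).
assert (Cn' : s < 0 -> sin (3 * th) < 0 -> 0 < q) by (intros; nra).
assert (C0 : s <> 0 -> sin (3 * th) = 0 -> q = 0).
{ intros K K'; rewrite K', Rmult_0_r in E; apply Rmult_integral in E; tauto. }
destruct (Rlt_dec th PI) as [H2 | H2].
- assert (0 < s) by (apply Sp; lra).
  destruct (Req_dec th (PI / 3)).
  { do 2 right; left; repeat split; try easy; apply C0; [lra |]; apply H30; lra. }
  destruct (Req_dec th (2 * PI / 3)).
  { do 4 right; left; repeat split; try easy; apply C0; [lra |]; apply H30; lra. }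
  destruct (Rlt_dec th (PI / 3)).
  { right; left; split; [lra |]; split; [easy |]; apply Cp; [lra |]; apply H3p; lra. }
  destruct (Rlt_dec th (2 * PI / 3)).
  { do 3 right; left; split; [lra |]; split; [easy |]; apply Cn; [lra |]; apply H3n; lra. }
  do 5 right; left; split; [lra |]; split; [easy |]; apply Cp; [lra |]; apply H3p; lra.
- assert (s < 0) by (apply Sn; lra).
  destruct (Req_dec th (4 * PI / 3)).
  { do 8 right; left; repeat split; try easy; apply C0; [lra |]; apply H30; lra. }
  destruct (Req_dec th (5 * PI / 3)).
  { do 10 right; left; repeat split; try easy; apply C0; [lra |]; apply H30; lra. }
  destruct (Rlt_dec th (4 * PI / 3)).
  { do 7 right; left; split; [lra |]; split; [easy |]; apply Cn'; [lra |]; apply H3n; lra. }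
  destruct (Rlt_dec th (5 * PI / 3)).
  { do 9 right; left; split; [lra |]; split; [easy |]; apply Cp'; [lra |]; apply H3p; lra. }
  do 11 right; split; [lra |]; split; [easy |]; apply Cn'; [lra |]; apply H3n; lra.
Qed.

Lemma oriented_boundary_1 D a b : sector_of D a b ->
  (forall w, frontier D w -> exists t, sector_path 1 a b t = w) ->
  oriented_boundary D (sector_path 1 a b :: nil).
Proof.
intros HS HF.
assert (HS' := HS); destruct HS' as (Ha & Hb & Hb2 & _).
assert (Hpi := PI_RGT_0).
split; [| split].
- intros w; split.
  + intros (g & t & [<- | []] & <-); apply sector_frontier, HS.
  + intros H; destruct (HF w H) as [t <-]; exists (sector_path 1 a b), t; simpl; auto.
- simpl; intros i j s t Hi Hj.
  replace i with O by lia; replace j with O by lia; intros E; split; [easy |].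
  apply sector_path_inj in E; lra.
- intros g [<- | []]; split; [intros t; apply continuous_sector_path |].
  exists (-1 :: 1 :: nil); apply sector_left, HS.
Qed.

Lemma Gamma_FI_plus_oriented_boundary : oriented_boundary D_FI_plus Gamma_FI_plus.
Proof.
assert (Hpi := PI_RGT_0).
split; [| split].
- intros w; split.
  + intros (g & t & [<- | [<- | []]] & <-);
      apply sector_frontier; [apply sector_FI_1 | apply sector_FI_2].
  + intros HF.
    destruct (frontier_polar D_FI_plus Im cubic_factor w) as (r & th & Hr & Hth & -> & P1 & P2 & P3);
      try easy.
    { apply continuous_Im. } { apply continuous_factor. }
    { intros v; unfold D_FI_plus; rewrite Im_cube; split; intros (? & ? & ?); repeat split; try easy; nra. }
    change (Im (polar r th)) with (r * sin th) in *.
    assert (K : (0 <= th <= PI / 3 /\ (r = 1 \/ th = 0 \/ th = PI / 3)) \/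
                (2 * PI / 3 <= th <= PI /\ (r = 1 \/ th = 2 * PI / 3 \/ th = PI))).
    { generalize (factor_sign r th); intros K; cbv zeta in K.
      specialize (K ltac:(lra) Hth). lra. }
    destruct K as [[K1 K2] | [K1 K2]].
    * destruct (sector_path_onto 0 (PI / 3) r th) as [t Ht]; try lra; try easy.
      exists (sector_path 1 0 (PI / 3)), t; simpl; auto.
    * destruct (sector_path_onto (2 * PI / 3) PI r th) as [t Ht]; try lra; try easy.
      exists (sector_path 1 (2 * PI / 3) PI), t; simpl; auto.
- simpl; intros [| [| i]] [| [| j]] s t Hi Hj E; try lia;
    apply sector_path_inj in E; try lra; (split; [easy | apply E; lra]) || (exfalso; lra).
- intros g [<- | [<- | []]]; (split; [intros t; apply continuous_sector_path |]);
    exists (-1 :: 1 :: nil); apply sector_left; [apply sector_FI_1 | apply sector_FI_2].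
Qed.

Lemma Gamma_FI_minus_oriented_boundary : oriented_boundary D_FI_minus Gamma_FI_minus.
Proof.
assert (Hpi := PI_RGT_0).
apply oriented_boundary_1; [apply sector_FI_3 |].
intros w HF.
destruct (frontier_polar D_FI_minus (fun v => - Im v) (fun v => - cubic_factor v) w)
  as (r & th & Hr & Hth & -> & P1 & P2 & P3); try easy.
{ intros v; apply continuous_Ropp, continuous_Im. }
{ intros v; apply continuous_Ropp, continuous_factor. }
{ intros v; unfold D_FI_minus; rewrite Im_cube; split; intros (? & ? & ?); repeat split; try easy; nra. }
change (Im (polar r th)) with (r * sin th) in *.
generalize (factor_sign r th); intros K; cbv zeta in K.
specialize (K ltac:(lra) Hth).
apply sector_path_onto; lra.
Qed.

Lemma Gamma_HL_plus_oriented_boundary : oriented_boundary D_HL_plus Gamma_HL_plus.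
Proof.
assert (Hpi := PI_RGT_0).
apply oriented_boundary_1; [apply sector_HL |].
intros w HF.
destruct (frontier_polar D_HL_plus Im (fun v => - cubic_factor v) w)
  as (r & th & Hr & Hth & -> & P1 & P2 & P3); try easy.
{ apply continuous_Im. }
{ intros v; apply continuous_Ropp, continuous_factor. }
{ intros v; unfold D_HL_plus; rewrite Re_mi_cube; split; intros (? & ? & ?); repeat split; try easy; nra. }
change (Im (polar r th)) with (r * sin th) in *.
generalize (factor_sign r th); intros K; cbv zeta in K.
specialize (K ltac:(lra) Hth).
apply sector_path_onto; lra.
Qed.

(* Main.v *)
Require Import Defs.
From Stdlib Require Import Reals.
From Coquelicot Require Import Coquelicot.
From Stdlib Require Import Lra Lia List ClassicalEpsilon Factorial.
Open Scope R_scope.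

(** Both operators are treated by the same argument.

    Three integrations by parts ([by_parts], [transform_third]) turn the
    transform of [S f = i f'''] at [mu] into [mu^3] times that of [f], plus
    boundary terms. The frequencies [lambda], [alpha lambda] and
    [alpha^2 lambda] have the same cube, and the combinations that define
    [F_lambda] are such that the boundary conditions and [1 + alpha + alpha^2 = 0]
    reduce the boundary terms to a remainder that is affine in [lambda], up to
    a factor [e^{-i lambda}] on the lower contour of the interval
    ([F_FI_eigen], [F_HL_eigen]).

    So the remainder contributes integrals of
    [e^{i lambda y} (A + B lambda) / lambda^3] along the boundary of a sector
    on which the exponential is bounded. They vanish by Cauchy's theorem
    ([cauchy_sector], [path_int_exp_0]). Since
    [e^{i lambda x} F_lambda(f)] is
    [e^{i lambda x} lambda^{-3} F_lambda(S f)] minus such an integrand, the two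
    integrals of the expansion agree as soon as one converges
    ([diagonalised_by_intro]). The one with the factor [lambda^{-3}] converges
    absolutely, because [e^{i lambda x} F_lambda(S f)] is bounded on the contour.
    On the interval this is a comparison of exponentials: on each of the six
    rays their moduli are [Y], [1] and [1 / Y] with [Y >= 2], so that one of them
    dominates [Delta] ([Delta_lower_rays]); on the unit circle [Delta] has no
    zero by its Taylor expansion ([Delta_neq_0_small]). On the half-line all
    derivatives of [f] decay exponentially, at every rate below that of [f]
    ([rate_tower]).

    Completeness is reduced to a moment problem. If an integral depending
    on a parameter vanishes along a ray, so do all its derivatives there
    ([gen_derive_0]). On the interval the lower contour gives
    [int Delta(omega r x) f(x) dx = 0] for [r >= 1], with [omega] on that contour;
    as [Delta] is, up to a constant, its own third derivative, the function
    [Delta(omega x) f(x)] is orthogonal to all powers of [x^3]. On the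
    half-line the real part of the contour gives vanishing moments of
    [e^{-ix} f(x)], which the exponential decay propagates to orthogonality to
    all powers of some [e^{-cx}] ([moments_shift]). In both cases Landau's
    kernels ([landau]) show that the function vanishes. *)

(** * Complex numbers and continuity *)

Notation derC := (@is_derive R_AbsRing C_R_NormedModule).
Notation intC := (@is_RInt C_R_NormedModule).
Notation RIntC := (@RInt C_R_CompleteNormedModule).
Notation genC := (@is_RInt_gen C_R_NormedModule).

(** Equalities that arise from the hierarchy of normed modules are stated over
    carrier types that the ring tactics do not recognize. *)
Ltac as_eq_C := match goal with |- @eq _ ?a ?b => change (@eq C a b) end; cbv beta.
Ltac as_eq_R := match goal with |- @eq _ ?a ?b => change (@eq R a b) end; cbv beta.
Ltac cring := as_eq_C; ring.
Ltac rring := as_eq_R; ring.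

(** [C_R_NormedModule] carries the norm of a product of two copies of [R]. *)
Lemma norm_C (z : C) : @norm R_AbsRing C_R_NormedModule z = Cmod z.
Proof.
change (sqrt (Rabs (fst z) ^ 2 + Rabs (snd z) ^ 2) = Cmod z).
unfold Cmod; rewrite !pow2_abs; reflexivity.
Qed.

Lemma scal_C (k : R) (z : C) : @scal R_AbsRing C_R_NormedModule k z = (RtoC k * z)%C.
Proof. destruct z as [x y]; unfold Cmult; simpl; unfold scal; simpl; unfold prod_scal, scal; simpl; unfold mult; simpl; f_equal; ring. Qed.

Lemma C_eq (z w : C) : Re z = Re w -> Im z = Im w -> z = w.
Proof. destruct z, w; simpl; intros -> ->; reflexivity. Qed.

Lemma continuous_C_comp {U : UniformSpace} (f : U -> C) x :
  continuous f x <-> continuous (fun u => Re (f u)) x /\ continuous (fun u => Im (f u)) x.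
Proof.
split.
- intros H; split.
  + apply (continuous_comp f (fun w : C => Re w)); [exact H |].
    apply (continuous_fst (U := R_UniformSpace) (V := R_UniformSpace)).
  + apply (continuous_comp f (fun w : C => Im w)); [exact H | apply continuous_Im].
- intros [H1 H2] P [e He].
  assert (K1 := H1 _ (locally_ball (Re (f x)) e)).
  assert (K2 := H2 _ (locally_ball (Im (f x)) e)).
  unfold filtermap in *.
  generalize (filter_and _ _ K1 K2); apply filter_imp.
  intros u [U1 U2]; apply He; split; assumption.
Qed.

Definition ex_derive_continuous_R := @ex_derive_continuous R_AbsRing R_NormedModule.

Section Continuity.
Context {U : UniformSpace}.
Implicit Types (f g : U -> C) (h k : U -> R) (x : U).

Lemma cont_Rplus h k x : continuous h x -> continuous k x -> continuous (fun u => h u + k u) x.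
Proof. apply (continuous_plus (V := R_NormedModule)). Qed.

Lemma cont_Rminus h k x : continuous h x -> continuous k x -> continuous (fun u => h u - k u) x.
Proof. apply (continuous_minus (V := R_NormedModule)). Qed.

Lemma cont_Ropp h x : continuous h x -> continuous (fun u => - h u) x.
Proof. apply (continuous_opp (V := R_NormedModule)). Qed.

Lemma cont_Rmult h k x : continuous h x -> continuous k x -> continuous (fun u => h u * k u) x.
Proof. apply (continuous_mult (K := R_AbsRing)). Qed.

Lemma cont_RtoC h x : continuous h x -> continuous (fun u => RtoC (h u)) x.
Proof. intros H; apply continuous_C_comp; split; [exact H | apply continuous_const]. Qed.

Lemma cont_Cplus f g x : continuous f x -> continuous g x -> continuous (fun u => f u + g u)%C x.
Proof.
rewrite !continuous_C_comp; intros [F1 F2] [G1 G2].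
split; apply cont_Rplus; assumption.
Qed.

Lemma cont_Copp f x : continuous f x -> continuous (fun u => - f u)%C x.
Proof. rewrite !continuous_C_comp; intros [F1 F2]; split; apply cont_Ropp; assumption. Qed.

Lemma cont_Cminus f g x : continuous f x -> continuous g x -> continuous (fun u => f u - g u)%C x.
Proof. intros F G; apply cont_Cplus; [| apply cont_Copp]; assumption. Qed.

Lemma cont_Cmult f g x : continuous f x -> continuous g x -> continuous (fun u => f u * g u)%C x.
Proof.
rewrite !continuous_C_comp; intros [F1 F2] [G1 G2]; split.
- apply cont_Rminus; apply cont_Rmult; assumption.
- apply cont_Rplus; apply cont_Rmult; assumption.
Qed.

Lemma cont_Cpow f n x : continuous f x -> continuous (fun u => f u ^ n)%C x.
Proof.
intros F; induction n as [| n IH]; [apply continuous_const |].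
apply cont_Cmult; assumption.
Qed.

Lemma cont_Cinv f x : f x <> RtoC 0 -> continuous f x -> continuous (fun u => / f u)%C x.
Proof.
intros H0; rewrite !continuous_C_comp; intros [F1 F2].
assert (N : Re (f x) ^ 2 + Im (f x) ^ 2 <> 0).
{ intros E; apply H0; apply C_eq; simpl; nra. }
assert (D : continuous (fun u => / (Re (f u) ^ 2 + Im (f u) ^ 2)) x).
{ apply (continuous_comp (fun u => Re (f u) ^ 2 + Im (f u) ^ 2) Rinv).
  - apply cont_Rplus; simpl.
    + apply cont_Rmult; [exact F1 | apply cont_Rmult; [exact F1 | apply continuous_const]].
    + apply cont_Rmult; [exact F2 | apply cont_Rmult; [exact F2 | apply continuous_const]].
  - apply (ex_derive_continuous (V := R_NormedModule)), ex_derive_Reals_1, derivable_pt_inv.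
    + exact N.
    + apply derivable_pt_id. }
split.
- apply cont_Rmult; assumption.
- apply cont_Rmult; [apply cont_Ropp |]; assumption.
Qed.

Lemma cont_Cexp f x : continuous f x -> continuous (fun u => Cexp (f u)) x.
Proof.
rewrite !continuous_C_comp; intros [F1 F2].
assert (E : continuous (fun u => exp (Re (f u))) x).
{ apply continuous_comp; [exact F1 | apply continuous_exp]. }
split; apply cont_Rmult; try exact E;
  apply continuous_comp; try exact F2; [apply continuous_cos | apply continuous_sin].
Qed.

Lemma cont_Cmod f x : continuous f x -> continuous (fun u => Cmod (f u)) x.
Proof.
rewrite !continuous_C_comp; intros [F1 F2].
apply (continuous_comp (fun u => fst (f u) ^ 2 + snd (f u) ^ 2) sqrt).
- apply cont_Rplus; simpl.
  + apply cont_Rmult; [exact F1 | apply cont_Rmult; [exact F1 | apply continuous_const]].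
  + apply cont_Rmult; [exact F2 | apply cont_Rmult; [exact F2 | apply continuous_const]].
- apply continuous_sqrt.
Qed.

End Continuity.

(** * The complex exponential *)

Lemma Cexp_add z w : Cexp (z + w) = (Cexp z * Cexp w)%C.
Proof.
unfold Cexp; destruct z, w; simpl; rewrite exp_plus, cos_plus, sin_plus.
unfold Cmult; simpl; f_equal; ring.
Qed.

Lemma Cexp_0 : Cexp 0 = RtoC 1.
Proof. unfold Cexp; simpl; rewrite exp_0, cos_0, sin_0; unfold RtoC; f_equal; ring. Qed.

Lemma Cmod_Cexp z : Cmod (Cexp z) = exp (Re z).
Proof. apply (Cmod_polar (exp (Re z)) (Im z)), Rlt_le, exp_pos. Qed.

Lemma Cexp_neq_0 z : Cexp z <> RtoC 0.
Proof.
intros E; generalize (exp_pos (Re z)); rewrite <- Cmod_Cexp, E, Cmod_0; lra.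
Qed.

Lemma Cexp_RtoC (t : R) : Cexp (RtoC t) = RtoC (exp t).
Proof. unfold Cexp, RtoC; simpl; rewrite cos_0, sin_0; f_equal; ring. Qed.

Lemma Cmod_em mu x : Cmod (em mu x) = exp (Im mu * x).
Proof. unfold em; rewrite Cmod_Cexp; destruct mu; simpl; f_equal; ring. Qed.

Lemma em_0 mu : em mu 0 = RtoC 1.
Proof. unfold em; rewrite Cmult_0_r; apply Cexp_0. Qed.

Lemma em_add_freq mu nu x : em (mu + nu) x = (em mu x * em nu x)%C.
Proof. unfold em; rewrite <- Cexp_add; f_equal; ring. Qed.

Lemma Cexp_i_em mu x : Cexp (Ci * mu * RtoC x) = em (- mu) x.
Proof. unfold em; f_equal; ring. Qed.

(** * Derivatives of complex functions of a real variable *)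

Lemma derC_comp (f : R -> C) (x : R) (l : C) : derC f x l <->
  is_derive (fun t => Re (f t)) x (Re l) /\ is_derive (fun t => Im (f t)) x (Im l).
Proof.
split.
- intros H; split.
  + apply (filterdiff_comp' f (fun w : C_R_NormedModule => fst w) x (fun y => scal y l) (fun w => fst w)) in H;
      [exact H | apply filterdiff_linear, is_linear_fst].
  + apply (filterdiff_comp' f (fun w : C_R_NormedModule => snd w) x (fun y => scal y l) (fun w => snd w)) in H;
      [exact H | apply filterdiff_linear, is_linear_snd].
- intros [H1 H2].
  assert (K := filterdiff_comp'_2 (fun t => Re (f t)) (fun t => Im (f t)) (fun a b : R => (a, b) : C_R_NormedModule) x
    (fun y => scal y (Re l)) (fun y => scal y (Im l)) (fun a b => (a, b)) H1 H2).
  apply (is_derive_ext (fun t => (Re (f t), Im (f t)) : C_R_NormedModule)).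
  { intros t; symmetry; apply surjective_pairing. }
  assert (L : is_linear (fun p : R_NormedModule * R_NormedModule => (fst p, snd p) : C_R_NormedModule)).
  { split.
    - intros [] []; reflexivity.
    - intros k []; reflexivity.
    - exists 1; split; [lra |]; intros [a b]; rewrite Rmult_1_l; apply Rle_refl. }
  apply K, (filterdiff_linear _ L).
Qed.

Lemma derC_ext (f g : R -> C) (x : R) (l : C) : (forall t, f t = g t) -> derC f x l -> derC g x l.
Proof. apply (is_derive_ext (V := C_R_NormedModule)). Qed.

Lemma derC_plus (f g : R -> C) (x : R) (l m : C) : derC f x l -> derC g x m -> derC (fun t => f t + g t)%C x (l + m)%C.
Proof. apply (is_derive_plus (V := C_R_NormedModule)). Qed.

Lemma derC_minus (f g : R -> C) (x : R) (l m : C) : derC f x l -> derC g x m -> derC (fun t => f t - g t)%C x (l - m)%C.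
Proof. apply (is_derive_minus (V := C_R_NormedModule)). Qed.

Lemma derC_const c (x : R) : derC (fun _ => c) x (RtoC 0).
Proof. apply (is_derive_const (V := C_R_NormedModule)). Qed.

Lemma derC_mult (f g : R -> C) (x : R) (l m : C) : derC f x l -> derC g x m ->
  derC (fun t => f t * g t)%C x (l * g x + f x * m)%C.
Proof.
rewrite !derC_comp; intros [F1 F2] [G1 G2].
assert (P : forall a b da db, is_derive a x da -> is_derive b x db ->
  is_derive (fun t : R => a t * b t) x (da * b x + a x * db)).
{ intros a b da db A B; apply (is_derive_mult (K := R_AbsRing) a b x da db A B).
  intros; apply Rmult_comm. }
split.
- evar_last.
  { apply (is_derive_minus (V := R_NormedModule)); apply P; eassumption. }
  as_eq_R; unfold minus, plus, opp, Re, Im; simpl; unfold Re, Im; ring.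
- evar_last.
  { apply (is_derive_plus (V := R_NormedModule)); apply P; eassumption. }
  as_eq_R; unfold minus, plus, opp, Re, Im; simpl; unfold Re, Im; ring.
Qed.

Lemma derC_scal c (f : R -> C) (x : R) (l : C) : derC f x l -> derC (fun t => c * f t)%C x (c * l)%C.
Proof.
intros H; evar_last; [apply derC_mult; [apply derC_const | exact H] |]; cring.
Qed.

Lemma derC_RtoC (h : R -> R) (x l : R) : is_derive h x l -> derC (fun t => RtoC (h t)) x (RtoC l).
Proof.
intros H; apply derC_comp; split; [exact H |].
exact (is_derive_const (K := R_AbsRing) (V := R_NormedModule) 0 x).
Qed.

Lemma derC_id (x : R) : derC (fun t => RtoC t) x (RtoC 1).
Proof. apply derC_RtoC, (is_derive_id (K := R_AbsRing)). Qed.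

Lemma derC_pair (a b : R -> R) (x da db : R) :
  is_derive a x da -> is_derive b x db -> derC (fun t => (a t, b t)) x (da, db).
Proof. intros A B; apply derC_comp; split; assumption. Qed.

Lemma derC_Cexp (f : R -> C) (x : R) (l : C) :
  derC f x l -> derC (fun t => Cexp (f t)) x (l * Cexp (f x))%C.
Proof.
rewrite derC_comp; intros [A B].
unfold Cexp.
set (a := fun t => Re (f t)) in A; set (b := fun t => Im (f t)) in B.
change (derC (fun t => (exp (a t) * cos (b t), exp (a t) * sin (b t))) x
  (l * ((exp (a x) * cos (b x))%R, (exp (a x) * sin (b x))%R))%C).
assert (EA := is_derive_unique _ _ _ A); assert (EB := is_derive_unique _ _ _ B).
assert (XA : ex_derive a x) by (eexists; exact A).
assert (XB : ex_derive b x) by (eexists; exact B).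
unfold Cmult; simpl; apply derC_pair.
- auto_derive; [auto |].
  replace (Derive (fun y => a y) x) with (Re l) by (symmetry; exact EA).
  replace (Derive (fun y => b y) x) with (Im l) by (symmetry; exact EB).
  unfold Re, Im; ring.
- auto_derive; [auto |].
  replace (Derive (fun y => a y) x) with (Re l) by (symmetry; exact EA).
  replace (Derive (fun y => b y) x) with (Im l) by (symmetry; exact EB).
  unfold Re, Im; ring.
Qed.

Lemma derC_Cinv (f : R -> C) (x : R) (l : C) : f x <> RtoC 0 -> derC f x l ->
  derC (fun t => / f t)%C x (- l * / f x * / f x)%C.
Proof.
rewrite derC_comp; intros H0 [A B].
assert (N : Re (f x) ^ 2 + Im (f x) ^ 2 <> 0).
{ intros E; apply H0; apply C_eq; simpl; nra. }
unfold Cinv.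
set (a := fun t => Re (f t)) in A; set (b := fun t => Im (f t)) in B.
change (a x ^ 2 + b x ^ 2 <> 0) in N.
change (derC (fun t => (a t / (a t ^ 2 + b t ^ 2), - b t / (a t ^ 2 + b t ^ 2))) x
  (- l * ((a x / (a x ^ 2 + b x ^ 2))%R, (- b x / (a x ^ 2 + b x ^ 2))%R)
       * ((a x / (a x ^ 2 + b x ^ 2))%R, (- b x / (a x ^ 2 + b x ^ 2))%R))%C).
assert (EA := is_derive_unique _ _ _ A); assert (EB := is_derive_unique _ _ _ B).
assert (XA : ex_derive a x) by (eexists; exact A).
assert (XB : ex_derive b x) by (eexists; exact B).
unfold Cmult; simpl fst; simpl snd; apply derC_pair.
- auto_derive; [auto |].
  replace (Derive (fun y => a y) x) with (Re l) by (symmetry; exact EA).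
  replace (Derive (fun y => b y) x) with (Im l) by (symmetry; exact EB).
  unfold Re, Im; field; simpl in *; lra.
- auto_derive; [auto |].
  replace (Derive (fun y => a y) x) with (Re l) by (symmetry; exact EA).
  replace (Derive (fun y => b y) x) with (Im l) by (symmetry; exact EB).
  unfold Re, Im; field; simpl in *; lra.
Qed.

Lemma derC_em mu (x : R) : derC (em mu) x (- Ci * mu * em mu x)%C.
Proof.
unfold em; evar_last.
{ apply (derC_Cexp (fun t => - Ci * mu * RtoC t)%C), derC_scal, derC_id. }
simpl; ring.
Qed.

Lemma derC_cont (f : R -> C) (x : R) (l : C) : derC f x l -> continuous f x.
Proof. intros H; apply (ex_derive_continuous (V := C_R_NormedModule)); eexists; exact H. Qed.

(** * Integrals of complex functions of a real variable *)

Definition RIntC_correct := @RInt_correct C_R_CompleteNormedModule.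

Lemma intC_comp f a b l : intC f a b l <->
  is_RInt (fun t => Re (f t)) a b (Re l) /\ is_RInt (fun t => Im (f t)) a b (Im l).
Proof.
split.
- intros H; split.
  + apply (is_RInt_fct_extend_fst (U := R_NormedModule) (V := R_NormedModule) f a b l H).
  + apply (is_RInt_fct_extend_snd (U := R_NormedModule) (V := R_NormedModule) f a b l H).
- intros [H1 H2].
  replace l with (Re l, Im l) by (symmetry; apply surjective_pairing).
  apply (is_RInt_fct_extend_pair (U := R_NormedModule) (V := R_NormedModule) f); assumption.
Qed.

Lemma intC_scal c f a b l : intC f a b l -> intC (fun t => c * f t)%C a b (c * l)%C.
Proof.
rewrite !intC_comp; intros [H1 H2]; destruct c as [c1 c2]; split.
- apply (is_RInt_minus (V := R_NormedModule)); apply (is_RInt_scal (V := R_NormedModule)); assumption.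
- apply (is_RInt_plus (V := R_NormedModule)); apply (is_RInt_scal (V := R_NormedModule)); assumption.
Qed.

Lemma intC_bound f g a b l K : a <= b -> (forall x, a <= x <= b -> Cmod (f x) <= g x) ->
  intC f a b l -> is_RInt g a b K -> Cmod l <= K.
Proof.
intros Hab H; rewrite <- norm_C; apply (norm_RInt_le (V := C_R_NormedModule)); [exact Hab |].
intros x Hx; rewrite norm_C; apply H, Hx.
Qed.

Lemma intC_ex f a b : (forall x, Rmin a b <= x <= Rmax a b -> continuous f x) -> intC f a b (RIntC f a b).
Proof.
intros H; apply RIntC_correct.
apply (ex_RInt_continuous (V := C_R_CompleteNormedModule)), H.
Qed.

Lemma intC_unique f a b l : intC f a b l -> RIntC f a b = l.
Proof. apply (is_RInt_unique (V := C_R_CompleteNormedModule)). Qed.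

Lemma intC_derive f df a b : a <= b -> (forall x, a <= x <= b -> derC f x (df x)) ->
  (forall x, a <= x <= b -> continuous df x) -> intC df a b (f b - f a)%C.
Proof.
intros Hab H1 H2; apply (is_RInt_derive (V := C_R_CompleteNormedModule));
  rewrite Rmin_left, Rmax_right by assumption; assumption.
Qed.

(** Both increments are the integrals of the derivatives. *)
Lemma derC_growth (f df : R -> C) (g dg : R -> R) a b : a <= b ->
  (forall x, a <= x <= b -> derC f x (df x)) ->
  (forall x, a <= x <= b -> is_derive g x (dg x)) ->
  (forall x, a <= x <= b -> continuous df x) ->
  (forall x, a <= x <= b -> continuous dg x) ->
  (forall x, a <= x <= b -> Cmod (df x) <= dg x) ->
  Cmod (f b - f a) <= g b - g a.
Proof.
intros Hab F G Cf Cg H.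
apply intC_bound with (f := df) (g := dg) (a := a) (b := b); auto.
- apply intC_derive; assumption.
- apply (is_RInt_derive (V := R_CompleteNormedModule)); rewrite Rmin_left, Rmax_right by assumption; assumption.
Qed.

Fixpoint exp_taylor (n : nat) (z : C) : C :=
  match n with
  | O => RtoC 0
  | S m => (exp_taylor m z + z ^ m * RtoC (/ INR (fact m)))%C
  end.

Lemma exp_taylor_0 n : exp_taylor (S n) 0 = RtoC 1.
Proof.
induction n as [| n IH].
- simpl; replace (/ 1) with 1 by field; ring.
- change (exp_taylor (S n) 0 + 0 ^ S n * RtoC (/ INR (fact (S n))) = RtoC 1)%C.
  rewrite IH; simpl Cpow; ring.
Qed.

Lemma derC_pow_lin n z (t : R) : derC (fun s => (RtoC s * z) ^ S n)%C t (RtoC (INR (S n)) * z * (RtoC t * z) ^ n)%C.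
Proof.
induction n as [| n IH].
- apply (derC_ext (fun s => z * RtoC s)%C); [intros s; simpl; ring |].
  evar_last; [apply derC_scal, derC_id | simpl; ring].
- apply (derC_ext (fun s => (z * RtoC s) * (RtoC s * z) ^ S n)%C).
  { intros s; simpl; ring. }
  evar_last; [apply derC_mult; [apply derC_scal, derC_id | exact IH] |].
  rewrite (S_INR (S n)), RtoC_plus; simpl Cpow; ring.
Qed.

Lemma derC_exp_taylor n z (t : R) :
  derC (fun s => exp_taylor (S n) (RtoC s * z)) t (z * exp_taylor n (RtoC t * z))%C.
Proof.
induction n as [| n IH].
- apply (derC_ext (fun s => RtoC 1)).
  { intros s; simpl; replace (/ 1) with 1 by field; ring. }
  evar_last; [apply derC_const | simpl; ring].
- change (derC (fun s => exp_taylor (S n) (RtoC s * z) + (RtoC s * z) ^ S n * RtoC (/ INR (fact (S n))))%C t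
    (z * (exp_taylor n (RtoC t * z) + (RtoC t * z) ^ n * RtoC (/ INR (fact n)))))%C.
  evar_last.
  { apply derC_plus; [exact IH |].
    apply derC_mult; [apply derC_pow_lin | apply derC_const]. }
  rewrite fact_simpl, mult_INR.
  assert (N1 := not_0_INR (S n) ltac:(lia)); assert (N2 := INR_fact_neq_0 n).
  rewrite Cmult_plus_distr_l; f_equal.
  replace (/ INR (fact n)) with (INR (S n) * / (INR (S n) * INR (fact n))) by (field; auto).
  rewrite RtoC_mult; ring.
Qed.

(** Induction on [n]: the derivative in [t] of [e^{tz} - T_{n+1}(tz)] is
    [z (e^{tz} - T_n(tz))], and [|z|] times the bound for [n] is one of the two
    terms of the derivative of the bound for [n + 1]. *)
Lemma Cmod_exp_taylor_path n z t : 0 <= t ->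
  Cmod (Cexp (RtoC t * z) - exp_taylor n (RtoC t * z))
    <= (t * Cmod z) ^ n / INR (fact n) * exp (t * Cmod z).
Proof.
revert t; induction n as [| n IH]; intros t Ht.
- simpl; unfold Cminus; rewrite Copp_0, Cplus_0_r, Cmod_Cexp.
  replace (1 / 1) with 1 by field; rewrite Rmult_1_l.
  apply exp_increasing_le || idtac.
  assert (Re (RtoC t * z) <= t * Cmod z).
  { destruct z as [x y]; simpl; generalize (re_le_Cmod (x, y)); simpl; intros H.
    apply Rabs_le_between in H; nra. }
  destruct (Req_dec (Re (RtoC t * z)) (t * Cmod z)) as [-> | ?]; [lra |].
  apply Rlt_le, exp_increasing; lra.
- set (m := Cmod z) in *.
  assert (Hm : 0 <= m) by apply Cmod_ge_0.
  assert (D : forall s, derC (fun s => Cexp (RtoC s * z) - exp_taylor (S n) (RtoC s * z))%C s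
     (z * (Cexp (RtoC s * z) - exp_taylor n (RtoC s * z)))%C).
  { intros s; evar_last.
    { apply derC_minus; [| apply derC_exp_taylor].
      apply (derC_Cexp (fun s => RtoC s * z)%C).
      apply (derC_ext (fun s => z * RtoC s)%C); [intros; cring |].
      apply derC_scal, derC_id. }
    simpl; ring. }
  assert (CT : forall s, continuous (fun s => exp_taylor n (RtoC s * z)) s).
  { intros s; destruct n as [| k]; [apply continuous_const |].
    eapply derC_cont, derC_exp_taylor. }
  assert (CE : forall s, continuous (fun s => RtoC s * z)%C s).
  { intros s; apply cont_Cmult; [apply cont_RtoC, continuous_id | apply continuous_const]. }
  set (dg := fun s => m * ((s * m) ^ n / INR (fact n) * exp (s * m))
     + m * ((s * m) ^ S n / INR (fact (S n)) * exp (s * m))).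
  assert (N1 := INR_fact_lt_0 n).
  assert (G : forall s, is_derive (fun s => (s * m) ^ S n / INR (fact (S n)) * exp (s * m)) s (dg s)).
  { intros s; unfold dg.
    rewrite fact_simpl, mult_INR.
    assert (N2 := lt_0_INR (S n) ltac:(lia)).
    auto_derive; [easy |].
    change (match n with O => 1 | S _ => INR n + 1 end) with (INR (S n)).
    change (Init.Nat.pred (S n)) with n.
    simpl pow. field; lra. }
  assert (K := derC_growth _ _ _ dg 0 t Ht (fun s _ => D s) (fun s _ => G s)).
  cbv beta in K.
  rewrite Rmult_0_l, Cmult_0_l, exp_taylor_0, Cexp_0 in K.
  replace (Cexp (RtoC t * z) - exp_taylor (S n) (RtoC t * z) - (1 - 1))%C
    with (Cexp (RtoC t * z) - exp_taylor (S n) (RtoC t * z))%C in K by ring.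
  replace (0 ^ S n / INR (fact (S n)) * exp 0) with 0 in K by (simpl pow; unfold Rdiv; ring).
  rewrite Rminus_0_r in K; apply K.
  + intros s _; apply cont_Cmult; [apply continuous_const |].
    apply cont_Cminus; [apply cont_Cexp, CE | apply CT].
  + intros s _; apply (ex_derive_continuous (V := R_NormedModule)); unfold dg; auto_derive; easy.
  + intros s Hs; rewrite Cmod_mult; unfold dg; fold m.
    assert (H := IH s (proj1 Hs)).
    assert (0 <= m * ((s * m) ^ S n / INR (fact (S n)) * exp (s * m))).
    { apply Rmult_le_pos; [easy |]; apply Rmult_le_pos; [| apply Rlt_le, exp_pos].
      apply Rle_div_r; [apply INR_fact_lt_0 |]; rewrite Rmult_0_l; apply pow_le; nra. }
    nra.
Qed.

Lemma Cmod_exp_taylor n z :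
  Cmod (Cexp z - exp_taylor n z) <= Cmod z ^ n / INR (fact n) * exp (Cmod z).
Proof.
generalize (Cmod_exp_taylor_path n z 1 Rle_0_1); rewrite Cmult_1_l, Rmult_1_l; easy.
Qed.

Lemma Cmod_exp_1 z : Cmod (Cexp z - 1) <= Cmod z * exp (Cmod z).
Proof.
generalize (Cmod_exp_taylor 1 z); simpl.
replace (Cexp z - (0 + 1 * RtoC (/ 1)))%C with (Cexp z - 1)%C by (rewrite Rinv_1; ring).
intros H; eapply Rle_trans; [exact H |]; right; field.
Qed.

Lemma Cmod_exp_2 z : Cmod (Cexp z - 1 - z) <= Cmod z ^ 2 * exp (Cmod z).
Proof.
generalize (Cmod_exp_taylor 2 z); simpl.
replace (Cexp z - (0 + 1 * RtoC (/ 1) + z * 1 * RtoC (/ 1)))%C with (Cexp z - 1 - z)%C by (rewrite Rinv_1; ring).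
intros H; eapply Rle_trans; [exact H |].
assert (0 <= Cmod z * Cmod z * exp (Cmod z)).
{ apply Rmult_le_pos; [| apply Rlt_le, exp_pos]; generalize (Cmod_ge_0 z); nra. }
lra.
Qed.

(** Continuity of a complex function by the shape of its body; factors whose
    continuity is not structural are left as goals. *)
Ltac ccont :=
  unfold Cdiv;
  lazymatch goal with
  | |- continuous (fun _ => ?c) _ => apply continuous_const
  | |- continuous (fun z => z) _ => apply continuous_id
  | |- continuous (fun z => Cplus (@?f z) (@?g z)) ?x => apply (cont_Cplus f g x); ccont
  | |- continuous (fun z => Cminus (@?f z) (@?g z)) ?x => apply (cont_Cminus f g x); ccont
  | |- continuous (fun z => Cmult (@?f z) (@?g z)) ?x => apply (cont_Cmult f g x); ccont
  | |- continuous (fun z => Copp (@?f z)) ?x => apply (cont_Copp f x); ccont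
  | |- continuous (fun z => Cpow (@?f z) ?n) ?x => apply (cont_Cpow f n x); ccont
  | |- continuous (fun z => Cexp (@?f z)) ?x => apply (cont_Cexp f x); ccont
  | |- continuous (fun z => RtoC (@?f z)) ?x => apply (cont_RtoC f x); ccont
  | |- continuous (fun z => Cinv (@?f z)) ?x => apply (cont_Cinv f x); [| ccont]
  | _ => idtac
  end.

(** * Improper integrals *)

(** The integrals over [[0, 1]] and over half-lines are treated alike: [X] is
    the region of integration, [a0] its left end, and the upper limit of
    integration follows the filter [F]. *)
Definition int_range (a0 : R) (X : R -> Prop) (F : (R -> Prop) -> Prop) : Prop :=
  F X /\ (forall b, X b -> a0 <= b) /\ (forall b x, X b -> a0 <= x <= b -> X x).

Lemma locally_Cmod (z : C) e : 0 < e -> locally z (fun w => Cmod (w - z) < e).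
Proof.
intros He.
assert (S : 0 < sqrt 2) by (apply sqrt_lt_R0; lra).
assert (P : 0 < e / sqrt 2) by (apply Rdiv_lt_0_compat; assumption).
exists (mkposreal _ P); intros w Hw.
assert (K := C_NormedModule_mixin_compat2 z w (mkposreal _ P) Hw).
simpl in K; replace (sqrt 2 * (e / sqrt 2)) with e in K by (field; lra).
exact K.
Qed.

Lemma filterlim_Cmod {T} (F : (T -> Prop) -> Prop) (FF : Filter F) (f : T -> C) (l : C) :
  (forall e, 0 < e -> F (fun t => Cmod (f t - l) < e)) -> filterlim f F (locally l).
Proof.
intros H P [e He].
refine (filter_imp (fun t => Cmod (f t - l) < e) (fun t => P (f t)) _ (H e (cond_pos e))); intros t Ht.
apply He; apply (C_NormedModule_mixin_compat1 l (f t) e), Ht.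
Qed.

Lemma filterlim_Cmod_inv {T} (F : (T -> Prop) -> Prop) (f : T -> C) (l : C) e :
  filterlim f F (locally l) -> 0 < e -> F (fun t => Cmod (f t - l) < e).
Proof. intros H He; apply (H _ (locally_Cmod l e He)). Qed.

Lemma genC_plus {Fa Fb} {FFa : Filter Fa} {FFb : Filter Fb} f g l m :
  genC f Fa Fb l -> genC g Fa Fb m -> genC (fun x => f x + g x)%C Fa Fb (l + m)%C.
Proof. apply (is_RInt_gen_plus (V := C_R_NormedModule)). Qed.

Lemma genC_minus {Fa Fb} {FFa : Filter Fa} {FFb : Filter Fb} f g l m :
  genC f Fa Fb l -> genC g Fa Fb m -> genC (fun x => f x - g x)%C Fa Fb (l - m)%C.
Proof. apply (is_RInt_gen_minus (V := C_R_NormedModule)). Qed.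

Lemma genC_scal {Fa Fb} {FFa : Filter Fa} {FFb : Filter Fb} c f l :
  genC f Fa Fb l -> genC (fun x => c * f x)%C Fa Fb (c * l)%C.
Proof.
intros H P HP.
assert (HP' : locally l (fun z => P (c * z)%C)).
{ apply (cont_Cmult (U := C_UniformSpace) (fun _ => c) (fun z => z) l); [apply continuous_const | apply continuous_id | exact HP]. }
generalize (H _ HP'); unfold filtermapi; apply filter_imp.
intros ab [y [Hy Py]]; exists (c * y)%C; split; [| exact Py].
apply intC_scal, Hy.
Qed.

Section Range.
Context {a0 : R} {X : R -> Prop} {F : (R -> Prop) -> Prop} {PF : ProperFilter F}.
Context (HX : int_range a0 X F).

Lemma range_seg b x : X b -> a0 <= x <= b -> X x.
Proof. apply HX. Qed.

Lemma range_ex_RInt {V : CompleteNormedModule R_AbsRing} (g : R -> V) b :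
  (forall x, X x -> continuous g x) -> X b -> ex_RInt g a0 b.
Proof.
intros C Hb; apply (ex_RInt_continuous (V := V)); intros z Hz.
assert (Hab := proj1 (proj2 HX) b Hb).
rewrite Rmin_left, Rmax_right in Hz by easy.
apply C, (range_seg b); easy.
Qed.

Lemma gen_lim {V : CompleteNormedModule R_AbsRing} (g : R -> V) (l : V) :
  (forall x, X x -> continuous g x) ->
  is_RInt_gen g (at_point a0) F l <-> filterlim (fun b => RInt g a0 b) F (locally l).
Proof.
intros C; split.
- intros H P HP; destruct (H P HP) as [Q S HQ HS HQS].
  unfold filtermap; revert HS; apply filter_imp; intros b Hb.
  destruct (HQS a0 b HQ Hb) as [y [Hy Py]]; simpl in Hy.
  rewrite (is_RInt_unique _ _ _ _ Hy); exact Py.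
- intros H P HP.
  exists (fun a => a = a0) (fun b => X b /\ P (RInt g a0 b)).
  + reflexivity.
  + apply filter_and; [apply HX | apply (H P HP)].
  + intros a b -> [Hb Pb]; exists (RInt g a0 b); split; [| exact Pb].
    apply (RInt_correct (V := V)), range_ex_RInt; assumption.
Qed.

Lemma gen_antiderivative {V : NormedModule R_AbsRing} (g W : R -> V) (l : V) :
  (forall b, X b -> is_RInt g a0 b (W b)) -> filterlim W F (locally l) ->
  is_RInt_gen g (at_point a0) F l.
Proof.
intros H1 H2 P HP.
exists (fun a => a = a0) (fun b => X b /\ P (W b)).
- reflexivity.
- apply filter_and; [apply HX | apply (H2 P HP)].
- intros a b -> [Hb Pb]; exists (W b); auto.
Qed.

Lemma gen_ext_range {V : NormedModule R_AbsRing} (f g : R -> V) (l : V) :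
  (forall x, X x -> f x = g x) -> is_RInt_gen f (at_point a0) F l ->
  is_RInt_gen g (at_point a0) F l.
Proof.
intros E; apply is_RInt_gen_ext.
exists (fun a => a = a0) X; [reflexivity | apply HX |].
intros a b -> Hb x Hx; simpl in Hx.
assert (Hab := proj1 (proj2 HX) b Hb).
rewrite Rmin_left, Rmax_right in Hx by easy.
apply E, (range_seg b); [exact Hb | lra].
Qed.

Lemma genC_ext (f g : R -> C) l : (forall x, X x -> f x = g x) ->
  genC f (at_point a0) F l -> genC g (at_point a0) F l.
Proof. apply (gen_ext_range (V := C_R_NormedModule)). Qed.

Lemma range_plus {f g l m} : genC f (at_point a0) F l -> genC g (at_point a0) F m ->
  genC (fun x => f x + g x)%C (at_point a0) F (l + m)%C.
Proof using HX PF. apply genC_plus. Qed.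

Lemma range_minus {f g l m} : genC f (at_point a0) F l -> genC g (at_point a0) F m ->
  genC (fun x => f x - g x)%C (at_point a0) F (l - m)%C.
Proof using HX PF. apply genC_minus. Qed.

Lemma range_scal c {f l} : genC f (at_point a0) F l ->
  genC (fun x => c * f x)%C (at_point a0) F (c * l)%C.
Proof using HX PF. apply genC_scal. Qed.

Lemma genC_unique f l m : genC f (at_point a0) F l -> genC f (at_point a0) F m -> l = m.
Proof.
intros H1 H2.
rewrite <- (is_RInt_gen_unique (V := C_R_CompleteNormedModule) _ _ H1).
apply (is_RInt_gen_unique (V := C_R_CompleteNormedModule) _ _ H2).
Qed.

Lemma genC_bound f g l K : (forall x, X x -> Cmod (f x) <= g x) ->
  genC f (at_point a0) F l -> is_RInt_gen g (at_point a0) F K -> Cmod l <= K.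
Proof.
intros H Hf Hg; rewrite <- norm_C.
assert (L : forall P : R * R -> Prop, (forall b, X b -> P (a0, b)) -> filter_prod (at_point a0) F P).
{ intros P HP; exists (fun a => a = a0) X; [reflexivity | apply HX |].
  intros a b -> Hb; apply HP, Hb. }
refine (RInt_gen_norm (V := C_R_CompleteNormedModule) f g l K _ _ Hf Hg); apply L; intros b Hb; simpl.
- apply HX, Hb.
- intros x Hx; change (@norm R_AbsRing C_R_NormedModule (f x) <= g x).
  rewrite norm_C; apply H, (range_seg b); assumption.
Qed.

(** Cauchy's criterion: the integral of [f] between two points is at most
    that of [g], which is small. *)
Lemma genC_dominated f g K :
  (forall x, X x -> continuous f x) -> (forall x, X x -> continuous g x) ->
  (forall x, X x -> Cmod (f x) <= g x) -> is_RInt_gen g (at_point a0) F K ->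
  exists l, genC f (at_point a0) F l /\ Cmod l <= K.
Proof.
intros Cf Cg H Hg.
enough (exists l, genC f (at_point a0) F l) as [l Hl].
{ exists l; split; [exact Hl |]; eapply genC_bound; eassumption. }
assert (Lg := proj1 (gen_lim (V := R_CompleteNormedModule) g K Cg) Hg).
enough (exists l, filterlim (fun b => RIntC f a0 b) F (locally l)) as [l Hl].
{ exists l; apply (gen_lim (V := C_R_CompleteNormedModule) f l Cf), Hl. }
apply (filterlim_locally_cauchy (U := C_R_CompleteNormedModule)); intros eps.
assert (Q : exists y, filterlim (fun b => RInt g a0 b) F (locally y)) by (exists K; exact Lg).
destruct (proj2 (filterlim_locally_cauchy (U := R_CompleteNormedModule) (F := F) (fun b => RInt g a0 b)) Q eps) as [P [HP Hball]].
exists (fun b => X b /\ P b); split; [apply filter_and; [apply HX | exact HP] |].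
assert (W : forall u v, X u -> X v -> u <= v ->
  Cmod (RIntC f a0 v - RIntC f a0 u) <= RInt g a0 v - RInt g a0 u).
{ intros u v Hu Hv Huv.
  assert (Hau := proj1 (proj2 HX) u Hu).
  assert (Cs : forall x, u <= x <= v -> X x) by (intros; apply (range_seg v); [exact Hv | lra]).
  apply intC_bound with (f := f) (g := g) (a := u) (b := v); [exact Huv | auto | |].
  - assert (E := RInt_Chasles (V := C_R_CompleteNormedModule) f a0 u v
      (range_ex_RInt (V := C_R_CompleteNormedModule) f u Cf Hu)).
    assert (Xuv : ex_RInt (V := C_R_CompleteNormedModule) f u v).
    { apply (ex_RInt_continuous (V := C_R_CompleteNormedModule)).
      rewrite Rmin_left, Rmax_right by easy; auto. }
    specialize (E Xuv).
    replace (RIntC f a0 v - RIntC f a0 u)%C with (RIntC f u v).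
    { apply RIntC_correct, Xuv. }
    rewrite <- E; assert (Q0 : forall p q : C, q = ((p + q) - p)%C) by (intros; ring); apply Q0.
  - assert (E := RInt_Chasles (V := R_CompleteNormedModule) g a0 u v
      (range_ex_RInt (V := R_CompleteNormedModule) g u Cg Hu)).
    assert (Xuv : ex_RInt (V := R_CompleteNormedModule) g u v).
    { apply (ex_RInt_continuous (V := R_CompleteNormedModule)).
      rewrite Rmin_left, Rmax_right by easy; auto. }
    specialize (E Xuv).
    replace (RInt g a0 v - RInt g a0 u) with (RInt g u v).
    { apply (RInt_correct (V := R_CompleteNormedModule)), Xuv. }
    rewrite <- E; assert (Q0 : forall p q : R, q = (p + q) - p) by (intros; ring); apply Q0. }
intros u v [Hu Pu] [Hv Pv].
apply (C_NormedModule_mixin_compat1 (RIntC f a0 u) (RIntC f a0 v) eps).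
change (Cmod (RIntC f a0 v - RIntC f a0 u) < eps).
destruct (Rle_dec u v) as [Huv | Huv].
- eapply Rle_lt_trans; [apply W; assumption |].
  assert (B := Hball u v Pu Pv); apply Rabs_lt_between in B.
  unfold minus, plus, opp in B; simpl in B; lra.
- replace (RIntC f a0 v - RIntC f a0 u)%C with (- (RIntC f a0 u - RIntC f a0 v))%C by ring.
  rewrite Cmod_opp; eapply Rle_lt_trans; [apply W; try assumption; lra |].
  assert (B := Hball u v Pu Pv); apply Rabs_lt_between in B.
  unfold minus, plus, opp in B; simpl in B; lra.
Qed.

End Range.

Lemma genC_comp {Fa Fb} {FFa : Filter Fa} {FFb : Filter Fb} f l : genC f Fa Fb l ->
  is_RInt_gen (fun x => Re (f x)) Fa Fb (Re l) /\ is_RInt_gen (fun x => Im (f x)) Fa Fb (Im l).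
Proof.
intros H; split; intros P HP.
- assert (HP' : locally l (fun z : C => P (Re z))).
  { apply (continuous_fst (U := R_UniformSpace) (V := R_UniformSpace)), HP. }
  generalize (H _ HP'); unfold filtermapi; apply filter_imp.
  intros ab [y [Hy Py]]; exists (Re y); split; [apply (proj1 (intC_comp _ _ _ _) Hy) | exact Py].
- assert (HP' : locally l (fun z : C => P (Im z))).
  { apply (continuous_snd (U := R_UniformSpace) (V := R_UniformSpace)), HP. }
  generalize (H _ HP'); unfold filtermapi; apply filter_imp.
  intros ab [y [Hy Py]]; exists (Im y); split; [apply (proj1 (intC_comp _ _ _ _) Hy) | exact Py].
Qed.

Lemma int_range_unit : int_range 0 unit_interval (at_point 1).
Proof. unfold int_range, unit_interval, at_point; repeat split; intros; lra. Qed.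

Lemma int_range_ray a : int_range a (fun x => a <= x) (Rbar_locally p_infty).
Proof.
split; [exists a; intros; lra | split; intros; lra].
Qed.

Lemma filterlim_p_infty_inv (W : R -> R) L K b0 : (forall b, b0 < b -> Rabs (W b - L) <= K / b) ->
  filterlim W (Rbar_locally p_infty) (locally L).
Proof.
intros H P [e He].
exists (Rmax (Rmax b0 1) (K / e)); intros b Hb.
assert (B1 := Rmax_l (Rmax b0 1) (K / e)); assert (B2 := Rmax_r (Rmax b0 1) (K / e)).
assert (B3 := Rmax_l b0 1); assert (B4 := Rmax_r b0 1).
apply He; change (Rabs (W b - L) < e).
eapply Rle_lt_trans; [apply H; lra |].
assert (He0 := cond_pos e).
apply Rlt_div_l; [lra |].
assert (K / e < b) by lra.
apply Rlt_div_l in H0; lra.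
Qed.

Lemma gen_exp_decay kappa : 0 < kappa ->
  is_RInt_gen (fun x => exp (- kappa * x)) (at_point 0) (Rbar_locally p_infty) (/ kappa).
Proof.
intros Hk.
apply (gen_antiderivative (int_range_ray 0) _ (fun b => / kappa - / kappa * exp (- kappa * b))).
- intros b Hb; simpl in Hb.
  evar_last.
  { apply (is_RInt_derive (V := R_CompleteNormedModule) (fun x => - / kappa * exp (- kappa * x))).
    - intros x _; auto_derive; [easy |]; field; lra.
    - intros x _; apply ex_derive_continuous_R; auto_derive; easy. }
  unfold minus, plus, opp; simpl; rewrite Rmult_0_r, exp_0; ring.
- apply filterlim_p_infty_inv with (K := / kappa * / kappa) (b0 := 0); intros b Hb.
  assert (E := exp_ineq1_le (kappa * b)); assert (E0 := exp_pos (- kappa * b)).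
  assert (Ki : 0 < / kappa) by (apply Rinv_0_lt_compat; easy).
  replace (/ kappa - / kappa * exp (- kappa * b) - / kappa) with (- (/ kappa * exp (- kappa * b))) by ring.
  rewrite Rabs_Ropp, Rabs_pos_eq by nra.
  replace (/ kappa * / kappa / b) with (/ kappa * / (kappa * b)) by (field; lra).
  apply Rmult_le_compat_l; [lra |].
  replace (- kappa * b) with (- (kappa * b)) by ring; rewrite exp_Ropp.
  apply Rinv_le_contravar; nra.
Qed.

Lemma gen_inv_sq a s : 0 < a + s ->
  is_RInt_gen (fun x => / (x + s) ^ 2) (at_point a) (Rbar_locally p_infty) (/ (a + s)).
Proof.
intros Ha.
apply (gen_antiderivative (int_range_ray a) _ (fun b => / (a + s) - / (b + s))).
- intros b Hb; simpl in Hb.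
  evar_last.
  { apply (is_RInt_derive (V := R_CompleteNormedModule) (fun x => - / (x + s))).
    - intros x Hx; rewrite Rmin_left, Rmax_right in Hx by easy.
      auto_derive; [lra |]; field; lra.
    - intros x Hx; rewrite Rmin_left, Rmax_right in Hx by easy.
      apply ex_derive_continuous_R; auto_derive; nra. }
  unfold minus, plus, opp; simpl; ring.
- apply filterlim_p_infty_inv with (K := 2) (b0 := Rmax (- s) (2 * Rabs s)); intros b Hb.
  assert (B1 := Rmax_l (- s) (2 * Rabs s)); assert (B2 := Rmax_r (- s) (2 * Rabs s)).
  replace (/ (a + s) - / (b + s) - / (a + s)) with (- / (b + s)) by ring.
  assert (Hs : - (b / 2) < s) by (generalize (Rabs_def2 s (b / 2)); intros Q; apply Q; lra).
  assert (0 <= Rabs s) by apply Rabs_pos.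
  assert (P : 0 < / (b + s)) by (apply Rinv_0_lt_compat; lra).
  rewrite Rabs_Ropp, Rabs_pos_eq by lra.
  replace (2 / b) with (/ (b / 2)) by (field; lra).
  apply Rinv_le_contravar; lra.
Qed.

Lemma gen_scal_R {Fa Fb} {FFa : Filter Fa} {FFb : Filter Fb} (k : R) (f : R -> R) l :
  is_RInt_gen f Fa Fb l -> is_RInt_gen (fun x => k * f x) Fa Fb (k * l).
Proof. apply (is_RInt_gen_scal (V := R_NormedModule)). Qed.

(** * Vanishing moments *)

Section Moments.
Context {a0 : R} {X : R -> Prop} {F : (R -> Prop) -> Prop} {PF : ProperFilter F}.
Context (HX : int_range a0 X F).

(** The kernels of Landau are powers of quadratic polynomials in [psi]. *)
Lemma gen_quadratic_power (psi h : R -> R) (A B : R) :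
  (forall k, is_RInt_gen (fun x => psi x ^ k * h x) (at_point a0) F 0) ->
  forall N k, is_RInt_gen (fun x => psi x ^ k * (A + B * psi x - psi x ^ 2) ^ N * h x) (at_point a0) F 0.
Proof.
intros H; induction N as [| N IH]; intros k.
- apply (gen_ext_range HX (fun x => psi x ^ k * h x)); [intros; simpl; ring | apply H].
- assert (H0 := gen_scal_R A _ _ (IH k)).
  assert (H1 := gen_scal_R B _ _ (IH (S k))).
  assert (H2 := IH (S (S k))).
  assert (K := is_RInt_gen_minus (V := R_NormedModule) _ _ _ _
     (is_RInt_gen_plus (V := R_NormedModule) _ _ _ _ H0 H1) H2).
  unfold minus, plus, opp in K; simpl in K.
  replace (A * 0 + B * 0 + - 0) with 0 in K by ring.
  revert K; apply (gen_ext_range (V := R_NormedModule) HX); intros x _; simpl; ring.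
Qed.

(** The function [q = 1 + d^2 - (psi - psi x0)^2] exceeds a constant greater
    than [1] near [x0], and [0 <= q <= 1] wherever [h] may be negative. If
    [h x0] were positive, then the integral of [q^N h] would tend to infinity
    with [N]; but it vanishes, being a combination of moments. *)
Lemma landau_pos (psi h w : R -> R) (K x0 x1 : R) :
  a0 <= x0 < x1 -> F (fun b => x1 <= b) ->
  (forall x, X x -> continuous h x) -> (forall x, X x -> continuous psi x) ->
  (forall x, X x -> continuous w x) ->
  (forall x, X x -> 0 <= psi x <= 1) ->
  (forall eta, 0 < eta -> exists d, 0 < d /\
     forall x, X x -> eta <= Rabs (x - x0) -> d <= Rabs (psi x - psi x0)) ->
  (forall x, X x -> Rabs (h x) <= w x) -> is_RInt_gen w (at_point a0) F K ->
  (forall k, is_RInt_gen (fun x => psi x ^ k * h x) (at_point a0) F 0) ->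
  ~ 0 < h x0.
Proof.
intros Hx0 Fx1 Ch Cpsi Cw Hpsi Hsep Hw HK Hmom Hpos.
assert (X1 : X x1).
{ destruct (filter_ex (F := F) (fun b => X b /\ x1 <= b)) as [b [Hb Hb1]].
  - apply filter_and; [apply HX | exact Fx1].
  - apply (range_seg HX b); [exact Hb | lra]. }
assert (Xs : forall x, a0 <= x <= x1 -> X x) by (intros x Hx; apply (range_seg HX x1); assumption).
(* [h] stays above half its value near [x0] *)
destruct (Ch x0 (Xs x0 ltac:(lra)) (fun y => h x0 / 2 < y)) as [eta Heta].
{ apply open_gt; lra. }
destruct (Hsep eta (cond_pos eta)) as [d [Hd Hfar]].
assert (Cpsi0 := Cpsi x0 (Xs x0 ltac:(lra))).
destruct (Cpsi0 (fun y => Rabs (y - psi x0) < d / 2)) as [zeta Hzeta].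
{ assert (Hd2 : 0 < d / 2) by lra. exists (mkposreal _ Hd2); intros y Hy; exact Hy. }
set (x2 := Rmin x1 (x0 + Rmin eta zeta / 2)).
assert (Em : 0 < Rmin eta zeta) by (apply Rmin_glb_lt; apply cond_pos).
assert (Em1 := Rmin_l eta zeta); assert (Em2 := Rmin_r eta zeta).
assert (M1 := Rmin_l x1 (x0 + Rmin eta zeta / 2)); assert (M2 := Rmin_r x1 (x0 + Rmin eta zeta / 2)).
fold x2 in M1, M2.
assert (M3 : x0 < x2) by (apply Rmin_glb_lt; lra).
set (q := fun x => 1 + d ^ 2 - (psi x - psi x0) ^ 2).
assert (Near : forall x, X x -> Rabs (psi x - psi x0) < d -> 0 < h x).
{ intros x Hx Hp.
  destruct (Rle_lt_dec eta (Rabs (x - x0))) as [L | L].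
  - assert (H0 := Hfar x Hx L); lra.
  - assert (H0 := Heta x L); lra. }
assert (P1 : forall x, X x -> Rabs (psi x - psi x0) <= 1).
{ intros x Hx; apply Rabs_le; assert (H0 := Hpsi x Hx); assert (H1 := Hpsi x0 (Xs x0 ltac:(lra))); lra. }
assert (Low : forall N x, X x -> - w x <= q x ^ N * h x).
{ intros N x Hx.
  assert (H0 := Hw x Hx); assert (H1 := P1 x Hx).
  assert (Sq : (psi x - psi x0) ^ 2 = Rabs (psi x - psi x0) ^ 2) by (symmetry; apply pow2_abs).
  assert (H2 := Rabs_pos (psi x - psi x0)).
  apply Rabs_le_between in H0.
  destruct (Rlt_le_dec (Rabs (psi x - psi x0)) d) as [L | L].
  - assert (H3 := Near x Hx L).
    assert (0 <= q x ^ N).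
    { apply pow_le; unfold q; rewrite Sq; nra. }
    assert (0 <= q x ^ N * h x) by nra. lra.
  - assert (Q0 : 0 <= q x <= 1) by (unfold q; rewrite Sq; nra).
    assert (Q1 : 0 <= q x ^ N <= 1).
    { split; [apply pow_le; lra |]; rewrite <- (pow1 N); apply pow_incr; lra. }
    nra. }
set (kap := 1 + d ^ 2 / 2).
assert (High : forall N x, x0 <= x <= x2 -> kap ^ N * (h x0 / 2) <= q x ^ N * h x).
{ intros N x Hx.
  assert (Ax : Rabs (x - x0) < zeta /\ Rabs (x - x0) < eta) by (rewrite Rabs_pos_eq by lra; lra).
  assert (H0 := Hzeta x (proj1 Ax)); assert (H1 := Heta x (proj2 Ax)).
  apply Rmult_le_compat; [apply pow_le; unfold kap; nra | lra | | lra].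
  apply pow_incr; split; [unfold kap; nra |].
  unfold q, kap; rewrite <- (pow2_abs (psi x - psi x0)).
  assert (H2 := Rabs_pos (psi x - psi x0)); nra. }
assert (Xx2 : X x2) by (apply Xs; lra).
assert (Main : forall N, kap ^ N * (h x0 / 2) * (x2 - x0) <= K + 2).
{ intros N.
  assert (Hq : is_RInt_gen (fun x => q x ^ N * h x) (at_point a0) F 0).
  { assert (H0 := gen_quadratic_power psi h (1 + d ^ 2 - psi x0 ^ 2) (2 * psi x0) Hmom N 0).
    revert H0; apply (gen_ext_range (V := R_NormedModule) HX); intros x _; unfold q.
    rewrite pow_O, Rmult_1_l; f_equal; f_equal; ring. }
  assert (Cq : forall x, X x -> continuous (fun x => q x ^ N * h x) x).
  { intros x Hx; apply cont_Rmult; [| apply Ch, Hx].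
    apply (continuous_comp q (fun y => y ^ N)).
    - unfold q; apply cont_Rminus; [apply continuous_const |].
      apply (continuous_comp (fun x => psi x - psi x0) (fun y => y ^ 2)).
      + apply cont_Rminus; [apply Cpsi, Hx | apply continuous_const].
      + apply ex_derive_continuous_R; auto_derive; easy.
    - apply ex_derive_continuous_R; auto_derive; easy. }
  assert (L1 := proj1 (gen_lim (V := R_CompleteNormedModule) HX (fun x => q x ^ N * h x) 0 Cq) Hq).
  assert (L2 := proj1 (gen_lim (V := R_CompleteNormedModule) HX w K Cw) HK).
  assert (B1 := L1 _ (locally_ball (0 : R_UniformSpace) (mkposreal 1 Rlt_0_1))).
  assert (B2 := L2 _ (locally_ball (K : R_UniformSpace) (mkposreal 1 Rlt_0_1))).
  assert (B : F (fun b => (ball 0 1 (RInt (fun x => q x ^ N * h x) a0 b) /\ ball K 1 (RInt w a0 b))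
    /\ (X b /\ x1 <= b))).
  { apply filter_and; [apply filter_and; [exact B1 | exact B2] | apply filter_and; [apply HX | exact Fx1]]. }
  destruct (filter_ex _ B) as [b [[Hb1 Hb2] [Hb Hb3]]].
  apply Rabs_lt_between in Hb1; apply Rabs_lt_between in Hb2.
  unfold minus, plus, opp in Hb1, Hb2; simpl in Hb1, Hb2.
  assert (Xb : forall x, a0 <= x <= b -> X x) by (intros; apply (range_seg HX b); assumption).
  assert (Ex : forall (g : R -> R) u v, (forall x, X x -> continuous g x) -> a0 <= u <= v -> v <= b ->
     ex_RInt (V := R_CompleteNormedModule) g u v).
  { intros g u v Cg Huv Hv; apply (ex_RInt_continuous (V := R_CompleteNormedModule)).
    rewrite Rmin_left, Rmax_right by lra; intros z Hz; apply Cg, Xb; lra. }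
  set (f := fun x => q x ^ N * h x) in *.
  assert (Split : forall g : R -> R, (forall x, X x -> continuous g x) ->
     RInt g a0 b = RInt g a0 x0 + (RInt g x0 x2 + RInt g x2 b)).
  { intros g Cg.
    assert (E1 := RInt_Chasles (V := R_CompleteNormedModule) g a0 x0 b
      (Ex g a0 x0 Cg ltac:(lra) ltac:(lra)) (Ex g x0 b Cg ltac:(lra) ltac:(lra))).
    assert (E2 := RInt_Chasles (V := R_CompleteNormedModule) g x0 x2 b
      (Ex g x0 x2 Cg ltac:(lra) ltac:(lra)) (Ex g x2 b Cg ltac:(lra) ltac:(lra))).
    rewrite <- E1, <- E2; reflexivity. }
  assert (Cw' : forall x, X x -> continuous (fun x => - w x) x).
  { intros x Hx; apply cont_Ropp, Cw, Hx. }
  assert (Lo : forall u v, a0 <= u <= v -> v <= b -> - RInt w u v <= RInt f u v).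
  { intros u v Huv Hv.
    assert (E := RInt_opp (V := R_CompleteNormedModule) w u v (Ex w u v Cw ltac:(lra) ltac:(lra))).
    change (RInt (fun x => - w x) u v = - RInt w u v) in E; rewrite <- E.
    apply RInt_le; [lra | apply Ex; [exact Cw' | lra | lra] | apply Ex; [exact Cq | lra | lra] |].
    intros x Hx; apply Low, Xb; lra. }
  assert (Wpos : 0 <= RInt w x0 x2).
  { apply RInt_ge_0; [lra | apply Ex; [exact Cw | lra | lra] |].
    intros x Hx; eapply Rle_trans; [apply Rabs_pos | apply Hw, Xb; lra]. }
  assert (Mid : kap ^ N * (h x0 / 2) * (x2 - x0) <= RInt f x0 x2).
  { assert (E := RInt_const (V := R_CompleteNormedModule) x0 x2 (kap ^ N * (h x0 / 2))).
    unfold scal in E; simpl in E; unfold mult in E; simpl in E.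
    rewrite (Rmult_comm _ (x2 - x0)), <- E.
    apply RInt_le; [lra | apply (ex_RInt_const (V := R_NormedModule)) | apply Ex; [exact Cq | lra | lra] |].
    intros x Hx; apply High; lra. }
  assert (S1 := Split f Cq); assert (S2 := Split w Cw).
  assert (G1 := Lo a0 x0 ltac:(lra) ltac:(lra)); assert (G2 := Lo x2 b ltac:(lra) ltac:(lra)).
  lra. }
assert (Hk : 1 < kap) by (unfold kap; nra).
assert (Hc : 0 < h x0 / 2 * (x2 - x0)) by (apply Rmult_lt_0_compat; lra).
destruct (Pow_x_infinity kap) with (b := (Rabs (K + 2) + 1) / (h x0 / 2 * (x2 - x0))) as [N HN].
{ rewrite Rabs_pos_eq; lra. }
specialize (HN N (le_n N)).
rewrite Rabs_pos_eq in HN by (apply pow_le; lra).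
apply Rge_le, Rle_div_l in HN; [| exact Hc].
assert (HM := Main N); assert (K2 := Rle_abs (K + 2)); nra.
Qed.

(** Uniqueness in the moment problem for the powers of an injective [psi]:
    [landau_pos] is applied to both signs of the real and imaginary parts. *)
Lemma landau (psi : R -> R) (H : R -> C) (w : R -> R) (K x0 x1 : R) :
  a0 <= x0 < x1 -> F (fun b => x1 <= b) ->
  (forall x, X x -> continuous H x) -> (forall x, X x -> continuous psi x) ->
  (forall x, X x -> continuous w x) ->
  (forall x, X x -> 0 <= psi x <= 1) ->
  (forall eta, 0 < eta -> exists d, 0 < d /\
     forall x, X x -> eta <= Rabs (x - x0) -> d <= Rabs (psi x - psi x0)) ->
  (forall x, X x -> Cmod (H x) <= w x) -> is_RInt_gen w (at_point a0) F K ->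
  (forall k, genC (fun x => RtoC (psi x ^ k) * H x)%C (at_point a0) F (RtoC 0)) ->
  H x0 = RtoC 0.
Proof.
intros Hx0 Fx1 CH Cpsi Cw Hpsi Hsep Hw HK Hmom.
assert (CR : forall x, X x -> continuous (fun x => Re (H x)) x).
{ intros x Hx; apply (proj1 (continuous_C_comp H x)), CH, Hx. }
assert (CI : forall x, X x -> continuous (fun x => Im (H x)) x).
{ intros x Hx; apply (proj1 (continuous_C_comp H x)), CH, Hx. }
assert (BR : forall x, X x -> Rabs (Re (H x)) <= w x).
{ intros x Hx; eapply Rle_trans; [apply re_le_Cmod | apply Hw, Hx]. }
assert (BI : forall x, X x -> Rabs (Im (H x)) <= w x).
{ intros x Hx; eapply Rle_trans; [| apply Hw, Hx].
  eapply Rle_trans; [apply Rmax_r | apply Rmax_Cmod]. }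
assert (MR : forall k, is_RInt_gen (fun x => psi x ^ k * Re (H x)) (at_point a0) F 0).
{ intros k; generalize (proj1 (genC_comp _ _ (Hmom k))).
  apply (gen_ext_range (V := R_NormedModule) HX); intros x _; simpl; unfold Re; ring. }
assert (MI : forall k, is_RInt_gen (fun x => psi x ^ k * Im (H x)) (at_point a0) F 0).
{ intros k; generalize (proj2 (genC_comp _ _ (Hmom k))).
  apply (gen_ext_range (V := R_NormedModule) HX); intros x _; simpl; unfold Im; ring. }
assert (Neg : forall h : R -> R,
  (forall x, X x -> continuous h x) -> (forall x, X x -> Rabs (h x) <= w x) ->
  (forall k, is_RInt_gen (fun x => psi x ^ k * h x) (at_point a0) F 0) -> h x0 = 0).
{ intros h Ch Bh Mh.
  assert (N1 : ~ 0 < h x0) by (apply (landau_pos psi h w K x0 x1); assumption).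
  assert (N2 : ~ 0 < - h x0).
  { apply (landau_pos psi (fun x => - h x) w K x0 x1); try assumption.
    - intros x Hx; apply cont_Ropp, Ch, Hx.
    - intros x Hx; rewrite Rabs_Ropp; apply Bh, Hx.
    - intros k; assert (E := gen_scal_R (-1) _ _ (Mh k)).
      replace (-1 * 0) with 0 in E by ring.
      revert E; apply (gen_ext_range (V := R_NormedModule) HX); intros x _; rring. }
  lra. }
apply C_eq; simpl; [apply (Neg (fun x => Re (H x))) | apply (Neg (fun x => Im (H x)))]; assumption.
Qed.

(** The integral of [G1] differs from that of a difference quotient of [G],
    which is zero, by at most [h K]. The increments [h] are positive, so that
    this applies at the left end of a closed range of the parameter. *)
Lemma gen_derive_0 (G : R -> R -> C) (G1 : R -> C) (w : R -> R) (K h0 : R) :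
  0 < h0 ->
  (forall h, 0 <= h < h0 -> genC (G h) (at_point a0) F (RtoC 0)) ->
  (forall h, 0 <= h < h0 -> forall x, X x -> continuous (G h) x) ->
  (forall x, X x -> continuous G1 x) -> (forall x, X x -> continuous w x) ->
  is_RInt_gen w (at_point a0) F K ->
  (forall h x, 0 < h < h0 -> X x -> Cmod (G h x - G 0 x - RtoC h * G1 x) <= h ^ 2 * w x) ->
  genC G1 (at_point a0) F (RtoC 0).
Proof.
intros Hh0 HG CG CG1 Cw HK Hrem.
assert (Key : forall h, 0 < h < h0 -> exists l, genC G1 (at_point a0) F l /\ Cmod l <= h * K).
{ intros h Hh.
  destruct (genC_dominated HX (fun x => G h x - G 0 x - RtoC h * G1 x)%C (fun x => h ^ 2 * w x) (h ^ 2 * K))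
    as [l [Hl Bl]].
  - intros x Hx; apply cont_Cminus; [apply cont_Cminus; apply CG; auto; lra |].
    apply cont_Cmult; [apply continuous_const | apply CG1, Hx].
  - intros x Hx; apply cont_Rmult; [apply continuous_const | apply Cw, Hx].
  - intros x Hx; apply Hrem; assumption.
  - apply gen_scal_R, HK.
  - assert (Hn : RtoC h <> RtoC 0) by (intros E; apply RtoC_inj in E; lra).
    assert (H1 := range_minus HX (range_minus HX (HG h ltac:(lra)) (HG 0 ltac:(lra))) Hl).
    assert (H2 := range_scal HX (/ RtoC h)%C H1).
    exists (/ RtoC h * (0 - 0 - l))%C; split.
    + revert H2; apply (genC_ext HX); intros x _; simpl.
      as_eq_C; field; exact Hn.
    + replace (/ RtoC h * (0 - 0 - l))%C with (- (/ RtoC h * l))%C by ring.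
      rewrite Cmod_opp, Cmod_mult, Cmod_inv, Cmod_R, Rabs_pos_eq by (try exact Hn; lra).
      apply Rmult_le_reg_l with h; [lra |].
      rewrite <- Rmult_assoc, Rinv_r, Rmult_1_l by lra; nra. }
destruct (Key (h0 / 2) ltac:(lra)) as [l [Hl _]].
assert (Kpos : 0 <= K).
{ destruct (Key (h0 / 2) ltac:(lra)) as [m [_ Bm]]; assert (0 <= Cmod m) by apply Cmod_ge_0; nra. }
enough (E : l = RtoC 0) by (rewrite <- E; exact Hl).
apply Cmod_eq_0; apply Rle_antisym; [| apply Cmod_ge_0].
apply Rnot_lt_le; intros P.
set (h := Rmin (h0 / 2) (Cmod l / (2 * (K + 1)))).
assert (Hq : 0 < Cmod l / (2 * (K + 1))) by (apply Rdiv_lt_0_compat; lra).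
assert (M1 := Rmin_l (h0 / 2) (Cmod l / (2 * (K + 1)))); assert (M2 := Rmin_r (h0 / 2) (Cmod l / (2 * (K + 1)))).
assert (M0 : 0 < h) by (apply Rmin_glb_lt; lra).
fold h in M1, M2.
destruct (Key h ltac:(lra)) as [m [Hm Bm]].
rewrite (genC_unique _ _ _ Hl Hm) in *.
assert (Cmod m / (2 * (K + 1)) * (2 * (K + 1)) = Cmod m) by (field; lra).
nra.
Qed.

End Moments.

(** * The transform [g |-> int e^{-i mu x} g(x) dx] *)

Definition transform (F : (R -> Prop) -> Prop) (g : R -> C) (mu : C) : C :=
  @RInt_gen C_R_CompleteNormedModule (fun x => em mu x * g x)%C (at_point 0) F.

(** The margin [h] gives integrability for frequencies near [mu], and the
    factor [1 + x] a Lipschitz bound there. *)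
Definition transformable (X : R -> Prop) (F : (R -> Prop) -> Prop) (g : R -> C) (mu : C) : Prop :=
  (forall x, X x -> continuous g x) /\
  exists (h K : R) (w : R -> R), 0 < h /\ (forall x, X x -> continuous w x) /\
    is_RInt_gen w (at_point 0) F K /\
    forall x, X x -> (1 + x) * exp ((Im mu + h) * x) * Cmod (g x) <= w x.

Lemma cont_em mu (x : R) : continuous (em mu) x.
Proof. eapply derC_cont, derC_em. Qed.

Lemma exp_le_mono a b : a <= b -> exp a <= exp b.
Proof. intros [H | ->]; [apply Rlt_le, exp_increasing, H | apply Rle_refl]. Qed.

Section Transform.
Context {X : R -> Prop} {F : (R -> Prop) -> Prop} {PF : ProperFilter F}.
Context (HX : int_range 0 X F).

Lemma range_ge_0 x : X x -> 0 <= x.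
Proof. apply HX. Qed.

Lemma transform_unique g mu l : genC (fun x => em mu x * g x)%C (at_point 0) F l -> transform F g mu = l.
Proof. apply (is_RInt_gen_unique (V := C_R_CompleteNormedModule)). Qed.

Lemma transform_dominated g mu w K :
  (forall x, X x -> continuous g x) -> (forall x, X x -> continuous w x) ->
  (forall x, X x -> Cmod (em mu x * g x) <= w x) -> is_RInt_gen w (at_point 0) F K ->
  genC (fun x => em mu x * g x)%C (at_point 0) F (transform F g mu) /\ Cmod (transform F g mu) <= K.
Proof.
intros Cg Cw H HK.
destruct (genC_dominated HX (fun x => em mu x * g x)%C w K) as [l [Hl Bl]]; try assumption.
- intros x Hx; apply cont_Cmult; [apply cont_em | apply Cg, Hx].
- rewrite (transform_unique g mu l Hl); split; assumption.
Qed.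

Lemma Im_le_Cmod (z : C) : Im z <= Cmod z.
Proof.
eapply Rle_trans; [apply Rle_abs |]; eapply Rle_trans; [apply Rmax_r | apply Rmax_Cmod].
Qed.

Lemma transformable_near g mu0 : transformable X F g mu0 ->
  exists h K, 0 < h /\ forall mu, Cmod (mu - mu0) <= h ->
    genC (fun x => em mu x * g x)%C (at_point 0) F (transform F g mu) /\
    Cmod (transform F g mu - transform F g mu0) <= Cmod (mu - mu0) * K.
Proof.
intros [Cg (h & K & w & Hh & Cw & HK & Hw)].
assert (I : forall mu, Cmod (mu - mu0) <= h ->
  genC (fun x => em mu x * g x)%C (at_point 0) F (transform F g mu)).
{ intros mu Hmu; apply (transform_dominated g mu w K); try assumption.
  intros x Hx; assert (H0 := range_ge_0 x Hx).
  eapply Rle_trans; [| apply Hw, Hx].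
  rewrite Cmod_mult, Cmod_em; apply Rmult_le_compat_r; [apply Cmod_ge_0 |].
  assert (E : exp (Im mu * x) <= exp ((Im mu0 + h) * x)).
  { apply exp_le_mono, Rmult_le_compat_r; [exact H0 |].
    assert (H1 := Im_le_Cmod (mu - mu0)%C); simpl in H1; unfold Im in *; lra. }
  assert (H1 := exp_pos ((Im mu0 + h) * x)); nra. }
exists h, K; split; [exact Hh |]; intros mu Hmu; split; [apply I, Hmu |].
assert (D : genC (fun x => em mu x * g x - em mu0 x * g x)%C (at_point 0) F
  (transform F g mu - transform F g mu0)%C).
{ apply genC_minus; apply I; [exact Hmu |].
  replace (mu0 - mu0)%C with (RtoC 0) by ring; rewrite Cmod_0; lra. }
apply (genC_bound HX _ (fun x => Cmod (mu - mu0) * w x) _ _) with (2 := D).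
- intros x Hx; assert (H0 := range_ge_0 x Hx).
  eapply Rle_trans; [| apply Rmult_le_compat_l; [apply Cmod_ge_0 | apply Hw, Hx]].
  replace (em mu x * g x - em mu0 x * g x)%C
    with (em mu0 x * (Cexp (- Ci * (mu - mu0) * RtoC x) - 1) * g x)%C.
  2: { replace mu with (mu0 + (mu - mu0))%C at 2 by ring.
       rewrite em_add_freq; unfold em at 3; ring. }
  rewrite !Cmod_mult, Cmod_em, <- !Rmult_assoc.
  apply Rmult_le_compat_r; [apply Cmod_ge_0 |].
  assert (H1 := Cmod_exp_1 (- Ci * (mu - mu0) * RtoC x)).
  assert (Em : Cmod (- Ci * (mu - mu0) * RtoC x) = Cmod (mu - mu0) * x).
  { rewrite !Cmod_mult, Cmod_opp, Cmod_Ci, Cmod_R, Rabs_pos_eq by exact H0; ring. }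
  rewrite Em in H1.
  assert (H2 : exp (Cmod (mu - mu0) * x) <= exp (h * x)).
  { apply exp_le_mono, Rmult_le_compat_r; assumption. }
  assert (H3 : exp ((Im mu0 + h) * x) = exp (Im mu0 * x) * exp (h * x)).
  { rewrite <- exp_plus; f_equal; ring. }
  rewrite H3.
  assert (P1 := exp_pos (Im mu0 * x)); assert (P2 := exp_pos (h * x)).
  assert (P3 := Cmod_ge_0 (mu - mu0)).
  replace (Cmod (mu - mu0) * (1 + x) * (exp (Im mu0 * x) * exp (h * x)))
    with (exp (Im mu0 * x) * (Cmod (mu - mu0) * (1 + x) * exp (h * x))) by ring.
  apply Rmult_le_compat_l; [lra |].
  eapply Rle_trans; [exact H1 |].
  apply Rmult_le_compat; [nra | left; apply exp_pos | nra | exact H2].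
- apply gen_scal_R, HK.
Qed.

Lemma transform_int g mu : transformable X F g mu ->
  genC (fun x => em mu x * g x)%C (at_point 0) F (transform F g mu).
Proof.
intros H; destruct (transformable_near g mu H) as (h & K & Hh & N).
apply N; replace (mu - mu)%C with (RtoC 0) by ring; rewrite Cmod_0; lra.
Qed.

Lemma transform_cont g mu : transformable X F g mu -> continuous (transform F g) mu.
Proof.
intros H; destruct (transformable_near g mu H) as (h & K & Hh & N).
assert (K0 : 0 < Rabs K + 1) by (generalize (Rabs_pos K); lra).
apply (filterlim_Cmod (locally mu) _ (transform F g)); intros e He.
assert (Hr : 0 < Rmin h (e / (Rabs K + 1))).
{ apply Rmin_glb_lt; [exact Hh | apply Rdiv_lt_0_compat; assumption]. }
generalize (locally_Cmod mu _ Hr); apply filter_imp; intros nu Hnu.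
assert (M1 := Rmin_l h (e / (Rabs K + 1))); assert (M2 := Rmin_r h (e / (Rabs K + 1))).
assert (L1 : Cmod (nu - mu) <= h) by lra.
assert (L2 : Cmod (nu - mu) < e / (Rabs K + 1)) by lra.
destruct (N nu L1) as [_ B].
apply Rlt_div_r in L2; [| exact K0].
assert (P := Cmod_ge_0 (nu - mu)); assert (Q := Rle_abs K); nra.
Qed.

End Transform.

(** * Integration by parts *)

(** What three integrations by parts of [e^{-i mu x} i f'''(x)] leave at [x],
    when [u k] is the [k]-th derivative of [f]. *)
Definition boundary_term (u : nat -> R -> C) (mu : C) (x : R) : C :=
  (Ci * em mu x * (u 2%nat x + Ci * mu * u 1%nat x - mu ^ 2 * u 0%nat x))%C.

Lemma Ci_sq : (Ci * Ci)%C = (- RtoC 1)%C.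
Proof. apply C_eq; simpl; ring. Qed.

Lemma by_parts (u : nat -> R -> C) mu b : 0 <= b ->
  (forall k x, 0 <= x <= b -> derC (u k) x (u (S k) x)) ->
  intC (fun x => em mu x * (Ci * u 3%nat x) - mu ^ 3 * (em mu x * u 0%nat x))%C 0 b
    (boundary_term u mu b - boundary_term u mu 0)%C.
Proof.
intros Hb D.
assert (Cu : forall k x, 0 <= x <= b -> continuous (u k) x).
{ intros k x Hx; eapply derC_cont, D, Hx. }
apply intC_derive; [exact Hb | |].
- intros x Hx; unfold boundary_term; evar_last.
  { apply derC_mult.
    - apply derC_scal, derC_em.
    - apply derC_minus; [apply derC_plus |].
      + apply D, Hx.
      + apply derC_scal, D, Hx.
      + apply derC_scal, D, Hx. }
  as_eq_C.
  assert (E2 := Ci_sq).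
  transitivity (em mu x * (Ci * u 3%nat x) + (Ci * Ci) * em mu x * (- mu * u 2%nat x + mu * u 2%nat x)
    + (Ci * Ci) * Ci * em mu x * (- mu ^ 2 * u 1%nat x)
    - Ci * em mu x * mu ^ 2 * u 1%nat x + (Ci * Ci) * em mu x * mu ^ 3 * u 0%nat x)%C;
    [simpl; ring |].
  rewrite E2; simpl; ring.
- intros x Hx; apply cont_Cminus.
  + apply cont_Cmult; [apply cont_em |].
    apply (cont_Cmult (fun _ => Ci)); [apply continuous_const | apply Cu, Hx].
  + apply (cont_Cmult (fun _ => mu ^ 3)%C); [apply continuous_const |].
    apply cont_Cmult; [apply cont_em | apply Cu, Hx].
Qed.

(** Here [i (i mu)^3 = mu^3] makes the transform diagonalise [i f'''] up to the
    boundary terms. *)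
Lemma transform_third {X F} {PF : ProperFilter F} (HX : int_range 0 X F) (u : nat -> R -> C) mu L :
  (forall k x, X x -> derC (u k) x (u (S k) x)) ->
  transformable X F (u 0%nat) mu -> transformable X F (fun x => Ci * u 3%nat x)%C mu ->
  filterlim (boundary_term u mu) F (locally L) ->
  transform F (fun x => Ci * u 3%nat x)%C mu
    = (mu ^ 3 * transform F (u 0%nat) mu + (L - boundary_term u mu 0))%C.
Proof.
intros D T0 T3 HL.
assert (H0 := range_scal HX (mu ^ 3)%C (transform_int HX _ _ T0)).
assert (H3 := transform_int HX _ _ T3).
assert (H := range_minus HX H3 H0).
assert (H' : genC (fun x => em mu x * (Ci * u 3%nat x) - mu ^ 3 * (em mu x * u 0%nat x))%C (at_point 0) F
  (L - boundary_term u mu 0)%C).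
{ apply (gen_antiderivative (V := C_R_NormedModule) HX _ (fun b => boundary_term u mu b - boundary_term u mu 0)%C).
  - intros b Hb; apply by_parts; [apply HX, Hb |].
    intros k x Hx; apply D, (range_seg HX b); assumption.
  - apply (filterlim_comp _ _ _ (boundary_term u mu) (fun z => z - boundary_term u mu 0)%C _ _ _ HL).
    apply (cont_Cminus (U := C_UniformSpace) (fun z => z) (fun _ => boundary_term u mu 0) L);
      [apply continuous_id | apply continuous_const]. }
assert (E := genC_unique _ _ _ H H'); simpl in E.
rewrite <- E; ring.
Qed.

(** * Integrals along the boundary of a sector *)

Definition path_int (gamma : R -> C) (g : C -> C) (v : C) : Prop :=
  genC (fun t => g (gamma t) * path_deriv gamma t)%C
    (Rbar_locally m_infty) (Rbar_locally p_infty) v.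

Lemma path_int_ext gamma g1 g2 v : (forall t, g1 (gamma t) = g2 (gamma t)) ->
  path_int gamma g1 v -> path_int gamma g2 v.
Proof.
intros E; unfold path_int.
apply (is_RInt_gen_ext (V := C_R_NormedModule) (Fa := Rbar_locally m_infty) (Fb := Rbar_locally p_infty)).
apply filter_forall; intros ab x _; rewrite E; reflexivity.
Qed.

Lemma path_int_minus gamma g1 g2 v1 v2 : path_int gamma g1 v1 -> path_int gamma g2 v2 ->
  path_int gamma (fun z => g1 z - g2 z)%C (v1 - v2)%C.
Proof.
intros H1 H2; assert (H := genC_minus (Fa := Rbar_locally m_infty) (Fb := Rbar_locally p_infty) _ _ _ _ H1 H2).
unfold path_int; revert H.
apply (is_RInt_gen_ext (V := C_R_NormedModule) (Fa := Rbar_locally m_infty) (Fb := Rbar_locally p_infty)).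
apply filter_forall; intros ab x _; cring.
Qed.

Lemma polar_Cexp r th : polar r th = (RtoC r * Cexp (Ci * RtoC th))%C.
Proof.
unfold polar, Cexp; apply C_eq; simpl.
- replace (0 * th - 1 * 0) with 0 by ring; rewrite exp_0.
  replace (0 * 0 + 1 * th) with th by ring; ring.
- replace (0 * th - 1 * 0) with 0 by ring; rewrite exp_0.
  replace (0 * 0 + 1 * th) with th by ring; ring.
Qed.

Lemma polar_scal r th : polar r th = (RtoC r * polar 1 th)%C.
Proof. rewrite (polar_Cexp r), (polar_Cexp 1); ring. Qed.

Lemma polar_neq_0 r th : 0 < r -> polar r th <> RtoC 0.
Proof. intros Hr E; assert (H := Cmod_polar r th ltac:(lra)); rewrite E, Cmod_0 in H; lra. Qed.

Lemma derC_polar (r th : R -> R) (t dr dth : R) : is_derive r t dr -> is_derive th t dth ->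
  derC (fun u => polar (r u) (th u)) t
    (RtoC dr * polar 1 (th t) + RtoC dth * (Ci * polar (r t) (th t)))%C.
Proof.
intros Hr Hth.
apply (derC_ext (fun u => RtoC (r u) * Cexp (Ci * RtoC (th u)))%C).
{ intros u; symmetry; apply polar_Cexp. }
evar_last.
{ apply derC_mult; [apply derC_RtoC, Hr |].
  apply (derC_Cexp (fun u => Ci * RtoC (th u))%C), derC_scal, derC_RtoC, Hth. }
rewrite (polar_Cexp (r t)), (polar_Cexp 1); cring.
Qed.

Lemma cont_polar {U : UniformSpace} (r th : U -> R) (x : U) :
  continuous r x -> continuous th x -> continuous (fun u => polar (r u) (th u)) x.
Proof.
intros Hr Hth; apply continuous_C_comp; split.
- apply cont_Rmult; [exact Hr | apply continuous_comp; [exact Hth | apply continuous_cos]].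
- apply cont_Rmult; [exact Hr | apply continuous_comp; [exact Hth | apply continuous_sin]].
Qed.

Lemma path_deriv_loc (gamma p : R -> C) (t : R) (l : C) :
  locally t (fun u => p u = gamma u) -> derC p t l -> path_deriv gamma t = l.
Proof.
intros HL D; apply (is_derive_ext_loc (V := C_R_NormedModule) _ _ _ _ HL) in D.
apply derC_comp in D; destruct D as [D1 D2].
rewrite (path_deriv_val gamma t (Re l) (Im l) D1 D2); symmetry; apply surjective_pairing.
Qed.

Lemma genC_reflect f a l : genC f (at_point a) (Rbar_locally p_infty) l ->
  genC (fun t => f (- t)) (Rbar_locally m_infty) (at_point (- a)) l.
Proof.
intros H P HP; destruct (H P HP) as [Q S HQ [M HM] HQS].
exists (fun b => b < - M) (fun b => b = - a); [exists (- M); auto | reflexivity |].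
intros x y Hx ->; simpl.
destruct (HQS a (- x) HQ (HM (- x) ltac:(simpl; lra))) as [z [Hz Pz]]; simpl in Hz.
exists z; split; [| exact Pz].
apply (is_RInt_swap (V := C_R_NormedModule)) in Hz.
replace a with (- - a) in Hz by ring.
assert (K := is_RInt_comp_opp (V := C_R_NormedModule) f x (- a) _ Hz).
assert (K2 := is_RInt_opp (V := C_R_NormedModule) _ _ _ _ K).
replace (opp (opp z)) with z in K2 by (symmetry; apply opp_opp).
revert K2; apply (is_RInt_ext (V := C_R_NormedModule)); intros; apply opp_opp.
Qed.

Section SectorPath.
Context (rho a b : R) (Hrho : 0 < rho) (Hab : a < b).

Lemma sector_path_l t : t <= - rho -> sector_path rho a b t = polar (- t) b.
Proof. intros H; unfold sector_path; destruct (Rle_dec t (- rho)); [reflexivity | lra]. Qed.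

Lemma sector_path_r t : rho <= t -> sector_path rho a b t = polar t a.
Proof.
intros H; unfold sector_path; destruct (Rle_dec t (- rho)); [lra |].
destruct (Rle_dec rho t); [reflexivity | lra].
Qed.

Lemma sector_path_m t : - rho < t < rho ->
  sector_path rho a b t = polar rho ((a + b) / 2 - t / rho * ((b - a) / 2)).
Proof.
intros H; unfold sector_path; destruct (Rle_dec t (- rho)); [lra |].
destruct (Rle_dec rho t); [lra | reflexivity].
Qed.

(** Polar coordinates of the points of [sector_path rho a b]. *)
Definition sector_edge (r th : R) : Prop :=
  (rho <= r /\ (th = a \/ th = b)) \/ (r = rho /\ a <= th <= b).

Lemma sector_path_edge t : exists r th, sector_edge r th /\ sector_path rho a b t = polar r th.
Proof.
unfold sector_edge; destruct (Rle_dec t (- rho)) as [H | H]; [| destruct (Rle_dec rho t) as [H' | H']].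
- exists (- t), b; split; [left; lra | apply sector_path_l, H].
- exists t, a; split; [left; lra | apply sector_path_r, H'].
- exists rho, ((a + b) / 2 - t / rho * ((b - a) / 2)); split; [right | apply sector_path_m; lra].
  assert (E : t / rho * rho = t) by (field; lra).
  split; [reflexivity |]; assert (-1 <= t / rho <= 1) by (split; nra); nra.
Qed.

Lemma path_deriv_l t : t < - rho -> path_deriv (sector_path rho a b) t = (- polar 1 b)%C.
Proof.
intros H; apply (path_deriv_loc _ (fun u => polar (- u) b)).
- generalize (open_lt (- rho) t H); apply filter_imp; intros u Hu.
  symmetry; apply sector_path_l, Rlt_le, Hu.
- evar_last; [apply (derC_polar (fun u => - u) (fun _ => b) t (-1) 0); auto_derive; easy |].
  replace (-1) with (- (1)) by ring; rewrite RtoC_opp; cring.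
Qed.

Lemma path_deriv_r t : rho < t -> path_deriv (sector_path rho a b) t = polar 1 a.
Proof.
intros H; apply (path_deriv_loc _ (fun u => polar u a)).
- generalize (open_gt rho t H); apply filter_imp; intros u Hu.
  symmetry; apply sector_path_r, Rlt_le, Hu.
- evar_last; [apply (derC_polar (fun u => u) (fun _ => a) t 1 0); auto_derive; easy |].
  cring.
Qed.

Lemma path_deriv_m t : - rho < t < rho -> path_deriv (sector_path rho a b) t =
  (RtoC (- ((b - a) / 2 / rho)) * (Ci * sector_path rho a b t))%C.
Proof.
intros H; rewrite sector_path_m by exact H.
apply (path_deriv_loc _ (fun u => polar rho ((a + b) / 2 - u / rho * ((b - a) / 2)))).
- assert (Ho : locally t (fun u => - rho < u /\ u < rho)).
  { apply filter_and; [apply open_gt; lra | apply open_lt; lra]. }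
  revert Ho; apply filter_imp; intros u Hu; symmetry; apply sector_path_m, Hu.
- evar_last.
  { apply (derC_polar (fun _ => rho) (fun u => (a + b) / 2 - u / rho * ((b - a) / 2)) t 0
      (- ((b - a) / 2 / rho))); auto_derive; try easy; field; lra. }
  cring.
Qed.

(** The path comes in along the ray [th = b], follows the arc clockwise, and
    leaves along [th = a]. *)
Lemma path_int_sector (g : C -> C) (Ia Ib M : C) :
  genC (fun r => g (polar r a) * polar 1 a)%C (at_point rho) (Rbar_locally p_infty) Ia ->
  genC (fun r => g (polar r b) * polar 1 b)%C (at_point rho) (Rbar_locally p_infty) Ib ->
  intC (fun th => g (polar rho th) * (Ci * polar rho th))%C a b M ->
  path_int (sector_path rho a b) g (Ia - M - Ib)%C.
Proof.
intros HIa HIb HM.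
assert (H1 : genC (fun t => g (sector_path rho a b t) * path_deriv (sector_path rho a b) t)%C
   (Rbar_locally m_infty) (at_point (- rho)) (- Ib)%C).
{ assert (K := genC_reflect _ _ _ HIb).
  assert (K2 := is_RInt_gen_opp (V := C_R_NormedModule) (Fa := Rbar_locally m_infty) (Fb := at_point (- rho)) _ _ K).
  revert K2; apply (is_RInt_gen_ext (V := C_R_NormedModule)).
  exists (fun x => x < - rho) (fun x => x = - rho); [exists (- rho); auto | reflexivity |].
  intros x y Hx -> t Ht; simpl in Ht; rewrite Rmin_left, Rmax_right in Ht by lra.
  rewrite sector_path_l, path_deriv_l by lra.
  change (- (g (polar (- t) b) * polar 1 b) = g (polar (- t) b) * - polar 1 b)%C; ring. }
assert (H2 : genC (fun t => g (sector_path rho a b t) * path_deriv (sector_path rho a b) t)%C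
   (at_point (- rho)) (at_point rho) (- M)%C).
{ apply (is_RInt_gen_at_point (V := C_R_NormedModule)).
  apply (is_RInt_swap (V := C_R_NormedModule)) in HM.
  assert (K := is_RInt_comp_lin (V := C_R_NormedModule)
    (fun th => g (polar rho th) * (Ci * polar rho th))%C (- ((b - a) / 2 / rho)) ((a + b) / 2) (- rho) rho (- M)%C).
  replace (- ((b - a) / 2 / rho) * - rho + (a + b) / 2) with b in K by (field; lra).
  replace (- ((b - a) / 2 / rho) * rho + (a + b) / 2) with a in K by (field; lra).
  specialize (K HM); revert K; apply (is_RInt_ext (V := C_R_NormedModule)).
  intros t Ht; rewrite Rmin_left, Rmax_right in Ht by lra.
  rewrite scal_C, path_deriv_m, sector_path_m by exact Ht.
  replace (- ((b - a) / 2 / rho) * t + (a + b) / 2) with ((a + b) / 2 - t / rho * ((b - a) / 2)) by (field; lra).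
  cring. }
assert (H3 : genC (fun t => g (sector_path rho a b t) * path_deriv (sector_path rho a b) t)%C
   (at_point rho) (Rbar_locally p_infty) Ia).
{ revert HIa; apply (is_RInt_gen_ext (V := C_R_NormedModule)).
  exists (fun x => x = rho) (fun x => rho < x); [reflexivity | exists rho; auto |].
  intros x y -> Hy t Ht; simpl in Ht; rewrite Rmin_left, Rmax_right in Ht by lra.
  rewrite sector_path_r, path_deriv_r by lra; reflexivity. }
assert (K := is_RInt_gen_Chasles (V := C_R_NormedModule) (Fa := Rbar_locally m_infty) (Fc := at_point rho) _ _ _ _ H1 H2).
assert (K' := is_RInt_gen_Chasles (V := C_R_NormedModule) (Fa := Rbar_locally m_infty) (Fc := Rbar_locally p_infty) _ _ _ _ K H3).
assert (E : (Ia - M - Ib)%C = (- Ib + - M + Ia)%C) by ring.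
rewrite E; exact K'.
Qed.

Lemma ray_ex (g : C -> C) th (K : R) :
  (forall r, rho <= r -> continuous g (polar r th)) ->
  (forall r, rho <= r -> Cmod (g (polar r th)) <= K / r ^ 2) ->
  exists v, genC (fun r => g (polar r th) * polar 1 th)%C (at_point rho) (Rbar_locally p_infty) v.
Proof.
intros Cg Bg.
destruct (genC_dominated (int_range_ray rho) (fun r => g (polar r th) * polar 1 th)%C (fun r => K * / (r + 0) ^ 2)
  (K * / (rho + 0))) as [v [Hv _]].
- intros r Hr; apply (cont_Cmult (fun r => g (polar r th)) (fun _ => polar 1 th)); [| apply continuous_const].
  apply (continuous_comp (fun r => polar r th) g); [| apply Cg, Hr].
  apply cont_polar; [apply continuous_id | apply continuous_const].
- intros r Hr; apply ex_derive_continuous_R; auto_derive.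
  assert (0 < r) by lra; rewrite Rplus_0_r, Rmult_1_r; apply Rmult_integral_contrapositive; lra.
- intros r Hr; rewrite Cmod_mult, (Cmod_polar 1), Rmult_1_r, Rplus_0_r by lra; apply Bg, Hr.
- apply gen_scal_R, gen_inv_sq; lra.
- exists v; exact Hv.
Qed.

Lemma path_int_sector_ex (g : C -> C) (K : R) :
  (forall r th, sector_edge r th -> continuous g (polar r th)) ->
  (forall r th, rho <= r -> th = a \/ th = b -> Cmod (g (polar r th)) <= K / r ^ 2) ->
  exists v, path_int (sector_path rho a b) g v.
Proof.
intros Cg Bg.
destruct (ray_ex g a K) as [Ia HIa]; [intros r Hr; apply Cg; left; auto | auto |].
destruct (ray_ex g b K) as [Ib HIb]; [intros r Hr; apply Cg; left; auto | auto |].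
assert (HM : intC (fun th => g (polar rho th) * (Ci * polar rho th))%C a b
  (RIntC (fun th => g (polar rho th) * (Ci * polar rho th))%C a b)).
{ apply intC_ex; rewrite Rmin_left, Rmax_right by lra; intros th Hth.
  assert (Cp : continuous (fun th => polar rho th) th).
  { apply cont_polar; [apply continuous_const | apply continuous_id]. }
  apply (cont_Cmult (fun th => g (polar rho th)) (fun th => Ci * polar rho th)%C).
  - apply (continuous_comp (fun th => polar rho th) g); [exact Cp | apply Cg; right; auto].
  - apply (cont_Cmult (fun _ => Ci)); [apply continuous_const | exact Cp]. }
eexists; apply path_int_sector; eassumption.
Qed.

End SectorPath.

(** * Cauchy's theorem for a sector *)

Lemma cont_pair_const (u th : R) : continuous (fun t : R => (u, t) : R * R) th.
Proof.
intros P [e He]; exists e; intros t Ht; apply He; split; [apply ball_center | exact Ht].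
Qed.

Lemma RInt_param_R (H H1 : R -> R -> R) (a b T : R) : a <= b -> 0 < T ->
  (forall u th, 0 < u -> is_derive (fun s => H s th) u (H1 u th)) ->
  (forall u th, 0 < u -> continuous (fun p : R * R => H1 (fst p) (snd p)) ((u, th) : R * R)) ->
  (forall u th, 0 < u -> continuous (H u) th) ->
  is_derive (fun u => RInt (H u) a b) T (RInt (H1 T) a b).
Proof.
intros Hab HT D C1 C0.
assert (HL : locally T (fun u => 0 < u)) by (apply open_gt, HT).
evar_last.
{ apply (is_derive_RInt_param H a b T).
  - revert HL; apply filter_imp; intros u Hu th _; eexists; apply D, Hu.
  - intros th _.
    apply continuity_2d_pt_ext_loc with H1.
    + destruct HL as [e He]; exists e; intros u v Hu _.
      symmetry; apply is_derive_unique, D, He, Hu.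
    + apply continuity_2d_pt_filterlim, (C1 T th HT).
  - revert HL; apply filter_imp; intros u Hu.
    apply (ex_RInt_continuous (V := R_CompleteNormedModule)); intros z _; apply C0, Hu. }
apply (RInt_ext (V := R_CompleteNormedModule)); intros th _; apply is_derive_unique, D, HT.
Qed.

Lemma RIntC_comp f a b : (forall x, Rmin a b <= x <= Rmax a b -> continuous f x) ->
  RIntC f a b = (RInt (fun t => Re (f t)) a b, RInt (fun t => Im (f t)) a b).
Proof.
intros Cf; assert (H := intC_ex f a b Cf); apply intC_comp in H; destruct H as [H1 H2].
rewrite (is_RInt_unique (V := R_CompleteNormedModule) _ _ _ _ H1),
  (is_RInt_unique (V := R_CompleteNormedModule) _ _ _ _ H2); apply surjective_pairing.
Qed.

Lemma RInt_param_C (H H1 : R -> R -> C) (a b T : R) : a <= b -> 0 < T ->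
  (forall u th, 0 < u -> derC (fun s => H s th) u (H1 u th)) ->
  (forall u th, 0 < u -> continuous (fun p : R * R => H1 (fst p) (snd p)) ((u, th) : R * R)) ->
  (forall u th, 0 < u -> continuous (H u) th) ->
  derC (fun u => RIntC (H u) a b) T (RIntC (H1 T) a b).
Proof.
intros Hab HT D C1 C0.
assert (C1' : forall u th, 0 < u -> continuous (H1 u) th).
{ intros u th Hu; apply (continuous_comp (fun th => (u, th)) (fun p : R * R => H1 (fst p) (snd p))).
  - apply cont_pair_const.
  - apply C1, Hu. }
rewrite RIntC_comp by (intros; apply C1', HT).
assert (HL : locally T (fun u => 0 < u)) by (apply open_gt, HT).
apply (is_derive_ext_loc (V := C_R_NormedModule)
  (fun u => (RInt (fun t => Re (H u t)) a b, RInt (fun t => Im (H u t)) a b))).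
{ revert HL; apply filter_imp; intros u Hu; symmetry; apply RIntC_comp; intros; apply C0, Hu. }
apply derC_pair.
- apply (RInt_param_R (fun u t => Re (H u t)) (fun u t => Re (H1 u t))); try assumption.
  + intros u th Hu; apply (proj1 (derC_comp _ _ _) (D u th Hu)).
  + intros u th Hu; apply (proj1 (continuous_C_comp _ _) (C1 u th Hu)).
  + intros u th Hu; apply (proj1 (continuous_C_comp _ _) (C0 u th Hu)).
- apply (RInt_param_R (fun u t => Im (H u t)) (fun u t => Im (H1 u t))); try assumption.
  + intros u th Hu; apply (proj1 (derC_comp _ _ _) (D u th Hu)).
  + intros u th Hu; apply (proj1 (continuous_C_comp _ _) (C1 u th Hu)).
  + intros u th Hu; apply (proj1 (continuous_C_comp _ _) (C0 u th Hu)).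
Qed.

(** Complex differentiability away from zero, as a chain rule along curves:
    Cauchy's theorem is derived from it for rays and arcs. *)
Definition holomorphic_off_0 (G dG : C -> C) : Prop :=
  (forall z, z <> RtoC 0 -> continuous G z) /\ (forall z, z <> RtoC 0 -> continuous dG z) /\
  forall (p : R -> C) (t : R) (l : C), p t <> RtoC 0 -> derC p t l ->
    derC (fun s => G (p s)) t (dG (p t) * l)%C.

(** Let [J T] be the integral over the arc of radius [T]. In polar coordinates
    the radial derivative of [i z G(z)] is the angular derivative of
    [e^{i th} G(z)], so that [J' T] is the difference of the integrands on the
    two rays. Hence the rays contribute [J rho - lim J], which the arc of
    radius [rho] cancels since [J T] tends to zero. *)
Lemma cauchy_sector (G dG : C -> C) (rho a b K : R) : 0 < rho -> a < b ->
  holomorphic_off_0 G dG ->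
  (forall r th, rho <= r -> a <= th <= b -> Cmod (G (polar r th)) <= K / r ^ 2) ->
  path_int (sector_path rho a b) G (RtoC 0).
Proof.
intros Hrho Hab (CG & CdG & DG) Bd.
set (H := fun T th => (G (polar T th) * (Ci * polar T th))%C).
set (H1 := fun T th => (dG (polar T th) * polar 1 th * (Ci * polar T th) + G (polar T th) * (Ci * polar 1 th))%C).
set (J := (fun T => RIntC (H T) a b) : R -> C).
set (ray := fun th r => (G (polar r th) * polar 1 th)%C).
assert (Dang : forall T th, derC (fun th => polar T th) th (Ci * polar T th)%C).
{ intros T th; evar_last; [apply (derC_polar (fun _ => T) (fun th => th) th 0 1); auto_derive; easy | cring]. }
assert (Drad : forall T th, derC (fun T => polar T th) T (polar 1 th)).
{ intros T th; evar_last; [apply (derC_polar (fun T => T) (fun _ => th) T 1 0); auto_derive; easy | cring]. }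
assert (DH : forall u th, 0 < u -> derC (fun s => H s th) u (H1 u th)).
{ intros u th Hu; unfold H, H1; evar_last.
  { apply derC_mult.
    - apply (DG (fun s => polar s th)); [apply polar_neq_0, Hu | apply Drad].
    - apply derC_scal, Drad. }
  cring. }
assert (Cpol : forall p : R * R, continuous (fun p : R * R => polar (fst p) (snd p)) p).
{ intros p; apply cont_polar; [apply continuous_fst | apply continuous_snd]. }
assert (Cang : forall T th, continuous (fun th => polar T th) th).
{ intros; eapply derC_cont, Dang. }
assert (CH : forall u th, 0 < u -> continuous (H u) th).
{ intros u th Hu; unfold H.
  apply (cont_Cmult (fun th => G (polar u th)) (fun th => Ci * polar u th)%C).
  - apply (continuous_comp (fun th => polar u th) G); [apply Cang | apply CG, polar_neq_0, Hu].
  - apply (cont_Cmult (fun _ => Ci)); [apply continuous_const | apply Cang]. }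
assert (CH1 : forall u th, 0 < u -> continuous (fun p : R * R => H1 (fst p) (snd p)) (u, th)).
{ intros u th Hu; unfold H1.
  assert (C1 : continuous (fun p : R * R => polar 1 (snd p)) (u, th)).
  { apply cont_polar; [apply continuous_const | apply continuous_snd]. }
  assert (Ccomp : forall K : C -> C, (forall z, z <> RtoC 0 -> continuous K z) ->
    continuous (fun p : R * R => K (polar (fst p) (snd p))) (u, th)).
  { intros k Ck; apply (continuous_comp (fun p : R * R => polar (fst p) (snd p)) k); [apply Cpol |].
    apply Ck, polar_neq_0, Hu. }
  apply cont_Cplus; apply cont_Cmult.
  - apply cont_Cmult; [apply Ccomp, CdG | exact C1].
  - apply (cont_Cmult (fun _ => Ci)); [apply continuous_const | apply Cpol].
  - apply Ccomp, CG.
  - apply (cont_Cmult (fun _ => Ci)); [apply continuous_const | exact C1]. }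
assert (Val : forall T, 0 < T -> RIntC (H1 T) a b = (ray b T - ray a T)%C).
{ intros T HT; apply intC_unique.
  apply (intC_derive (fun th => ray th T) (H1 T) a b); [lra | |].
  - intros th _; unfold ray, H1; evar_last.
    { apply derC_mult; [apply (DG (fun th => polar T th)); [apply polar_neq_0, HT | apply Dang] | apply Dang]. }
    cring.
  - intros th _.
    apply (continuous_comp (fun th => (T, th)) (fun p : R * R => H1 (fst p) (snd p))).
    + apply cont_pair_const.
    + apply CH1, HT. }
assert (DJ : forall T, 0 < T -> derC J T (ray b T - ray a T)%C).
{ intros T HT; rewrite <- Val by exact HT; apply RInt_param_C; try assumption; lra. }
assert (Cray : forall th r, 0 < r -> continuous (ray th) r).
{ intros th r Hr; apply (cont_Cmult (fun r => G (polar r th)) (fun _ => polar 1 th)); [| apply continuous_const].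
  apply (continuous_comp (fun r => polar r th) G); [eapply derC_cont, Drad | apply CG, polar_neq_0, Hr]. }
destruct (ray_ex rho Hrho G a K) as [Ia HIa].
{ intros r Hr; apply CG, polar_neq_0; lra. }
{ intros r Hr; apply Bd; lra. }
destruct (ray_ex rho Hrho G b K) as [Ib HIb].
{ intros r Hr; apply CG, polar_neq_0; lra. }
{ intros r Hr; apply Bd; lra. }
assert (HJ : intC (H rho) a b (J rho)).
{ apply intC_ex; intros; apply CH, Hrho. }
assert (Jbound : forall T, rho < T -> Cmod (J T) <= (b - a) * K / T).
{ intros T HT.
  apply (intC_bound (H T) (fun _ => K / T) a b); [lra | | apply intC_ex; intros; apply CH; lra |].
  - intros th Hth; unfold H; rewrite !Cmod_mult, Cmod_Ci, Cmod_polar by lra.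
    assert (B := Bd T th ltac:(lra) Hth).
    replace (K / T) with (K / T ^ 2 * (1 * T)) by (field; lra).
    apply Rmult_le_compat_r; lra.
  - evar_last; [apply (is_RInt_const (V := R_NormedModule)) |].
    unfold scal; simpl; unfold mult; simpl; field; lra. }
assert (HD : genC (fun r => ray b r - ray a r)%C (at_point rho) (Rbar_locally p_infty) (RtoC 0 - J rho)%C).
{ apply (gen_antiderivative (V := C_R_NormedModule) (int_range_ray rho) _ (fun T => J T - J rho)%C).
  - intros T HT; apply intC_derive; [exact HT | intros r Hr; apply DJ; lra |].
    intros r Hr; apply cont_Cminus; apply Cray; lra.
  - apply filterlim_Cmod; [apply Rbar_locally_filter |]; intros e He.
    exists (Rmax rho ((Rabs ((b - a) * K) + 1) / e)); intros T HT.
    assert (M1 := Rmax_l rho ((Rabs ((b - a) * K) + 1) / e)); assert (M2 := Rmax_r rho ((Rabs ((b - a) * K) + 1) / e)).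
    replace (J T - J rho - (0 - J rho))%C with (J T) by ring.
    eapply Rle_lt_trans; [apply Jbound; lra |].
    assert (HT' : (Rabs ((b - a) * K) + 1) / e < T) by lra.
    apply Rlt_div_l in HT'; [| exact He].
    assert (Q := Rle_abs ((b - a) * K)).
    apply Rlt_div_l; [lra | nra]. }
assert (HD2 := range_minus (int_range_ray rho) HIb HIa).
assert (E := genC_unique _ _ _ HD HD2).
assert (P := path_int_sector rho a b Hrho G Ia Ib (J rho) HIa HIb HJ).
replace (RtoC 0) with (Ia - J rho - Ib)%C; [exact P |].
replace (J rho) with (- (0 - J rho))%C by ring; rewrite E; ring.
Qed.

(** The remainder functionals are integrated against such functions. The
    condition on [y] bounds the exponential by one on the closed sector, which
    leaves a quadratic decay. *)
Lemma path_int_exp_0 (rho a b y : R) (A B : C) : 0 < rho -> a < b ->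
  (forall th, a <= th <= b -> 0 <= y * sin th) ->
  path_int (sector_path rho a b)
    (fun z => Cexp (Ci * z * RtoC y) / z ^ 3 * (A + B * z))%C (RtoC 0).
Proof.
intros Hrho Hab Hy.
set (G := fun z => (Cexp (Ci * z * RtoC y) / z ^ 3 * (A + B * z))%C).
set (dG := fun z => (Ci * RtoC y * Cexp (Ci * z * RtoC y) * / z * / z * / z * (A + B * z)
  + Cexp (Ci * z * RtoC y) * (- RtoC 3 * / z * / z * / z * / z * (A + B * z) + / z * / z * / z * B))%C).
apply (cauchy_sector G dG rho a b (Cmod A / rho + Cmod B)); try assumption.
- split; [| split].
  + intros z Hz; unfold G; ccont; apply Cpow_nz, Hz.
  + intros z Hz; unfold dG; ccont; exact Hz.
  + intros p t l Hp Dp.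
    apply (derC_ext
      (fun s => Cexp (Ci * p s * RtoC y) * ((/ p s * (/ p s * / p s)) * (A + B * p s)))%C).
    { intros s; unfold G.
      destruct (Ceq_dec (p s) (RtoC 0)) as [E | E].
      - rewrite E; unfold Cdiv.
        replace (RtoC 0 ^ 3)%C with (RtoC 0) by (simpl; ring).
        assert (I0 : (/ RtoC 0 = RtoC 0)%C).
        { unfold Cinv, RtoC; simpl; f_equal; unfold Rdiv; ring. }
        rewrite I0; cring.
      - as_eq_C; field; exact E. }
    assert (Di := derC_Cinv p t l Hp Dp).
    evar_last.
    { apply derC_mult.
      - apply (derC_Cexp (fun s => Ci * p s * RtoC y)%C).
        apply (derC_ext (fun s => (Ci * RtoC y) * p s)%C); [intros; cring |].
        apply derC_scal, Dp.
      - apply derC_mult; [apply derC_mult; [exact Di | apply derC_mult; exact Di] |].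
        apply derC_plus; [apply derC_const | apply derC_scal, Dp]. }
    unfold dG; cring.
- intros r th Hr Hth; unfold G.
  assert (Hr0 : 0 < r) by lra.
  assert (Hn := polar_neq_0 r th Hr0).
  unfold Cdiv; rewrite !Cmod_mult, Cmod_inv, Cmod_pow, Cmod_Cexp, Cmod_polar by (try apply Cpow_nz, Hn; lra).
  assert (E1 : exp (Re (Ci * polar r th * RtoC y)) <= 1).
  { rewrite <- exp_0; apply exp_le_mono; simpl.
    assert (Q := Hy th Hth); nra. }
  assert (E2 : Cmod (A + B * polar r th) <= Cmod A + Cmod B * r).
  { eapply Rle_trans; [apply Cmod_triangle |]; rewrite Cmod_mult, Cmod_polar; lra. }
  assert (P3 : 0 < / r ^ 3) by (apply Rinv_0_lt_compat, pow_lt, Hr0).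
  assert (E0 := exp_pos (Re (Ci * polar r th * RtoC y))).
  apply Rle_trans with (1 * / r ^ 3 * (Cmod A + Cmod B * r)).
  + apply Rmult_le_compat; [nra | apply Cmod_ge_0 | nra | exact E2].
  + assert (A0 := Cmod_ge_0 A).
    replace (1 * / r ^ 3 * (Cmod A + Cmod B * r)) with ((Cmod A / r + Cmod B) / r ^ 2) by (field; lra).
    apply Rmult_le_compat_r; [left; apply Rinv_0_lt_compat, pow_lt, Hr0 |].
    apply Rplus_le_compat_r, Rmult_le_compat_l; [exact A0 |].
    apply Rinv_le_contravar; lra.
Qed.

(** * Smooth functions on an interval *)

(** Derivatives relative to such a [J] are unique. *)
Definition perfect (J : R -> Prop) : Prop :=
  forall x e, J x -> 0 < e -> exists y, J y /\ y <> x /\ Rabs (y - x) < e.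

(** A function on [J] with all its derivatives, continued outside [J] in such a
    way that the derivatives at its endpoints are two-sided. *)
Definition tower (J : R -> Prop) (u : nat -> R -> C) : Prop :=
  forall k x, J x -> derC (u k) x (u (S k) x).

Lemma perfect_unit : perfect unit_interval.
Proof.
intros x e [H0 H1] He; unfold unit_interval.
destruct (Rle_dec x (1 / 2)).
- assert (M1 := Rmin_l (e / 2) (1 / 2)); assert (M2 := Rmin_r (e / 2) (1 / 2)).
  assert (M0 : 0 < Rmin (e / 2) (1 / 2)) by (apply Rmin_glb_lt; lra).
  exists (x + Rmin (e / 2) (1 / 2)); repeat split; try lra.
  rewrite Rabs_pos_eq; lra.
- assert (M1 := Rmin_l (e / 2) (1 / 2)); assert (M2 := Rmin_r (e / 2) (1 / 2)).
  assert (M0 : 0 < Rmin (e / 2) (1 / 2)) by (apply Rmin_glb_lt; lra).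
  exists (x - Rmin (e / 2) (1 / 2)); repeat split; try lra.
  rewrite Rabs_left; lra.
Qed.

Lemma perfect_half : perfect half_line.
Proof.
intros x e H0 He; unfold half_line in *; exists (x + e / 2); repeat split; try lra.
rewrite Rabs_pos_eq; lra.
Qed.

Lemma perfect_R : perfect (fun _ => True).
Proof.
intros x e _ He; exists (x + e / 2); repeat split; try lra.
rewrite Rabs_pos_eq; lra.
Qed.

Lemma is_derive_on_unique J f x (l m : C) : perfect J -> J x ->
  is_derive_on J f x l -> is_derive_on J f x m -> l = m.
Proof.
intros HP Jx H1 H2.
assert (PF : ProperFilter (within (fun y => J y /\ y <> x) (locally x))).
{ constructor; [| apply within_filter, locally_filter].
  intros P [e He]; destruct (HP x e Jx (cond_pos e)) as (y & Jy & Ny & Hy).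
  exists y; apply He; [exact Hy | auto]. }
apply (filterlim_locally_unique (K := C_AbsRing) (V := C_NormedModule)
  (F := within (fun y => J y /\ y <> x) (locally x)) (fun y => (f y - f x) / RtoC (y - x))%C);
  assumption.
Qed.

Lemma is_derive_on_eps J f x (l : C) : is_derive_on J f x l <->
  forall e, 0 < e -> exists d, 0 < d /\ forall y, J y -> Rabs (y - x) < d ->
    Cmod (f y - f x - RtoC (y - x) * l) <= e * Rabs (y - x).
Proof.
assert (Q : forall y, y <> x -> Cmod (f y - f x - RtoC (y - x) * l) =
   Cmod ((f y - f x) / RtoC (y - x) - l) * Rabs (y - x)).
{ intros y Hy; rewrite <- Cmod_R, <- Cmod_mult; f_equal; field.
  intros E; apply RtoC_inj in E; lra. }
split.
- intros H e He.
  destruct (filterlim_Cmod_inv _ _ _ e H He) as [d Hd].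
  exists d; split; [apply cond_pos |]; intros y Jy Hy.
  destruct (Req_dec y x) as [-> | N].
  + replace (f x - f x - RtoC (x - x) * l)%C with (RtoC 0).
    * rewrite Cmod_0, Rminus_diag, Rabs_R0; lra.
    * rewrite Rminus_diag; ring.
  + rewrite (Q y N); apply Rmult_le_compat_r; [apply Rabs_pos |].
    apply Rlt_le, (Hd y Hy); auto.
- intros H; apply filterlim_Cmod; [apply within_filter, locally_filter |].
  intros e He; destruct (H (e / 2)) as (d & Hd & K); [lra |].
  exists (mkposreal d Hd); intros y Hy [Jy N].
  assert (P : 0 < Rabs (y - x)) by (apply Rabs_pos_lt; lra).
  specialize (K y Jy Hy); rewrite (Q y N) in K.
  apply Rmult_le_reg_r in K; [lra | exact P].
Qed.

Lemma derC_eps f (x : R) (l : C) : derC f x l <->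
  forall e, 0 < e -> exists d, 0 < d /\ forall y, Rabs (y - x) < d ->
    Cmod (f y - f x - RtoC (y - x) * l) <= e * Rabs (y - x).
Proof.
assert (Q : forall y, @norm R_AbsRing C_R_NormedModule
   (minus (minus (f y) (f x)) (scal (minus y x) l)) = Cmod (f y - f x - RtoC (y - x) * l)).
{ intros y; rewrite scal_C, norm_C; reflexivity. }
split.
- intros [_ H] e He.
  destruct (H x (fun P HP => HP) (mkposreal e He)) as [d Hd].
  exists d; split; [apply cond_pos |]; intros y Hy.
  rewrite <- Q; apply (Hd y Hy).
- intros H; split; [apply is_linear_scal_l |].
  intros z Hz; assert (Ez := is_filter_lim_locally_unique x z Hz); subst z.
  intros e; destruct (H e (cond_pos e)) as (d & Hd & K).
  exists (mkposreal d Hd); intros y Hy; rewrite Q; apply K, Hy.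
Qed.

Lemma derC_derive_on J f (x : R) (l : C) : derC f x l -> is_derive_on J f x l.
Proof.
intros H; apply is_derive_on_eps; intros e He.
destruct (proj1 (derC_eps f x l) H e He) as (d & Hd & K); exists d; auto.
Qed.

Lemma is_derive_on_ext J f g x (l : C) : (forall y, J y -> f y = g y) -> J x ->
  is_derive_on J f x l -> is_derive_on J g x l.
Proof.
intros E Jx; rewrite !is_derive_on_eps; intros H e He.
destruct (H e He) as (d & Hd & K); exists d; split; [exact Hd |].
intros y Jy Hy; rewrite <- !E by assumption; auto.
Qed.

Lemma Derive_on_val J f x (l : C) : perfect J -> J x -> is_derive_on J f x l -> Derive_on J f x = l.
Proof.
intros HP Jx H; apply (is_derive_on_unique J f x); try assumption.
apply (epsilon_spec (inhabits (RtoC 0)) (is_derive_on J f x)); exists l; exact H.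
Qed.

Lemma Derive_on_n_tower J u f : perfect J -> tower J u -> (forall x, J x -> f x = u 0%nat x) ->
  forall n x, J x -> Derive_on_n J n f x = u n x.
Proof.
intros HP Hu E; induction n as [| n IH]; intros x Jx; [apply E, Jx |].
apply Derive_on_val; [exact HP | exact Jx |].
apply is_derive_on_ext with (u n); [intros; symmetry; auto | exact Jx |].
apply derC_derive_on, Hu, Jx.
Qed.

Lemma smooth_on_tower J u f : perfect J -> tower J u -> (forall x, J x -> f x = u 0%nat x) ->
  smooth_on J f.
Proof.
intros HP Hu E n x Jx; exists (u (S n) x).
apply is_derive_on_ext with (u n); [| exact Jx | apply derC_derive_on, Hu, Jx].
intros y Jy; symmetry; apply (Derive_on_n_tower J u f); assumption.
Qed.

Lemma smooth_on_derive J f n x : smooth_on J f -> J x ->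
  is_derive_on J (Derive_on_n J n f) x (Derive_on_n J (S n) f x).
Proof.
intros H Jx; apply (epsilon_spec (inhabits (RtoC 0)) (is_derive_on J (Derive_on_n J n f) x)), H, Jx.
Qed.

Lemma is_derive_on_cont J f x (l : C) : is_derive_on J f x l ->
  forall e, 0 < e -> exists d, 0 < d /\ forall y, J y -> Rabs (y - x) < d -> Cmod (f y - f x) <= e.
Proof.
rewrite is_derive_on_eps; intros H e He.
destruct (H 1 Rlt_0_1) as (d & Hd & K).
assert (P : 0 < 1 + Cmod l) by (generalize (Cmod_ge_0 l); lra).
exists (Rmin d (e / (1 + Cmod l))); split.
{ apply Rmin_glb_lt; [exact Hd | apply Rdiv_lt_0_compat; assumption]. }
intros y Jy Hy.
assert (M1 := Rmin_l d (e / (1 + Cmod l))); assert (M2 := Rmin_r d (e / (1 + Cmod l))).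
specialize (K y Jy ltac:(lra)).
assert (L : Rabs (y - x) < e / (1 + Cmod l)) by lra.
apply Rlt_div_r in L; [| exact P].
replace (f y - f x)%C with ((f y - f x - RtoC (y - x) * l) + RtoC (y - x) * l)%C by ring.
eapply Rle_trans; [apply Cmod_triangle |]; rewrite (Cmod_mult _ l), Cmod_R; nra.
Qed.

Definition clamp01 (x : R) : R := Rmax 0 (Rmin 1 x).

Lemma clamp01_in x : unit_interval (clamp01 x).
Proof.
unfold clamp01, unit_interval, Rmax, Rmin.
destruct (Rle_dec 1 x); destruct (Rle_dec 0 _); lra.
Qed.

Lemma clamp01_id x : unit_interval x -> clamp01 x = x.
Proof.
unfold clamp01, unit_interval, Rmax, Rmin; intros H.
destruct (Rle_dec 1 x); destruct (Rle_dec 0 _); lra.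
Qed.

Lemma clamp01_between x y : unit_interval x ->
  Rabs (y - clamp01 y) + Rabs (clamp01 y - x) = Rabs (y - x).
Proof.
unfold clamp01, unit_interval, Rmax, Rmin; intros H.
destruct (Rle_dec 1 y); destruct (Rle_dec 0 _); unfold Rabs; repeat destruct Rcase_abs; lra.
Qed.

(** One-sided derivatives at the endpoints become two-sided ones when every
    derivative is continued by its tangents there. *)
Lemma smooth_unit_tower f : smooth_on unit_interval f ->
  exists u, tower unit_interval u /\
    forall k x, unit_interval x -> Derive_on_n unit_interval k f x = u k x.
Proof.
intros Hf.
set (D := fun k => Derive_on_n unit_interval k f).
set (u := fun k x => (D k (clamp01 x) + RtoC (x - clamp01 x) * D (S k) (clamp01 x))%C).
assert (E : forall k x, unit_interval x -> u k x = D k x).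
{ intros k x Hx; unfold u; rewrite clamp01_id, Rminus_diag by exact Hx; ring. }
exists u; split; [| intros k x Hx; symmetry; apply E, Hx].
intros k x Hx; rewrite (E (S k) x Hx); apply derC_eps; intros e He.
destruct (proj1 (is_derive_on_eps _ _ _ _) (smooth_on_derive _ f k x Hf Hx) (e / 2)) as (d1 & P1 & K1); [lra |].
destruct (is_derive_on_cont _ _ _ _ (smooth_on_derive _ f (S k) x Hf Hx) (e / 2)) as (d2 & P2 & K2); [lra |].
fold (D k) in K1; fold (D (S k)) in K1, K2.
exists (Rmin d1 d2); split; [apply Rmin_glb_lt; assumption |]; intros y Hy.
assert (M1 := Rmin_l d1 d2); assert (M2 := Rmin_r d1 d2).
assert (B := clamp01_between x y Hx); assert (Iz := clamp01_in y).
assert (A1 := Rabs_pos (y - clamp01 y)); assert (A2 := Rabs_pos (clamp01 y - x)).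
specialize (K1 (clamp01 y) Iz ltac:(lra)); specialize (K2 (clamp01 y) Iz ltac:(lra)).
rewrite (E k x Hx); unfold u.
replace (D k (clamp01 y) + RtoC (y - clamp01 y) * D (S k) (clamp01 y) - D k x - RtoC (y - x) * D (S k) x)%C
  with ((D k (clamp01 y) - D k x - RtoC (clamp01 y - x) * D (S k) x)
    + RtoC (y - clamp01 y) * (D (S k) (clamp01 y) - D (S k) x))%C
  by (rewrite !RtoC_minus; ring).
eapply Rle_trans; [apply Cmod_triangle |]; rewrite (Cmod_mult (RtoC _)), Cmod_R; nra.
Qed.

Lemma tower_cont J u k x : tower J u -> J x -> continuous (u k) x.
Proof. intros H Jx; eapply derC_cont, H, Jx. Qed.

Lemma tower_linear J u v a b : tower J u -> tower J v ->
  tower J (fun k x => a * u k x + b * v k x)%C.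
Proof. intros Hu Hv k x Jx; apply derC_plus; apply derC_scal; auto. Qed.

Lemma tower_shift J u n : tower J u -> tower J (fun k x => Ci * u (n + k)%nat x)%C.
Proof. intros Hu k x Jx; apply derC_scal; rewrite Nat.add_succ_r; apply Hu, Jx. Qed.

(** * Rapidly decreasing functions on the half-line *)

Definition schwartz_tower (u : nat -> R -> C) : Prop :=
  tower (fun _ => True) u /\
  forall j k : nat, exists M, forall x, Rabs x ^ j * Cmod (u k x) <= M.

Lemma schwartz_half_tower f :
  schwartz_half f <-> exists u, schwartz_tower u /\ forall x, half_line x -> f x = u 0%nat x.
Proof.
split.
- intros (g & [Sg Bg] & E); exists (fun k => Derive_on_n (fun _ => True) k g); split; [split |].
  + intros k x _; apply derC_eps; intros e He.
    destruct (proj1 (is_derive_on_eps _ _ _ _) (smooth_on_derive _ g k x Sg I) e He) as (d & Hd & K).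
    exists d; auto.
  + intros j k; destruct (Bg j k) as [M HM]; exists M; auto.
  + exact E.
- intros (u & [Hu Bu] & E); exists (u 0%nat); split; [| exact E].
  split; [apply (smooth_on_tower _ u); auto; apply perfect_R |].
  intros j k; destruct (Bu j k) as [M HM]; exists M; intros x _.
  rewrite (Derive_on_n_tower (fun _ => True) u); auto; apply perfect_R.
Qed.

Lemma tower_R_half u : tower (fun _ => True) u -> tower half_line u.
Proof. intros H k x _; apply H; exact I. Qed.

Lemma schwartz_tower_linear u v a b : schwartz_tower u -> schwartz_tower v ->
  schwartz_tower (fun k x => a * u k x + b * v k x)%C.
Proof.
intros [Hu Bu] [Hv Bv]; split; [apply tower_linear; assumption |].
intros j k; destruct (Bu j k) as [M HM]; destruct (Bv j k) as [N HN].
exists (Cmod a * M + Cmod b * N); intros x.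
assert (P : 0 <= Rabs x ^ j) by (apply pow_le, Rabs_pos).
eapply Rle_trans; [apply Rmult_le_compat_l; [exact P | apply Cmod_triangle] |].
rewrite !Cmod_mult; assert (A := Cmod_ge_0 a); assert (B := Cmod_ge_0 b).
specialize (HM x); specialize (HN x); nra.
Qed.

Lemma schwartz_tower_shift u n : schwartz_tower u -> schwartz_tower (fun k x => Ci * u (n + k)%nat x)%C.
Proof.
intros [Hu Bu]; split; [apply tower_shift, Hu |].
intros j k; destruct (Bu j (n + k)%nat) as [M HM]; exists M; intros x.
rewrite Cmod_mult, Cmod_Ci, Rmult_1_l; apply HM.
Qed.

Definition weighted_bounds (sigma : R) (u : nat -> R -> C) : Prop :=
  forall j k : nat, exists M, forall x, 0 <= x -> x ^ j * (exp (sigma * x) * Cmod (u k x)) <= M.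

(** The derivatives of [(sigma + d/dx)^k u]. *)
Fixpoint weight_iter (sigma : R) (u : nat -> R -> C) (k : nat) : nat -> R -> C :=
  match k with
  | O => u
  | S m => fun j x => (RtoC sigma * weight_iter sigma u m j x + weight_iter sigma u m (S j) x)%C
  end.

(** The [k]-th derivative of [e^{sigma x} u] is [e^{sigma x}] times
    [(sigma + d/dx)^k u]. On the negative axis the weight is at most one, so
    that an extension of [f] to the real line serves for the product too. *)
Lemma schwartz_half_weight sigma u f : 0 <= sigma -> schwartz_tower u -> weighted_bounds sigma u ->
  (forall x, half_line x -> f x = u 0%nat x) -> schwartz_half (exp_weight sigma f).
Proof.
intros Hs [Hu Bu] Wu E.
assert (DW : forall k, tower (fun _ => True) (weight_iter sigma u k)).
{ induction k as [| k IH]; [exact Hu |].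
  intros j x Hx; apply derC_plus; [apply derC_scal |]; apply IH, Hx. }
assert (BW : forall k p j, exists M, forall x,
  Rabs x ^ p * (exp (sigma * x) * Cmod (weight_iter sigma u k j x)) <= M).
{ induction k as [| k IH]; intros p j.
  - destruct (Bu p j) as [M1 HM1]; destruct (Wu p j) as [M2 HM2]; exists (Rmax M1 M2); intros x.
    destruct (Rle_dec 0 x) as [H | H].
    + eapply Rle_trans; [| apply Rmax_r]; rewrite Rabs_pos_eq by exact H; apply HM2, H.
    + eapply Rle_trans; [| apply Rmax_l]; eapply Rle_trans; [| apply (HM1 x)].
      assert (P : 0 <= Rabs x ^ p) by (apply pow_le, Rabs_pos).
      apply Rmult_le_compat_l; [exact P |].
      assert (X1 : exp (sigma * x) <= 1) by (rewrite <- exp_0; apply exp_le_mono; nra).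
      assert (C0 := Cmod_ge_0 (u j x)); simpl; nra.
  - destruct (IH p j) as [M1 HM1]; destruct (IH p (S j)) as [M2 HM2].
    exists (sigma * M1 + M2); intros x; simpl.
    specialize (HM1 x); specialize (HM2 x).
    assert (P : 0 <= Rabs x ^ p) by (apply pow_le, Rabs_pos).
    assert (Q := exp_pos (sigma * x)).
    assert (T : Cmod (RtoC sigma * weight_iter sigma u k j x + weight_iter sigma u k (S j) x)
      <= sigma * Cmod (weight_iter sigma u k j x) + Cmod (weight_iter sigma u k (S j) x)).
    { eapply Rle_trans; [apply Cmod_triangle |]; rewrite Cmod_mult, Cmod_R, Rabs_pos_eq by exact Hs; lra. }
    eapply Rle_trans; [apply Rmult_le_compat_l; [exact P | apply Rmult_le_compat_l; [lra | exact T]] |].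
    nra. }
apply schwartz_half_tower.
exists (fun k x => RtoC (exp (sigma * x)) * weight_iter sigma u k 0%nat x)%C; split; [split |].
- intros k x _; evar_last.
  { apply derC_mult; [| apply DW; exact I].
    apply derC_RtoC with (l := sigma * exp (sigma * x)); auto_derive; [easy | ring]. }
  simpl; rewrite RtoC_mult; cring.
- intros j k; destruct (BW k j 0%nat) as [M HM]; exists M; intros x.
  rewrite Cmod_mult, Cmod_R, (Rabs_pos_eq (exp _)) by (left; apply exp_pos); apply HM.
- intros x Hx; unfold exp_weight; rewrite E by exact Hx; reflexivity.
Qed.

(** * Decay of the derivatives *)

Definition rate (f : R -> C) (a : R) : Prop :=
  exists K, 0 <= K /\ forall x, 0 <= x -> Cmod (f x) <= K * exp (- a * x).

Lemma rate_le f a c : c <= a -> rate f a -> rate f c.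
Proof.
intros Hca (K & HK & H); exists K; split; [exact HK |]; intros x Hx.
eapply Rle_trans; [apply H, Hx |]; apply Rmult_le_compat_l; [exact HK |].
apply exp_le_mono; nra.
Qed.

Lemma derC_lipschitz (f df : R -> C) a b M : a <= b ->
  (forall x, a <= x <= b -> derC f x (df x)) -> (forall x, a <= x <= b -> continuous df x) ->
  (forall x, a <= x <= b -> Cmod (df x) <= M) -> Cmod (f b - f a) <= M * (b - a).
Proof.
intros Hab D Cd B.
replace (M * (b - a)) with (M * b - M * a) by ring.
apply (derC_growth f df (fun x => M * x) (fun _ => M) a b); auto.
- intros x _; auto_derive; [easy | ring].
- intros; apply continuous_const.
Qed.

(** A quantitative form of Landau's inequality [|f'|^2 <= C |f| |f''|]. *)
Lemma rate_interpolate (f f1 f2 : R -> C) a c :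
  (forall x, 0 <= x -> derC f x (f1 x)) -> (forall x, 0 <= x -> derC f1 x (f2 x)) ->
  (forall x, 0 <= x -> continuous f2 x) -> 0 <= c <= a ->
  rate f a -> rate f2 c -> rate f1 ((a + c) / 2).
Proof.
intros D1 D2 C2 Hca (A & HA & Ba) (B & HB & Bb).
exists (2 * A + B); split; [lra |]; intros x Hx.
(* the step that balances [|f| / h] against [h |f''|] *)
set (h := exp (- ((a - c) / 2) * x)).
assert (h0 : 0 < h) by apply exp_pos.
assert (L : forall s, 0 <= s <= h -> Cmod (f1 (x + s) - f1 x) <= B * exp (- c * x) * h).
{ intros s Hs.
  assert (P := exp_pos (- c * x)).
  apply Rle_trans with (B * exp (- c * x) * (x + s - x)).
  - apply (derC_lipschitz f1 f2 x (x + s)); [lra | | |].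
    + intros y Hy; apply D2; lra.
    + intros y Hy; apply C2; lra.
    + intros y Hy; eapply Rle_trans; [apply Bb; lra |]; apply Rmult_le_compat_l; [exact HB |].
      apply exp_le_mono; nra.
  - apply Rmult_le_compat_l; [nra | lra]. }
assert (M : Cmod (f (x + h) - RtoC (x + h) * f1 x - (f x - RtoC x * f1 x)) <= B * exp (- c * x) * h * (x + h - x)).
{ apply (derC_lipschitz (fun y => f y - RtoC y * f1 x)%C (fun y => f1 y - f1 x)%C x (x + h)); [lra | | |].
  - intros y Hy; apply derC_minus; [apply D1; lra |].
    apply (derC_ext (fun y => f1 x * RtoC y)%C); [intros; cring |].
    evar_last; [apply derC_scal, derC_id | cring].
  - intros y Hy; apply (cont_Cminus f1 (fun _ => f1 x)); [| apply continuous_const].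
    eapply derC_cont, D2; lra.
  - intros y Hy; assert (K := L (y - x) ltac:(lra)).
    replace (x + (y - x)) with y in K by ring; exact K. }
assert (F0 := Ba x Hx); assert (F1 := Ba (x + h) ltac:(lra)).
assert (Emono : exp (- a * (x + h)) <= exp (- a * x)) by (apply exp_le_mono; nra).
assert (T : h * Cmod (f1 x) <= 2 * A * exp (- a * x) + B * exp (- c * x) * h * h).
{ replace (h * Cmod (f1 x)) with (Cmod (RtoC h * f1 x)) by (rewrite Cmod_mult, Cmod_R, Rabs_pos_eq; lra).
  replace (RtoC h * f1 x)%C with (f (x + h)%R + (- f x
    + - (f (x + h)%R - RtoC (x + h) * f1 x - (f x - RtoC x * f1 x))))%C by (rewrite RtoC_plus; ring).
  eapply Rle_trans; [apply Cmod_triangle |].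
  eapply Rle_trans; [apply Rplus_le_compat_l, Cmod_triangle |].
  rewrite !Cmod_opp; nra. }
apply Rmult_le_reg_l with h; [exact h0 |].
eapply Rle_trans; [exact T |]; right.
assert (E1 : exp (- a * x) = h * exp (- ((a + c) / 2) * x)).
{ unfold h; rewrite <- exp_plus; f_equal; field. }
assert (E2 : exp (- c * x) * h = exp (- ((a + c) / 2) * x)).
{ unfold h; rewrite <- exp_plus; f_equal; field. }
rewrite E1; transitivity (2 * A * (h * exp (- ((a + c) / 2) * x)) + B * (exp (- c * x) * h) * h); [ring |].
rewrite E2; ring.
Qed.

(** If decay at the rate [a] implies decay of the derivative at the rate
    [r a], then it implies [r^2 a] for the second derivative, and so, by
    interpolation, [(a + r^2 a) / 2] for the first. The iteration of
    [r |-> (1 + r^2) / 2] from zero converges to one. *)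
Fixpoint rate_fraction (m : nat) : R :=
  match m with O => 0 | S m => (1 + rate_fraction m ^ 2) / 2 end.

Lemma rate_fraction_bounds m : 1 - 2 / (INR m + 2) <= rate_fraction m <= 1 /\ 0 <= rate_fraction m.
Proof.
induction m as [| m IH]; [simpl; lra |].
rewrite S_INR; simpl rate_fraction; set (r := rate_fraction m) in *.
assert (P := pos_INR m).
assert (I : INR m + 2 <> 0) by lra.
set (t := 2 / (INR m + 2)) in *.
assert (Ht : t * (INR m + 2) = 2) by (unfold t; field; lra).
assert (T0 : 0 < t) by (apply Rdiv_lt_0_compat; lra).
assert (T1 : t <= 1) by nra.
split; [split |]; try nra.
apply Rle_trans with ((1 + (1 - t) ^ 2) / 2); [| nra].
assert (S0 : 2 / (INR m + 1 + 2) * (INR m + 3) = 2) by (field; lra).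
set (s := 2 / (INR m + 1 + 2)) in *.
assert (s > 0) by nra.
assert (t - t ^ 2 / 2 <= s); [| lra].
apply Rmult_le_reg_r with (INR m + 3); [lra |]; rewrite S0.
apply Rmult_le_reg_r with ((INR m + 2) ^ 2); [nra |].
replace ((t - t ^ 2 / 2) * (INR m + 3) * (INR m + 2) ^ 2)
  with ((t * (INR m + 2) * (INR m + 2) - (t * (INR m + 2)) ^ 2 / 2) * (INR m + 3)) by (clearbody t; field).
rewrite Ht; nra.
Qed.

Lemma rate_derive (u : nat -> R -> C) : tower half_line u -> (forall k, rate (u k) 0) ->
  forall m k a, 0 <= a -> rate (u k) a -> rate (u (S k)) (a * rate_fraction m).
Proof.
intros Hu Hb; induction m as [| m IH]; intros k a Ha H.
- simpl; rewrite Rmult_0_r; apply Hb.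
- assert (B := rate_fraction_bounds m).
  assert (H1 := IH k a Ha H).
  assert (H2 := IH (S k) (a * rate_fraction m) ltac:(nra) H1).
  replace (a * rate_fraction (S m)) with ((a + a * rate_fraction m * rate_fraction m) / 2) by (simpl; field).
  apply (rate_interpolate (u k) (u (S k)) (u (S (S k)))); try assumption.
  + intros x Hx; apply Hu, Hx.
  + intros x Hx; apply Hu, Hx.
  + intros x Hx; apply (tower_cont half_line); assumption.
  + assert (0 <= a * rate_fraction m <= a) by (split; nra).
    split; nra.
Qed.

Lemma rate_tower (u : nat -> R -> C) eps : 0 < eps -> tower half_line u -> (forall k, rate (u k) 0) ->
  rate (u 0%nat) eps -> forall k eta, eta < eps -> rate (u k) eta.
Proof.
intros He Hu Hb H0; induction k as [| k IH]; intros eta Heta.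
- apply rate_le with eps; [lra | exact H0].
- destruct (Rle_dec eta 0) as [N | N]; [apply rate_le with 0; auto |].
  (* room for the factor [rate_fraction m], which is less than one *)
  set (eta' := (eta + eps) / 2).
  assert (H1 : rate (u k) eta') by (apply IH; unfold eta'; lra).
  destruct (INR_unbounded (2 * eta' / (eta' - eta))) as [m Hm].
  apply rate_le with (eta' * rate_fraction m); [| apply rate_derive; try assumption; unfold eta'; lra].
  destruct (rate_fraction_bounds m) as [[B _] _].
  assert (D : 0 < eta' - eta) by (unfold eta'; lra).
  assert (P := pos_INR m).
  apply Rgt_lt, Rlt_div_l in Hm; [| exact D].
  apply Rle_trans with (eta' * (1 - 2 / (INR m + 2))); [| apply Rmult_le_compat_l; [unfold eta'; lra | exact B]].
  assert (E : eta' * (2 / (INR m + 2)) * (INR m + 2) = 2 * eta') by (field; lra).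
  assert (eta' * (2 / (INR m + 2)) <= eta' - eta); [| lra].
  apply Rmult_le_reg_r with (INR m + 2); [lra |]; nra.
Qed.

Lemma pow_le_exp n kappa : 0 < kappa -> exists K, 0 <= K /\ forall x, 0 <= x -> x ^ n <= K * exp (kappa * x).
Proof.
revert kappa; induction n as [| n IHn]; intros kappa Hk.
- exists 1; split; [lra |]; intros x Hx; simpl.
  rewrite Rmult_1_l, <- exp_0; apply exp_le_mono; nra.
- destruct (IHn (kappa / 2)) as (K & HK & IH); [lra |].
  exists (2 / kappa * K); split.
  { apply Rmult_le_pos; [| exact HK]; apply Rlt_le, Rdiv_lt_0_compat; lra. }
  intros x Hx; simpl.
  assert (E := exp_ineq1_le (kappa / 2 * x)).
  assert (X : x <= 2 / kappa * exp (kappa / 2 * x)).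
  { apply Rmult_le_reg_l with (kappa / 2); [lra |].
    replace (kappa / 2 * (2 / kappa * exp (kappa / 2 * x))) with (exp (kappa / 2 * x)) by (field; lra); lra. }
  replace (exp (kappa * x)) with (exp (kappa / 2 * x) * exp (kappa / 2 * x))
    by (rewrite <- exp_plus; f_equal; field).
  replace (2 / kappa * K * (exp (kappa / 2 * x) * exp (kappa / 2 * x)))
    with (2 / kappa * exp (kappa / 2 * x) * (K * exp (kappa / 2 * x))) by ring.
  apply Rmult_le_compat; [exact Hx | apply pow_le, Hx | exact X | apply IH, Hx].
Qed.

Lemma weighted_bounds_rate u sigma : (forall k, exists eta, sigma < eta /\ rate (u k) eta) -> weighted_bounds sigma u.
Proof.
intros H j k; destruct (H k) as (eta & He & K & HK & Hr).
destruct (pow_le_exp j (eta - sigma)) as (P & HP & Hp); [lra |].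
exists (P * K); intros x Hx.
specialize (Hp x Hx); specialize (Hr x Hx).
assert (E1 := exp_pos (sigma * x)); assert (X := pow_le x j Hx).
eapply Rle_trans.
{ apply Rmult_le_compat_l; [exact X |]; apply Rmult_le_compat_l; [lra | exact Hr]. }
eapply Rle_trans.
{ apply Rmult_le_compat_r; [| exact Hp].
  apply Rmult_le_pos; [lra |]; apply Rmult_le_pos; [exact HK | left; apply exp_pos]. }
right.
replace (P * exp ((eta - sigma) * x) * (exp (sigma * x) * (K * exp (- eta * x))))
  with (P * K * (exp ((eta - sigma) * x) * exp (sigma * x) * exp (- eta * x))) by ring.
rewrite <- !exp_plus; replace ((eta - sigma) * x + sigma * x + - eta * x) with 0 by ring.
rewrite exp_0; ring.
Qed.

Lemma exp_decay_tower eps f : 0 < eps -> exp_decay_half eps f ->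
  exists u, schwartz_tower u /\ (forall x, half_line x -> f x = u 0%nat x) /\
    forall k eta, eta < eps -> rate (u k) eta.
Proof.
intros He [Hf (M & X & HM)].
apply schwartz_half_tower in Hf; destruct Hf as (u & Su & E).
exists u; split; [exact Su | split; [exact E |]].
destruct Su as [Hu Bu].
assert (Hb : forall k, rate (u k) 0).
{ intros k; destruct (Bu 0%nat k) as [N HN]; exists N; split.
  - generalize (HN 0) (Cmod_ge_0 (u k 0)); simpl; lra.
  - intros x Hx; generalize (HN x); simpl; rewrite Ropp_0, Rmult_0_l, exp_0; lra. }
apply rate_tower; try assumption; [apply tower_R_half, Hu |].
destruct (Hb 0%nat) as (N & HN & BN).
exists (Rabs M + N * exp (eps * Rabs X)); split.
{ apply Rplus_le_le_0_compat; [apply Rabs_pos |]; apply Rmult_le_pos; [exact HN | left; apply exp_pos]. }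
intros x Hx; assert (P := exp_pos (- eps * x)).
destruct (Rle_dec X x) as [H | H].
- rewrite <- E by exact Hx; eapply Rle_trans; [apply HM; assumption |].
  apply Rmult_le_compat_r; [lra |].
  assert (Q := Rle_abs M); assert (0 <= N * exp (eps * Rabs X)); [| lra].
  apply Rmult_le_pos; [exact HN | left; apply exp_pos].
- eapply Rle_trans; [apply BN, Hx |]; rewrite Ropp_0, Rmult_0_l, exp_0, Rmult_1_r.
  rewrite Rmult_plus_distr_r, Rmult_assoc, <- exp_plus.
  assert (Q := Rle_abs X); assert (Q' := Rabs_pos M).
  assert (E1 : 1 <= exp (eps * Rabs X + - eps * x)) by (rewrite <- exp_0; apply exp_le_mono; nra).
  nra.
Qed.

(** * Diagonalisation *)

Lemma contour_int_paths (G : contour) (f : C -> C) (v : (R -> C) -> C) :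
  (forall gamma, In gamma G -> path_int gamma f (v gamma)) ->
  is_contour_int G f (fold_right (fun gamma s => v gamma + s)%C (RtoC 0) G).
Proof.
induction G as [| gamma G IH]; intros H; [reflexivity |].
exists (v gamma), (fold_right (fun gamma s => v gamma + s)%C (RtoC 0) G).
split; [apply H; left; reflexivity | split; [apply IH; intros; apply H; right; assumption | reflexivity]].
Qed.

Lemma contour_int_0 (G : contour) (f : C -> C) :
  (forall gamma, In gamma G -> path_int gamma f (RtoC 0)) -> is_contour_int G f (RtoC 0).
Proof.
intros H; assert (K := contour_int_paths G f (fun _ => RtoC 0) H).
replace (RtoC 0) with (fold_right (fun (_ : R -> C) s => RtoC 0 + s)%C (RtoC 0) G); [exact K |].
clear; induction G as [| gamma G IH]; [reflexivity |]; simpl; rewrite IH; ring.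
Qed.

(** The integrands of the two integrals to be compared differ by that of the
    remainder, which integrates to zero along each path separately. So it is
    enough that the first of them converges. *)
Lemma diagonalised_by_intro (I : R -> Prop) (V : fspace) (D : C -> fspace)
    (Phi : (R -> C) -> Prop) (L : (R -> C) -> R -> C) (G : contour)
    (E : C -> (R -> C) -> C) (z : C -> C) (Rem : C -> (R -> C) -> C) :
  (forall phi, Phi phi -> mem V phi) ->
  linear_operator Phi V L ->
  (forall lambda, on_contour G lambda ->
     (forall f, mem (D lambda) f -> mem V f) /\
     (forall phi, Phi phi -> mem (D lambda) phi /\ mem (D lambda) (L phi)) /\
     dual (D lambda) (E lambda)) ->
  (forall lambda, on_contour G lambda -> dual V (Rem lambda)) ->
  (forall lambda phi, on_contour G lambda -> Phi phi ->
     E lambda (L phi) = (z lambda * E lambda phi + Rem lambda phi)%C) ->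
  (forall lambda, on_contour G lambda -> z lambda <> RtoC 0) ->
  (forall phi x gamma, Phi phi -> I x -> In gamma G ->
     path_int gamma (fun lambda => Cexp (Ci * lambda * RtoC x) / z lambda * Rem lambda phi)%C (RtoC 0)) ->
  (forall phi x gamma, Phi phi -> I x -> In gamma G -> exists v,
     path_int gamma (fun lambda => Cexp (Ci * lambda * RtoC x) * (1 / z lambda) * E lambda (L phi))%C v) ->
  complete_system V Phi G E ->
  diagonalised_by I V D Phi L G E z.
Proof.
intros HV HL HD HR HE Hz HR0 HA Hc.
split; [| split; [exact Hc |]].
- split; [exact HV | split; [exact HL | split; [exact HD |]]].
  exists Rem; split; [exact HR | split; [exact HE |]].
  intros phi x Hphi Hx; apply contour_int_0; intros; apply HR0; assumption.
- intros f x Hf Hx.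
  set (v := fun gamma => epsilon (inhabits (RtoC 0)) (path_int gamma
    (fun lambda => Cexp (Ci * lambda * RtoC x) * (1 / z lambda) * E lambda (L f))%C)).
  assert (Hv : forall gamma, In gamma G -> path_int gamma
    (fun lambda => Cexp (Ci * lambda * RtoC x) * (1 / z lambda) * E lambda (L f))%C (v gamma)).
  { intros gamma Hg; apply epsilon_spec, HA; assumption. }
  exists (fold_right (fun gamma s => v gamma + s)%C (RtoC 0) G).
  split; apply contour_int_paths; [exact Hv |].
  intros gamma Hg.
  assert (K := path_int_minus _ _ _ _ _ (Hv gamma Hg) (HR0 f x gamma Hf Hx Hg)).
  replace (v gamma - RtoC 0)%C with (v gamma) in K by ring.
  revert K; apply path_int_ext; intros t.
  assert (Ht : on_contour G (gamma t)) by (exists gamma, t; auto).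
  rewrite HE by assumption; field; apply Hz, Ht.
Qed.

(** The remainder in the hypotheses of [gen_derive_0], for one exponential. *)
Lemma em_taylor_2 nu (r h x : R) n : 0 <= h -> 0 <= x ->
  Cmod ((- Ci * nu * RtoC x) ^ n * em (nu * RtoC (r + h)) x - (- Ci * nu * RtoC x) ^ n * em (nu * RtoC r) x
    - RtoC h * ((- Ci * nu * RtoC x) ^ S n * em (nu * RtoC r) x))
  <= h ^ 2 * ((Cmod nu * x) ^ (n + 2) * exp (Im nu * r * x + Cmod nu * h * x)).
Proof.
intros Hh Hx.
assert (Ez : Cmod (- Ci * nu * RtoC x) = Cmod nu * x).
{ rewrite !Cmod_mult, Cmod_opp, Cmod_Ci, Cmod_R, Rabs_pos_eq by exact Hx; ring. }
assert (Ew : Cmod (RtoC h * (- Ci * nu * RtoC x)) = Cmod nu * h * x).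
{ rewrite Cmod_mult, Ez, Cmod_R, Rabs_pos_eq by exact Hh; ring. }
replace ((- Ci * nu * RtoC x) ^ n * em (nu * RtoC (r + h)) x - (- Ci * nu * RtoC x) ^ n * em (nu * RtoC r) x
    - RtoC h * ((- Ci * nu * RtoC x) ^ S n * em (nu * RtoC r) x))%C
  with ((- Ci * nu * RtoC x) ^ n * em (nu * RtoC r) x *
    (Cexp (RtoC h * (- Ci * nu * RtoC x)) - 1 - RtoC h * (- Ci * nu * RtoC x)))%C.
2: { replace (nu * RtoC (r + h))%C with (nu * RtoC r + nu * RtoC h)%C by (rewrite RtoC_plus; ring).
     rewrite em_add_freq; unfold em at 3.
     replace (- Ci * (nu * RtoC h) * RtoC x)%C with (RtoC h * (- Ci * nu * RtoC x))%C by ring.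
     simpl; ring. }
rewrite !Cmod_mult, Cmod_pow, Ez, Cmod_em.
assert (B := Cmod_exp_2 (RtoC h * (- Ci * nu * RtoC x))); rewrite Ew in B.
replace (Im (nu * RtoC r) * x) with (Im nu * r * x) by (destruct nu; simpl; ring).
assert (P1 : 0 <= (Cmod nu * x) ^ n) by (apply pow_le, Rmult_le_pos; [apply Cmod_ge_0 | exact Hx]).
assert (P2 := exp_pos (Im nu * r * x)).
eapply Rle_trans; [apply Rmult_le_compat_l; [nra | exact B] |].
right; rewrite exp_plus, pow_add; ring.
Qed.

(** * The cube roots of unity and the zeros of [Delta] *)

Lemma alpha_polar : alpha = polar 1 (2 * PI / 3).
Proof. unfold alpha; rewrite polar_Cexp; ring. Qed.

Lemma alpha2_polar : (alpha ^ 2)%C = polar 1 (4 * PI / 3).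
Proof.
rewrite alpha_polar; simpl; rewrite Cmult_1_r, polar_mul; f_equal; field.
Qed.

Lemma alpha_mul_polar r th : (alpha * polar r th)%C = polar r (th + 2 * PI / 3).
Proof. rewrite alpha_polar, polar_mul; f_equal; ring. Qed.

Lemma alpha2_mul_polar r th : (alpha ^ 2 * polar r th)%C = polar r (th + 4 * PI / 3).
Proof. rewrite alpha2_polar, polar_mul; f_equal; ring. Qed.

Lemma alpha_cube : (alpha ^ 3)%C = RtoC 1.
Proof.
rewrite alpha_polar, polar_cube; unfold polar.
replace (3 * (2 * PI / 3)) with (2 * PI) by field.
rewrite cos_2PI, sin_2PI; unfold RtoC; f_equal; ring.
Qed.

Lemma alpha_sum : (1 + alpha + alpha ^ 2)%C = RtoC 0.
Proof.
rewrite alpha2_polar, alpha_polar; unfold polar.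
replace (4 * PI / 3) with (PI / 3 + PI) by field.
replace (2 * PI / 3) with (2 * (PI / 3)) by field.
rewrite neg_cos, neg_sin, cos_2PI3, sin_2PI3, cos_PI3, sin_PI3.
unfold Cplus, RtoC; simpl; f_equal; field.
Qed.

Lemma alpha_mul_cube (z : C) : ((alpha * z) ^ 3)%C = (z ^ 3)%C.
Proof. transitivity (alpha ^ 3 * z ^ 3)%C; [simpl; ring |]; rewrite alpha_cube; ring. Qed.

Lemma alpha2_mul_cube (z : C) : ((alpha ^ 2 * z) ^ 3)%C = (z ^ 3)%C.
Proof. transitivity (alpha ^ 3 * alpha ^ 3 * z ^ 3)%C; [simpl; ring |]; rewrite alpha_cube; ring. Qed.

Lemma Cmod_alpha : Cmod alpha = 1.
Proof. rewrite alpha_polar; apply Cmod_polar; lra. Qed.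

Lemma Cmod_alpha2 : Cmod (alpha ^ 2) = 1.
Proof. rewrite alpha2_polar; apply Cmod_polar; lra. Qed.

(** This decides whether the leading term of [Delta] outweighs the third-order
    remainder of the exponentials on the whole unit disc. *)
Lemma exp_1_lt_3 : exp 1 < 3.
Proof.
assert (H := exp_ineq1_le (- (1 / 6))).
assert (P := exp_pos (- (1 / 6))).
assert (E : exp (- (1 / 6)) ^ 6 * exp 1 = 1).
{ simpl; rewrite Rmult_1_r, <- !exp_plus, <- exp_0; f_equal; field. }
assert (Q : (5 / 6) ^ 6 <= exp (- (1 / 6)) ^ 6) by (apply pow_incr; lra).
assert (P1 := exp_pos 1); simpl in Q; nra.
Qed.

(** Since [1 + a + a^2 = 0] for [a = alpha] and for [a = alpha^2], the Taylor
    expansion of [Delta] at zero starts with [3 (- i lambda)^2 / 2]. *)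
Lemma Delta_neq_0_small (z : C) : 0 < Cmod z <= 1 -> Delta_FI z <> RtoC 0.
Proof.
intros Hz E.
assert (X : forall w : C, exp_taylor 3 w = (1 + w + w ^ 2 * RtoC (/ 2))%C).
{ intros w; simpl.
  replace (/ 1) with 1 by field; replace (1 + 1) with 2 by ring; ring. }
assert (R : forall w : C, Cmod w = Cmod z -> Cmod (Cexp w - (1 + w + w ^ 2 * RtoC (/ 2))) <= Cmod z ^ 3 / 6 * exp (Cmod z)).
{ intros w Hw; generalize (Cmod_exp_taylor 3 w); rewrite X, Hw.
  replace (INR (fact 3)) with 6 by (simpl; ring); easy. }
assert (M : forall c : C, Cmod c = 1 -> Cmod (- Ci * (c * z) * RtoC 1) = Cmod z).
{ intros c Hc; rewrite !Cmod_mult, Cmod_opp, Cmod_Ci, Cmod_R, Rabs_R1, Hc; ring. }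
assert (R0 := R (- Ci * (1 * z) * RtoC 1)%C (M (RtoC 1) Cmod_1)).
assert (R1 := R (- Ci * (alpha * z) * RtoC 1)%C (M alpha Cmod_alpha)).
assert (R2 := R (- Ci * (alpha ^ 2 * z) * RtoC 1)%C (M (alpha ^ 2)%C Cmod_alpha2)).
set (p := fun c => (1 + (- Ci * (c * z) * RtoC 1) + (- Ci * (c * z) * RtoC 1) ^ 2 * RtoC (/ 2))%C).
assert (S : (p (RtoC 1) + alpha * p alpha + alpha ^ 2 * p (alpha ^ 2) = - RtoC (3 / 2) * z ^ 2)%C).
{ unfold p.
  assert (A3 := alpha_cube); assert (A0 := alpha_sum); assert (I2 := Ci_sq).
  assert (A2 : (alpha ^ 2 = - 1 - alpha)%C).
  { transitivity ((1 + alpha + alpha ^ 2) - 1 - alpha)%C; [ring | rewrite A0; ring]. }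
  transitivity ((1 + alpha + alpha ^ 2) + - Ci * z * (1 + alpha ^ 2 + alpha ^ 3 * alpha)
    + (Ci * Ci) * z ^ 2 * RtoC (/ 2) * (1 + alpha ^ 3 + alpha ^ 3 * alpha ^ 3))%C; [simpl; ring |].
  rewrite A3, A0, I2, A2.
  replace (3 / 2) with (3 * / 2) by field; rewrite RtoC_mult.
  replace (RtoC 3) with (1 + 1 + 1)%C by (rewrite <- !RtoC_plus; f_equal; ring); ring. }
assert (D : (Delta_FI z - (p (RtoC 1) + alpha * p alpha + alpha ^ 2 * p (alpha ^ 2)) =
   (Cexp (- Ci * (1 * z) * RtoC 1) - p (RtoC 1)) + alpha * (Cexp (- Ci * (alpha * z) * RtoC 1) - p alpha)
   + alpha ^ 2 * (Cexp (- Ci * (alpha ^ 2 * z) * RtoC 1) - p (alpha ^ 2)))%C).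
{ unfold Delta_FI, em; rewrite Cmult_1_l; ring. }
rewrite E, S in D.
assert (B : Cmod (0 - - RtoC (3 / 2) * z ^ 2) <= 3 * (Cmod z ^ 3 / 6 * exp (Cmod z))).
{ rewrite D; eapply Rle_trans; [apply Cmod_triangle |].
  eapply Rle_trans; [apply Rplus_le_compat_r, Cmod_triangle |].
  rewrite (Cmod_mult alpha), (Cmod_mult (alpha ^ 2)), Cmod_alpha, Cmod_alpha2.
  unfold p; lra. }
replace (0 - - RtoC (3 / 2) * z ^ 2)%C with (RtoC (3 / 2) * z ^ 2)%C in B by ring.
rewrite Cmod_mult, Cmod_pow, Cmod_R, Rabs_pos_eq in B by lra.
assert (L : exp (Cmod z) <= exp 1) by (apply exp_le_mono; lra).
assert (L3 := exp_1_lt_3).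
set (m := Cmod z) in *.
assert (0 < m ^ 2) by (apply pow_lt; lra).
assert (K : m ^ 3 / 6 * exp m <= m ^ 2 * (exp 1 / 6)).
{ replace (m ^ 3 / 6 * exp m) with (m ^ 2 * (m * exp m / 6)) by field.
  apply Rmult_le_compat_l; [lra |]; assert (P := exp_pos m); nra. }
nra.
Qed.

Definition six_rays (th : R) : Prop :=
  th = 0 \/ th = PI / 3 \/ th = 2 * PI / 3 \/ th = PI \/ th = 4 * PI / 3 \/ th = 5 * PI / 3.

(** The largest of the moduli of the three exponentials in [Delta] on the six
    rays, at the distance [r] from zero. *)
Definition growth (r : R) : R := exp (sqrt 3 / 2 * r).

Lemma growth_ge_2 r : 1 <= r -> 2 <= growth r.
Proof.
intros Hr.
assert (S : 17 / 10 <= sqrt 3).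
{ rewrite <- (sqrt_square (17 / 10)) by lra; apply sqrt_le_1_alt; lra. }
apply Rle_trans with (exp (17 / 40) * exp (17 / 40)).
- assert (H := exp_ineq1_le (17 / 40)); nra.
- rewrite <- exp_plus; apply exp_le_mono; nra.
Qed.

Lemma sin_multiples :
  let s := sqrt 3 / 2 in
  sin 0 = 0 /\ sin (PI / 3) = s /\ sin (2 * PI / 3) = s /\ sin PI = 0 /\ sin (4 * PI / 3) = - s /\
  sin (5 * PI / 3) = - s /\ sin (2 * PI) = 0 /\ sin (7 * PI / 3) = s /\ sin (8 * PI / 3) = s /\ sin (3 * PI) = 0.
Proof.
intros s.
assert (S1 : sin (PI / 3) = s) by apply sin_PI3.
assert (S2 : sin (2 * PI / 3) = s).
{ replace (2 * PI / 3) with (2 * (PI / 3)) by field; apply sin_2PI3. }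
assert (S0 := sin_0); assert (S3 := sin_PI).
assert (P : forall x, sin (x + 2 * PI) = sin x).
{ intros x; replace (x + 2 * PI) with (x + 2 * INR 1 * PI) by (simpl; ring); apply sin_period. }
repeat split; try assumption.
- replace (4 * PI / 3) with (PI / 3 + PI) by field; rewrite neg_sin; lra.
- replace (5 * PI / 3) with (2 * PI / 3 + PI) by field; rewrite neg_sin; lra.
- apply sin_2PI.
- replace (7 * PI / 3) with (PI / 3 + 2 * PI) by field; rewrite P; lra.
- replace (8 * PI / 3) with (2 * PI / 3 + 2 * PI) by field; rewrite P; lra.
- replace (3 * PI) with (PI + 2 * PI) by ring; rewrite P; lra.
Qed.

Definition moduli (z : C) (m0 m1 m2 : R) : Prop :=
  Cmod (em z 1) = m0 /\ Cmod (em (alpha * z) 1) = m1 /\ Cmod (em (alpha ^ 2 * z) 1) = m2.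

Lemma moduli_rays r :
  let Y := growth r in
  moduli (polar r 0) 1 Y (/ Y) /\ moduli (polar r (PI / 3)) Y 1 (/ Y) /\
  moduli (polar r (2 * PI / 3)) Y (/ Y) 1 /\ moduli (polar r PI) 1 (/ Y) Y /\
  moduli (polar r (4 * PI / 3)) (/ Y) 1 Y /\ moduli (polar r (5 * PI / 3)) (/ Y) Y 1.
Proof.
intros Y.
destruct sin_multiples as (S0 & S1 & S2 & S3 & S4 & S5 & S6 & S7 & S8 & S9).
assert (E0 : forall th, sin th = 0 -> Cmod (em (polar r th) 1) = 1).
{ intros th H; rewrite Cmod_em; simpl; rewrite H, Rmult_1_r, Rmult_0_r; apply exp_0. }
assert (E1 : forall th, sin th = sqrt 3 / 2 -> Cmod (em (polar r th) 1) = Y).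
{ intros th H; rewrite Cmod_em; simpl; rewrite H, Rmult_1_r; unfold Y, growth; f_equal; ring. }
assert (E2 : forall th, sin th = - (sqrt 3 / 2) -> Cmod (em (polar r th) 1) = / Y).
{ intros th H; rewrite Cmod_em; simpl; rewrite H, Rmult_1_r; unfold Y, growth; rewrite <- exp_Ropp; f_equal; ring. }
unfold moduli.
rewrite !alpha_mul_polar, !alpha2_mul_polar.
replace (0 + 2 * PI / 3) with (2 * PI / 3) by ring; replace (0 + 4 * PI / 3) with (4 * PI / 3) by ring.
replace (PI / 3 + 2 * PI / 3) with PI by field; replace (PI / 3 + 4 * PI / 3) with (5 * PI / 3) by field.
replace (2 * PI / 3 + 2 * PI / 3) with (4 * PI / 3) by field; replace (2 * PI / 3 + 4 * PI / 3) with (2 * PI) by field.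
replace (PI + 2 * PI / 3) with (5 * PI / 3) by field; replace (PI + 4 * PI / 3) with (7 * PI / 3) by field.
replace (4 * PI / 3 + 2 * PI / 3) with (2 * PI) by field; replace (4 * PI / 3 + 4 * PI / 3) with (8 * PI / 3) by field.
replace (5 * PI / 3 + 2 * PI / 3) with (7 * PI / 3) by field; replace (5 * PI / 3 + 4 * PI / 3) with (3 * PI) by field.
repeat match goal with |- _ /\ _ => split end;
  (apply E0; assumption) || (apply E1; assumption) || (apply E2; assumption).
Qed.

Lemma Cmod_3_lower (a b c : C) : Cmod a - Cmod b - Cmod c <= Cmod (a + b + c).
Proof.
assert (H : Cmod a <= Cmod (a + b + c) + Cmod b + Cmod c).
{ replace a with ((a + b + c) + - b + - c)%C at 1 by ring.
  eapply Rle_trans; [apply Cmod_triangle |]; rewrite Cmod_opp.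
  apply Rplus_le_compat_r; eapply Rle_trans; [apply Cmod_triangle |]; rewrite Cmod_opp; lra. }
lra.
Qed.

Lemma Delta_lower (z : C) m0 m1 m2 : moduli z m0 m1 m2 ->
  m0 - m1 - m2 <= Cmod (Delta_FI z) /\ m1 - m0 - m2 <= Cmod (Delta_FI z) /\
  m2 - m0 - m1 <= Cmod (Delta_FI z).
Proof.
intros (E0 & E1 & E2); unfold Delta_FI.
set (a := em z 1) in *; set (b := (alpha * em (alpha * z) 1)%C); set (c := (alpha ^ 2 * em (alpha ^ 2 * z) 1)%C).
assert (Eb : Cmod b = m1) by (unfold b; rewrite Cmod_mult, Cmod_alpha; lra).
assert (Ec : Cmod c = m2) by (unfold c; rewrite Cmod_mult, Cmod_alpha2; lra).
assert (H1 := Cmod_3_lower a b c); assert (H2 := Cmod_3_lower b a c); assert (H3 := Cmod_3_lower c a b).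
replace (b + a + c)%C with (a + b + c)%C in H2 by ring.
replace (c + a + b)%C with (a + b + c)%C in H3 by ring.
lra.
Qed.

(** On the six rays the moduli of the three exponentials are [Y], [1] and
    [1 / Y], so that one of them dominates. *)
Lemma Delta_lower_rays r th : 1 <= r -> six_rays th -> growth r / 4 <= Cmod (Delta_FI (polar r th)).
Proof.
intros Hr Hth.
assert (Y2 := growth_ge_2 r Hr).
assert (I : / growth r <= / 2) by (apply Rinv_le_contravar; lra).
destruct (moduli_rays r) as (M0 & M1 & M2 & M3 & M4 & M5).
destruct Hth as [-> | [-> | [-> | [-> | [-> | ->]]]]];
  [apply Delta_lower in M0 | apply Delta_lower in M1 | apply Delta_lower in M2
  | apply Delta_lower in M3 | apply Delta_lower in M4 | apply Delta_lower in M5]; lra.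
Qed.

Lemma Delta_neq_0_rays r th : 1 <= r -> six_rays th -> Delta_FI (polar r th) <> RtoC 0.
Proof.
intros Hr Hth E; assert (H := Delta_lower_rays r th Hr Hth); rewrite E, Cmod_0 in H.
assert (Y2 := growth_ge_2 r Hr); lra.
Qed.

(** * The finite interval *)

Notation hat1 := (transform (at_point 1)).

(** The functionals [F_lambda] as combinations of transforms. These formulas
    make sense at every complex [z], so that their continuity at the points of
    the contour does not see the change of formula in [F_FI]. *)
Definition FI_plus (g : R -> C) (z : C) : C :=
  (1 / (RtoC (2 * PI) * Delta_FI z) *
    (hat1 g z * (alpha * em (alpha * z) 1 + alpha ^ 2 * em (alpha ^ 2 * z) 1)
     - (alpha * hat1 g (alpha * z) + alpha ^ 2 * hat1 g (alpha ^ 2 * z)) * em z 1))%C.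

Definition FI_minus (g : R -> C) (z : C) : C :=
  (- em z 1 / (RtoC (2 * PI) * Delta_FI z) *
    (hat1 g z + alpha * hat1 g (alpha * z) + alpha ^ 2 * hat1 g (alpha ^ 2 * z)))%C.

Lemma RtoC_2PI_neq_0 : RtoC (2 * PI) <> RtoC 0.
Proof. intros E; apply RtoC_inj in E; assert (H := PI_RGT_0); lra. Qed.

Definition is_FI_edge_plus (r th : R) : Prop :=
  sector_edge 1 0 (PI / 3) r th \/ sector_edge 1 (2 * PI / 3) PI r th.

Lemma on_FI_plus z : on_contour Gamma_FI_plus z -> exists r th, is_FI_edge_plus r th /\ z = polar r th.
Proof.
assert (Hpi := PI_RGT_0).
intros (g & t & [<- | [<- | []]] & <-).
- destruct (sector_path_edge 1 0 (PI / 3) ltac:(lra) ltac:(lra) t) as (r & th & He & E).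
  exists r, th; split; [left; exact He | exact E].
- destruct (sector_path_edge 1 (2 * PI / 3) PI ltac:(lra) ltac:(lra) t) as (r & th & He & E).
  exists r, th; split; [right; exact He | exact E].
Qed.

Lemma on_FI_minus z : on_contour Gamma_FI_minus z ->
  exists r th, sector_edge 1 (4 * PI / 3) (5 * PI / 3) r th /\ z = polar r th.
Proof.
assert (Hpi := PI_RGT_0).
intros (g & t & [<- | []] & <-).
destruct (sector_path_edge 1 (4 * PI / 3) (5 * PI / 3) ltac:(lra) ltac:(lra) t) as (r & th & He & E).
exists r, th; split; [exact He | exact E].
Qed.

Lemma FI_plus_Im r th : is_FI_edge_plus r th -> 0 <= sin th /\ 1 <= r.
Proof.
assert (Hpi := PI_RGT_0).
intros [[[Hr [-> | ->]] | [-> Hth]] | [[Hr [-> | ->]] | [-> Hth]]]; (split; [apply sin_ge_0; lra | lra]).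
Qed.

Lemma FI_minus_Im r th : sector_edge 1 (4 * PI / 3) (5 * PI / 3) r th -> sin th < 0 /\ 1 <= r.
Proof.
assert (Hpi := PI_RGT_0).
intros [[Hr [-> | ->]] | [-> Hth]]; (split; [apply sin_lt_0; lra | lra]).
Qed.

Lemma FI_minus_not_plus z : on_contour Gamma_FI_minus z -> ~ on_contour Gamma_FI_plus z.
Proof.
intros Hm Hp.
destruct (on_FI_minus z Hm) as (r & th & He & ->); apply FI_minus_Im in He.
destruct (on_FI_plus _ Hp) as (r' & th' & He' & E); apply FI_plus_Im in He'.
apply (f_equal Im) in E; simpl in E; nra.
Qed.

Lemma on_FI_cases z : on_contour Gamma_FI z -> on_contour Gamma_FI_plus z \/ on_contour Gamma_FI_minus z.
Proof.
intros (g & t & Hg & E); unfold Gamma_FI in Hg; apply in_app_or in Hg.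
destruct Hg as [Hg | Hg]; [left | right]; exists g, t; auto.
Qed.

Lemma edge_Delta r th a b : (six_rays a /\ six_rays b) -> sector_edge 1 a b r th ->
  1 <= r /\ polar r th <> RtoC 0 /\ Delta_FI (polar r th) <> RtoC 0.
Proof.
intros [Ha Hb] [[Hr Hth] | [-> Hth]].
- split; [exact Hr | split; [apply polar_neq_0; lra |]].
  destruct Hth as [-> | ->]; apply Delta_neq_0_rays; assumption.
- split; [lra | split; [apply polar_neq_0; lra |]].
  apply Delta_neq_0_small; rewrite Cmod_polar; lra.
Qed.

Lemma six_FI1 : six_rays 0 /\ six_rays (PI / 3). Proof. unfold six_rays; auto. Qed.
Lemma six_FI2 : six_rays (2 * PI / 3) /\ six_rays PI. Proof. unfold six_rays; auto 6. Qed.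
Lemma six_FI3 : six_rays (4 * PI / 3) /\ six_rays (5 * PI / 3). Proof. unfold six_rays; auto 8. Qed.

Lemma on_FI_Delta z : on_contour Gamma_FI z -> z <> RtoC 0 /\ Delta_FI z <> RtoC 0.
Proof.
intros H; apply on_FI_cases in H; destruct H as [H | H].
- destruct (on_FI_plus z H) as (r & th & [He | He] & ->).
  + apply edge_Delta in He; [apply He | apply six_FI1].
  + apply edge_Delta in He; [apply He | apply six_FI2].
- destruct (on_FI_minus z H) as (r & th & He & ->).
  apply edge_Delta in He; [apply He | apply six_FI3].
Qed.

Section UnitFunctions.
Context (g : R -> C) (Cg : forall x, unit_interval x -> continuous g x).

Lemma unit_integral (w : R -> R) : (forall x, unit_interval x -> continuous w x) ->
  is_RInt_gen w (at_point 0) (at_point 1) (RInt w 0 1).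
Proof.
intros Cw; apply (is_RInt_gen_at_point (V := R_NormedModule)), (RInt_correct (V := R_CompleteNormedModule)).
apply (ex_RInt_continuous (V := R_CompleteNormedModule)).
rewrite Rmin_left, Rmax_right by lra; exact Cw.
Qed.

Lemma hat1_transformable z : transformable unit_interval (at_point 1) g z.
Proof.
split; [exact Cg |].
assert (Cw : forall x, unit_interval x -> continuous (fun x => (1 + x) * exp ((Im z + 1) * x) * Cmod (g x)) x).
{ intros x Hx; apply cont_Rmult; [| apply cont_Cmod, Cg, Hx].
  apply ex_derive_continuous_R; auto_derive; easy. }
exists 1, (RInt (fun x => (1 + x) * exp ((Im z + 1) * x) * Cmod (g x)) 0 1), 
  (fun x => (1 + x) * exp ((Im z + 1) * x) * Cmod (g x)).
split; [lra | split; [exact Cw | split; [apply unit_integral, Cw | intros; apply Rle_refl]]].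
Qed.

Lemma hat1_int z : genC (fun x => em z x * g x)%C (at_point 0) (at_point 1) (hat1 g z).
Proof. apply (transform_int int_range_unit), hat1_transformable. Qed.

Lemma hat1_cont z : continuous (hat1 g) z.
Proof. apply (transform_cont int_range_unit), hat1_transformable. Qed.

Lemma hat1_bound z : Cmod (hat1 g z) <= Rmax 1 (Cmod (em z 1)) * RInt (fun x => Cmod (g x)) 0 1.
Proof.
apply (transform_dominated int_range_unit g z (fun x => Rmax 1 (Cmod (em z 1)) * Cmod (g x))).
- exact Cg.
- intros x Hx; apply cont_Rmult; [apply continuous_const | apply cont_Cmod, Cg, Hx].
- intros x [H0 H1]; rewrite Cmod_mult, !Cmod_em; apply Rmult_le_compat_r; [apply Cmod_ge_0 |].
  destruct (Rle_dec (Im z) 0) as [N | N].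
  + eapply Rle_trans; [| apply Rmax_l]; rewrite <- exp_0; apply exp_le_mono; nra.
  + eapply Rle_trans; [| apply Rmax_r]; apply exp_le_mono; nra.
- apply gen_scal_R, unit_integral; intros x Hx; apply cont_Cmod, Cg, Hx.
Qed.

Lemma F_FI_plus f z : (forall x, unit_interval x -> f x = g x) ->
  on_contour Gamma_FI_plus z -> F_FI z f = FI_plus g z.
Proof.
intros E Hz; unfold F_FI; apply intC_unique.
apply (is_RInt_gen_at_point (V := C_R_NormedModule)).
assert (H0 := hat1_int z); assert (H1 := hat1_int (alpha * z)%C); assert (H2 := hat1_int (alpha ^ 2 * z)%C).
assert (H := range_scal int_range_unit (1 / (RtoC (2 * PI) * Delta_FI z))%C (range_minus int_range_unit
   (range_scal int_range_unit (alpha * em (alpha * z) 1 + alpha ^ 2 * em (alpha ^ 2 * z) 1)%C H0)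
   (range_scal int_range_unit (em z 1) (range_plus int_range_unit
      (range_scal int_range_unit alpha H1)
      (range_scal int_range_unit (alpha ^ 2)%C H2))))).
replace (FI_plus g z) with (1 / (RtoC (2 * PI) * Delta_FI z) *
  ((alpha * em (alpha * z) 1 + alpha ^ 2 * em (alpha ^ 2 * z) 1) * hat1 g z
    - em z 1 * (alpha * hat1 g (alpha * z) + alpha ^ 2 * hat1 g (alpha ^ 2 * z))))%C
  by (unfold FI_plus; ring).
revert H; apply (genC_ext int_range_unit); intros x Hx.
destruct (excluded_middle_informative _) as [_ | N]; [| contradiction].
rewrite (E x Hx); unfold phi_FI_plus; cring.
Qed.

Lemma F_FI_minus f z : (forall x, unit_interval x -> f x = g x) ->
  ~ on_contour Gamma_FI_plus z -> F_FI z f = FI_minus g z.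
Proof.
intros E Hz; unfold F_FI; apply intC_unique.
apply (is_RInt_gen_at_point (V := C_R_NormedModule)).
assert (H0 := hat1_int z); assert (H1 := hat1_int (alpha * z)%C); assert (H2 := hat1_int (alpha ^ 2 * z)%C).
assert (H := range_scal int_range_unit (- em z 1 / (RtoC (2 * PI) * Delta_FI z))%C (range_plus int_range_unit
   (range_plus int_range_unit H0
      (range_scal int_range_unit alpha H1))
   (range_scal int_range_unit (alpha ^ 2)%C H2))).
revert H; apply (genC_ext int_range_unit); intros x Hx.
destruct (excluded_middle_informative _) as [N | _]; [contradiction |].
rewrite (E x Hx); unfold phi_FI_minus; cring.
Qed.

Lemma cont_em_arg (c : C) (x : R) (z : C) : continuous (fun z => em (c * z) x) z.
Proof. unfold em; ccont. Qed.

Lemma cont_hat1_arg (c z : C) : continuous (fun z => hat1 g (c * z)%C) z.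
Proof.
apply (continuous_comp (fun z => c * z)%C (hat1 g)); [ccont | apply hat1_cont].
Qed.

Lemma cont_Delta z : continuous Delta_FI z.
Proof.
unfold Delta_FI.
apply (continuous_ext (fun z => em (1 * z) 1 + alpha * em (alpha * z) 1 + alpha ^ 2 * em (alpha ^ 2 * z) 1)%C).
{ intros w; rewrite Cmult_1_l; reflexivity. }
ccont; apply cont_em_arg.
Qed.

Lemma cont_FI_plus z : Delta_FI z <> RtoC 0 -> continuous (FI_plus g) z.
Proof.
intros N; unfold FI_plus.
apply (continuous_ext (fun z => 1 / (RtoC (2 * PI) * Delta_FI z) *
    (hat1 g (1 * z) * (alpha * em (alpha * z) 1 + alpha ^ 2 * em (alpha ^ 2 * z) 1)
     - (alpha * hat1 g (alpha * z) + alpha ^ 2 * hat1 g (alpha ^ 2 * z)) * em (1 * z) 1))%C).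
{ intros w; rewrite Cmult_1_l; reflexivity. }
ccont; lazymatch goal with
  | |- continuous (fun z => transform _ _ _) _ => apply cont_hat1_arg
  | |- continuous (fun z => em _ _) _ => apply cont_em_arg
  | |- continuous (fun z => Delta_FI z) _ => apply cont_Delta
  | _ => idtac
  end.
apply Cmult_neq_0; [apply RtoC_2PI_neq_0 | exact N].
Qed.

Lemma cont_FI_minus z : Delta_FI z <> RtoC 0 -> continuous (FI_minus g) z.
Proof.
intros N; unfold FI_minus.
apply (continuous_ext (fun z => - em (1 * z) 1 / (RtoC (2 * PI) * Delta_FI z) *
    (hat1 g (1 * z) + alpha * hat1 g (alpha * z) + alpha ^ 2 * hat1 g (alpha ^ 2 * z)))%C).
{ intros w; rewrite Cmult_1_l; reflexivity. }
ccont; lazymatch goal with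
  | |- continuous (fun z => transform _ _ _) _ => apply cont_hat1_arg
  | |- continuous (fun z => em _ _) _ => apply cont_em_arg
  | |- continuous (fun z => Delta_FI z) _ => apply cont_Delta
  | _ => idtac
  end.
apply Cmult_neq_0; [apply RtoC_2PI_neq_0 | exact N].
Qed.

Let K := RInt (fun x => Cmod (g x)) 0 1.

Lemma K_ge_0 : 0 <= K.
Proof.
apply RInt_ge_0; [lra | | intros; apply Cmod_ge_0].
apply (ex_RInt_continuous (V := R_CompleteNormedModule)).
rewrite Rmin_left, Rmax_right by lra; intros x Hx; apply cont_Cmod, Cg, Hx.
Qed.

Lemma hat1_moduli z m0 m1 m2 : moduli z m0 m1 m2 ->
  Cmod (hat1 g z) <= Rmax 1 m0 * K /\ Cmod (hat1 g (alpha * z)) <= Rmax 1 m1 * K /\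
  Cmod (hat1 g (alpha ^ 2 * z)) <= Rmax 1 m2 * K.
Proof. intros (<- & <- & <-); repeat split; apply hat1_bound. Qed.

Lemma Cmod_prefactor (c z : C) Y : 0 < Y -> Y / 4 <= Cmod (Delta_FI z) ->
  Cmod (c / (RtoC (2 * PI) * Delta_FI z)) <= Cmod c * / Y.
Proof.
intros HY HD.
assert (P3 : 3 < PI) by (generalize PI2_3_2; lra).
assert (N : (RtoC (2 * PI) * Delta_FI z)%C <> RtoC 0).
{ apply Cmult_neq_0; [apply RtoC_2PI_neq_0 |]; intros E; rewrite E, Cmod_0 in HD; lra. }
rewrite Cmod_div by exact N; apply Rmult_le_compat_l; [apply Cmod_ge_0 |].
rewrite Cmod_mult, Cmod_R, Rabs_pos_eq by lra; apply Rinv_le_contravar; nra.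
Qed.

(** On these rays the numerator is at most a multiple of [growth r], which is
    also the size of [Delta]. *)
Lemma FI_plus_bound r th : 1 <= r -> th = 0 \/ th = PI / 3 \/ th = 2 * PI / 3 \/ th = PI ->
  Cmod (FI_plus g (polar r th)) <= 8 * K.
Proof.
intros Hr Hth.
assert (S6 : six_rays th) by (unfold six_rays; tauto).
assert (Y2 := growth_ge_2 r Hr); assert (HD := Delta_lower_rays r th Hr S6).
assert (HK := K_ge_0).
set (Y := growth r) in *.
assert (I0 : 0 < / Y) by (apply Rinv_0_lt_compat; lra).
assert (I1 : / Y <= / 2) by (apply Rinv_le_contravar; lra).
assert (IY : / Y * Y = 1) by (field; lra).
assert (R1 : Rmax 1 1 = 1) by (apply Rmax_left; lra).
assert (RY : Rmax 1 Y = Y) by (apply Rmax_right; lra).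
assert (RI : Rmax 1 (/ Y) = 1) by (apply Rmax_left; lra).
unfold FI_plus; rewrite Cmod_mult.
assert (B1 := Cmod_prefactor 1 (polar r th) Y ltac:(lra) HD); rewrite Cmod_1, Rmult_1_l in B1.
assert (B2 : Cmod (hat1 g (polar r th) * (alpha * em (alpha * polar r th) 1 + alpha ^ 2 * em (alpha ^ 2 * polar r th) 1)
     - (alpha * hat1 g (alpha * polar r th) + alpha ^ 2 * hat1 g (alpha ^ 2 * polar r th)) * em (polar r th) 1)
  <= 8 * K * Y).
{ set (z := polar r th) in *.
  eapply Rle_trans; [apply Cmod_triangle |]; rewrite Cmod_opp, !Cmod_mult.
  assert (T1 : forall a b : C, Cmod (alpha * a + alpha ^ 2 * b) <= Cmod a + Cmod b).
  { intros a b; eapply Rle_trans; [apply Cmod_triangle |]; rewrite !Cmod_mult, Cmod_alpha, Cmod_alpha2; lra. }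
  assert (G : forall m0 m1 m2, moduli z m0 m1 m2 -> Rmax 1 m0 * (m1 + m2) + (Rmax 1 m1 + Rmax 1 m2) * m0 <= 8 * Y ->
     Cmod (hat1 g z) * Cmod (alpha * em (alpha * z) 1 + alpha ^ 2 * em (alpha ^ 2 * z) 1) +
     Cmod (alpha * hat1 g (alpha * z) + alpha ^ 2 * hat1 g (alpha ^ 2 * z)) * Cmod (em z 1) <= 8 * K * Y).
  { intros m0 m1 m2 M HM.
    destruct (hat1_moduli z m0 m1 m2 M) as (H0 & H1 & H2).
    destruct M as (E0 & E1 & E2).
    assert (Q1 := T1 (em (alpha * z) 1) (em (alpha ^ 2 * z) 1)); rewrite E1, E2 in Q1.
    assert (Q2 := T1 (hat1 g (alpha * z)) (hat1 g (alpha ^ 2 * z))).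
    assert (N0 : 0 <= m0) by (rewrite <- E0; apply Cmod_ge_0).
    rewrite E0.
    apply Rle_trans with (Rmax 1 m0 * K * (m1 + m2) + (Rmax 1 m1 * K + Rmax 1 m2 * K) * m0); [| nra].
    apply Rplus_le_compat; apply Rmult_le_compat; try apply Cmod_ge_0; lra. }
  destruct (moduli_rays r) as (M0 & M1 & M2 & M3 & _ & _); fold Y in M0, M1, M2, M3.
  unfold z in *; destruct Hth as [-> | [-> | [-> | ->]]].
  - apply (G _ _ _ M0); rewrite R1, RY, RI; nra.
  - apply (G _ _ _ M1); rewrite R1, RY, RI; nra.
  - apply (G _ _ _ M2); rewrite R1, RY, RI; nra.
  - apply (G _ _ _ M3); rewrite R1, RY, RI; nra. }
apply Rle_trans with (/ Y * (8 * K * Y)).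
- apply Rmult_le_compat; try apply Cmod_ge_0; assumption.
- right; field; lra.
Qed.

(** In the lower half-plane [e^{i lambda x}] is large, but in modulus at most
    [e^{i lambda}] since [x <= 1]; the factor [e^{-i lambda}] of [phi^-]
    compensates it. *)
Lemma FI_minus_bound r th x : 1 <= r -> th = 4 * PI / 3 \/ th = 5 * PI / 3 -> 0 <= x <= 1 ->
  Cmod (Cexp (Ci * polar r th * RtoC x) * FI_minus g (polar r th)) <= 8 * K.
Proof.
intros Hr Hth Hx.
assert (S6 : six_rays th) by (unfold six_rays; tauto).
assert (Y2 := growth_ge_2 r Hr); assert (HD := Delta_lower_rays r th Hr S6).
assert (HK := K_ge_0).
set (Y := growth r) in *.
assert (I0 : 0 < / Y) by (apply Rinv_0_lt_compat; lra).
assert (I1 : / Y <= / 2) by (apply Rinv_le_contravar; lra).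
assert (IY : / Y * Y = 1) by (field; lra).
assert (R1 : Rmax 1 1 = 1) by (apply Rmax_left; lra).
assert (RY : Rmax 1 Y = Y) by (apply Rmax_right; lra).
assert (RI : Rmax 1 (/ Y) = 1) by (apply Rmax_left; lra).
unfold FI_minus.
replace (Cexp (Ci * polar r th * RtoC x) * (- em (polar r th) 1 / (RtoC (2 * PI) * Delta_FI (polar r th)) *
    (hat1 g (polar r th) + alpha * hat1 g (alpha * polar r th) + alpha ^ 2 * hat1 g (alpha ^ 2 * polar r th))))%C
  with ((- (Cexp (Ci * polar r th * RtoC x) * em (polar r th) 1)) / (RtoC (2 * PI) * Delta_FI (polar r th)) *
    (hat1 g (polar r th) + alpha * hat1 g (alpha * polar r th) + alpha ^ 2 * hat1 g (alpha ^ 2 * polar r th)))%C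
  by (unfold Cdiv; ring).
rewrite Cmod_mult.
eapply Rle_trans.
{ apply Rmult_le_compat_r; [apply Cmod_ge_0 |]; apply (Cmod_prefactor _ _ Y); [lra | exact HD]. }
set (z := polar r th) in *.
assert (Sn : sin th < 0).
{ assert (Hpi := PI_RGT_0); apply sin_lt_0; lra. }
assert (B1 : Cmod (- (Cexp (Ci * z * RtoC x) * em z 1)) <= 1).
{ rewrite Cmod_opp, Cmod_mult, Cexp_i_em, !Cmod_em, <- exp_plus.
  apply Rle_trans with (exp 0); [| rewrite exp_0; lra].
  apply exp_le_mono; unfold z; simpl.
  assert (r * sin th <= 0) by nra; nra. }
assert (B2 : Cmod (hat1 g z + alpha * hat1 g (alpha * z) + alpha ^ 2 * hat1 g (alpha ^ 2 * z)) <= 8 * K * Y).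
{ eapply Rle_trans; [apply Cmod_triangle |].
  eapply Rle_trans; [apply Rplus_le_compat_r, Cmod_triangle |].
  rewrite (Cmod_mult alpha), (Cmod_mult (alpha ^ 2)), Cmod_alpha, Cmod_alpha2.
  destruct (moduli_rays r) as (_ & _ & _ & _ & M4 & M5); fold Y in M4, M5.
  unfold z; destruct Hth as [-> | ->].
  - destruct (hat1_moduli _ _ _ _ M4) as (H0 & H1 & H2); rewrite R1, RY, RI in *; nra.
  - destruct (hat1_moduli _ _ _ _ M5) as (H0 & H1 & H2); rewrite R1, RY, RI in *; nra. }
apply Rle_trans with (1 * / Y * (8 * K * Y)).
- apply Rmult_le_compat; [| apply Cmod_ge_0 | nra | exact B2].
  apply Rmult_le_pos; [apply Cmod_ge_0 | lra].
- right; field; lra.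
Qed.

Lemma Cmod_inv_cube_le r th : 1 <= r -> Cmod (1 / cube (polar r th)) <= / r ^ 2.
Proof.
intros Hr; unfold cube, Cdiv.
rewrite Cmult_1_l, Cmod_inv by (apply Cpow_nz, polar_neq_0; lra).
rewrite Cmod_pow, Cmod_polar by lra.
apply Rinv_le_contravar; [apply pow_lt; lra | simpl; nra].
Qed.

Lemma FI_integrand_plus_ex a b x : a < b -> (six_rays a /\ six_rays b) ->
  (a = 0 /\ b = PI / 3 \/ a = 2 * PI / 3 /\ b = PI) -> 0 < x < 1 ->
  exists v, path_int (sector_path 1 a b) (fun z => Cexp (Ci * z * RtoC x) * (1 / cube z) * FI_plus g z)%C v.
Proof.
intros Hab H6 Hcase Hx; apply (path_int_sector_ex 1 a b Rlt_0_1 Hab _ (8 * K)).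
- intros r th He; destruct (edge_Delta r th a b H6 He) as (Hr & N & ND); unfold cube.
  ccont; [apply Cpow_nz, N | apply cont_FI_plus, ND].
- intros r th Hr Hth.
  assert (Hth' : th = 0 \/ th = PI / 3 \/ th = 2 * PI / 3 \/ th = PI).
  { destruct Hcase as [[-> ->] | [-> ->]]; tauto. }
  rewrite !Cmod_mult.
  assert (B1 := Cmod_inv_cube_le r th Hr); assert (B2 := FI_plus_bound r th Hr Hth').
  assert (B0 : Cmod (Cexp (Ci * polar r th * RtoC x)) <= 1).
  { rewrite Cexp_i_em, Cmod_em, <- exp_0; apply exp_le_mono; simpl.
    assert (0 <= sin th); [| assert (0 <= r * sin th) by nra; nra].
    assert (Hpi := PI_RGT_0); apply sin_ge_0; lra. }
  unfold Rdiv; rewrite (Rmult_comm (8 * K)).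
  apply Rmult_le_compat; try apply Cmod_ge_0; try exact B2.
  + apply Rmult_le_pos; apply Cmod_ge_0.
  + rewrite <- (Rmult_1_l (/ r ^ 2)); apply Rmult_le_compat; try apply Cmod_ge_0; assumption.
Qed.

Lemma FI_integrand_minus_ex x : 0 < x < 1 ->
  exists v, path_int (sector_path 1 (4 * PI / 3) (5 * PI / 3))
    (fun z => Cexp (Ci * z * RtoC x) * (1 / cube z) * FI_minus g z)%C v.
Proof.
assert (Hpi := PI_RGT_0).
intros Hx; apply (path_int_sector_ex 1 (4 * PI / 3) (5 * PI / 3) Rlt_0_1 ltac:(lra) _ (8 * K)).
- intros r th He; destruct (edge_Delta r th _ _ six_FI3 He) as (Hr & N & ND); unfold cube.
  ccont; [apply Cpow_nz, N | apply cont_FI_minus, ND].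
- intros r th Hr Hth.
  replace (Cexp (Ci * polar r th * RtoC x) * (1 / cube (polar r th)) * FI_minus g (polar r th))%C
    with ((Cexp (Ci * polar r th * RtoC x) * FI_minus g (polar r th)) * (1 / cube (polar r th)))%C by ring.
  rewrite Cmod_mult; unfold Rdiv.
  apply Rmult_le_compat; try apply Cmod_ge_0; [apply FI_minus_bound; lra | apply Cmod_inv_cube_le, Hr].
Qed.

End UnitFunctions.

Lemma unit_linear (f g : R -> C) (a b : C) :
  smooth_on unit_interval f -> smooth_on unit_interval g ->
  smooth_on unit_interval (fun x => a * f x + b * g x)%C /\
  forall k x, unit_interval x -> Derive_on_n unit_interval k (fun x => a * f x + b * g x)%C x
    = (a * Derive_on_n unit_interval k f x + b * Derive_on_n unit_interval k g x)%C.
Proof.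
intros Hf Hg.
destruct (smooth_unit_tower f Hf) as (u & Tu & Eu); destruct (smooth_unit_tower g Hg) as (v & Tv & Ev).
assert (T := tower_linear _ _ _ a b Tu Tv).
assert (E0 : forall x, unit_interval x -> (a * f x + b * g x = a * u 0%nat x + b * v 0%nat x)%C).
{ intros x Hx; rewrite <- (Eu 0%nat x Hx), <- (Ev 0%nat x Hx); reflexivity. }
split; [apply (smooth_on_tower _ _ _ perfect_unit T E0) |].
intros k x Hx; rewrite (Derive_on_n_tower _ _ _ perfect_unit T E0) by exact Hx.
rewrite Eu, Ev by exact Hx; reflexivity.
Qed.

Lemma unit_0 : unit_interval 0. Proof. unfold unit_interval; lra. Qed.
Lemma unit_1 : unit_interval 1. Proof. unfold unit_interval; lra. Qed.

Lemma S_unit_smooth f : smooth_on unit_interval f -> smooth_on unit_interval (S_op unit_interval f).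
Proof.
intros Hf; destruct (smooth_unit_tower f Hf) as (u & Tu & Eu).
apply (smooth_on_tower _ _ _ perfect_unit (tower_shift _ _ 3 Tu)).
intros x Hx; unfold S_op; rewrite Eu by exact Hx; reflexivity.
Qed.

Lemma S_unit_linear_operator : linear_operator Phi_FI smooth_unit_space (S_op unit_interval).
Proof.
split; [intros f Hf; apply S_unit_smooth, Hf |].
intros a b f g (Hf & F0 & F1 & F2) (Hg & G0 & G1 & G2).
destruct (unit_linear f g a b Hf Hg) as [Hs HD].
split; [split; [exact Hs |] |].
- rewrite F0, F1, G0, G1; split; [ring | split; [ring |]].
  rewrite (HD 1%nat 1 unit_1 : Derive_on unit_interval _ 1 = _).
  change (Derive_on_n unit_interval 1 f 1) with (Derive_on unit_interval f 1).
  change (Derive_on_n unit_interval 1 g 1) with (Derive_on unit_interval g 1).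
  rewrite F2, G2; ring.
- intros x Hx; unfold S_op; rewrite HD by exact Hx; ring.
Qed.

Definition FI_rem (z : C) (f : R -> C) : C :=
  if excluded_middle_informative (on_contour Gamma_FI_plus z)
  then (RtoC (/ (2 * PI)) * (z * Derive_on_n unit_interval 1 f 0 - Ci * Derive_on_n unit_interval 2 f 0))%C
  else (RtoC (/ (2 * PI)) * (- Ci * em z 1 * Derive_on_n unit_interval 2 f 1))%C.

Lemma inv_2PI_bounds : 0 <= / (2 * PI) <= 1.
Proof.
assert (H := PI2_3_2); split; [left; apply Rinv_0_lt_compat; lra |].
rewrite <- Rinv_1; apply Rinv_le_contravar; lra.
Qed.

Lemma Cmod_inv_2PI w B : Cmod w <= B -> Cmod (RtoC (/ (2 * PI)) * w) <= B.
Proof.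
intros H; assert (K := inv_2PI_bounds).
rewrite Cmod_mult, Cmod_R, Rabs_pos_eq by lra; assert (0 <= Cmod w) by apply Cmod_ge_0; nra.
Qed.

Lemma dual_FI_rem z : dual smooth_unit_space (FI_rem z).
Proof.
split.
- intros a b f g Hf Hg; simpl in Hf, Hg; destruct (unit_linear f g a b Hf Hg) as [_ HD]; unfold FI_rem.
  rewrite !HD by (apply unit_0 || apply unit_1).
  destruct (excluded_middle_informative _); ring.
- exists 2%nat, (Cmod z + 1 + Cmod (em z 1)); intros f B _ HB; simpl in HB.
  assert (B1 := HB 1%nat 0 ltac:(lia) unit_0); assert (B2 := HB 2%nat 0 ltac:(lia) unit_0).
  assert (B3 := HB 2%nat 1 ltac:(lia) unit_1).
  assert (Z0 := Cmod_ge_0 z); assert (Z1 := Cmod_ge_0 (em z 1)).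
  assert (N1 := Cmod_ge_0 (Derive_on_n unit_interval 1 f 0)).
  assert (N2 := Cmod_ge_0 (Derive_on_n unit_interval 2 f 0)).
  assert (N3 := Cmod_ge_0 (Derive_on_n unit_interval 2 f 1)).
  unfold FI_rem; destruct (excluded_middle_informative _); apply Cmod_inv_2PI.
  + eapply Rle_trans; [apply Cmod_triangle |]; rewrite Cmod_opp, !Cmod_mult, Cmod_Ci; nra.
  + rewrite !Cmod_mult, Cmod_opp, Cmod_Ci; nra.
Qed.

Lemma hat1_linear (f g : R -> C) a b z :
  (forall x, unit_interval x -> continuous f x) -> (forall x, unit_interval x -> continuous g x) ->
  hat1 (fun x => a * f x + b * g x)%C z = (a * hat1 f z + b * hat1 g z)%C.
Proof.
intros Cf Cg; apply transform_unique.
assert (H := range_plus int_range_unit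
  (range_scal int_range_unit a (hat1_int f Cf z))
  (range_scal int_range_unit b (hat1_int g Cg z))).
revert H; apply (genC_ext int_range_unit); intros x _; cring.
Qed.

Lemma F_FI_cases z (f g : R -> C) : (forall x, unit_interval x -> continuous g x) ->
  (forall x, unit_interval x -> f x = g x) ->
  F_FI z f = if excluded_middle_informative (on_contour Gamma_FI_plus z) then FI_plus g z else FI_minus g z.
Proof.
intros Cg E; destruct (excluded_middle_informative _).
- apply F_FI_plus; assumption.
- apply F_FI_minus; assumption.
Qed.

Lemma dual_F_FI z : dual smooth_unit_space (F_FI z).
Proof.
assert (Tow : forall f, smooth_on unit_interval f -> exists g,
  (forall x, unit_interval x -> continuous g x) /\ forall x, unit_interval x -> f x = g x).
{ intros f Hf; destruct (smooth_unit_tower f Hf) as (u & Tu & Eu); exists (u 0%nat); split.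
  - intros x Hx; apply (tower_cont unit_interval); assumption.
  - intros x Hx; apply (Eu 0%nat x Hx). }
split.
- intros a b f g Hf Hg; destruct (Tow f Hf) as (u & Cu & Eu); destruct (Tow g Hg) as (v & Cv & Ev).
  assert (Cw : forall x, unit_interval x -> continuous (fun x => a * u x + b * v x)%C x).
  { intros x Hx; ccont; auto. }
  rewrite (F_FI_cases z f u Cu Eu), (F_FI_cases z g v Cv Ev).
  rewrite (F_FI_cases z (fun x => a * f x + b * g x)%C (fun x => a * u x + b * v x)%C Cw).
  2: { intros x Hx; rewrite Eu, Ev by exact Hx; reflexivity. }
  destruct (excluded_middle_informative _); unfold FI_plus, FI_minus;
    rewrite !hat1_linear by assumption; unfold Cdiv; ring.
- set (m := fun w : C => Rmax 1 (Cmod (em w 1))).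
  assert (M0 : forall w, 0 <= m w) by (intros w; eapply Rle_trans; [apply Rle_0_1 | apply Rmax_l]).
  exists 0%nat, (Cmod (1 / (RtoC (2 * PI) * Delta_FI z)) *
     (m z * Cmod (alpha * em (alpha * z) 1 + alpha ^ 2 * em (alpha ^ 2 * z) 1) +
      (m (alpha * z)%C + m (alpha ^ 2 * z)%C) * Cmod (em z 1))
    + Cmod (- em z 1 / (RtoC (2 * PI) * Delta_FI z)) * (m z + m (alpha * z)%C + m (alpha ^ 2 * z)%C)).
  intros f B Hf HB; destruct (Tow f Hf) as (u & Cu & Eu).
  rewrite (F_FI_cases z f u Cu Eu).
  assert (Hu : forall w, Cmod (hat1 u w) <= m w * B).
  { intros w; eapply Rle_trans; [apply hat1_bound, Cu |].
    apply Rmult_le_compat_l; [apply M0 |].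
    replace B with (RInt (fun _ => B) 0 1).
    - apply RInt_le; [lra | | apply (ex_RInt_const (V := R_NormedModule)) |].
      + apply (ex_RInt_continuous (V := R_CompleteNormedModule)).
        rewrite Rmin_left, Rmax_right by lra; intros x Hx; apply cont_Cmod, Cu, Hx.
      + intros x Hx; rewrite <- Eu by (unfold unit_interval; lra).
        apply (HB 0%nat x ltac:(lia)); unfold unit_interval; lra.
    - rewrite RInt_const; unfold scal; simpl; unfold mult; simpl; ring. }
  assert (B0 : 0 <= B).
  { eapply Rle_trans; [apply Cmod_ge_0 | apply (HB 0%nat 0 ltac:(lia) unit_0)]. }
  assert (H0 := Hu z); assert (H1 := Hu (alpha * z)%C); assert (H2 := Hu (alpha ^ 2 * z)%C).
  assert (N0 := M0 z); assert (N1 := M0 (alpha * z)%C); assert (N2 := M0 (alpha ^ 2 * z)%C).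
  assert (Q0 := Cmod_ge_0 (em z 1)).
  set (p := (1 / (RtoC (2 * PI) * Delta_FI z))%C) in *.
  set (q := (- em z 1 / (RtoC (2 * PI) * Delta_FI z))%C) in *.
  set (s := (alpha * em (alpha * z) 1 + alpha ^ 2 * em (alpha ^ 2 * z) 1)%C) in *.
  assert (Pp := Cmod_ge_0 p); assert (Pq := Cmod_ge_0 q); assert (Ps := Cmod_ge_0 s).
  assert (X1 : 0 <= Cmod p * (m z * Cmod s + (m (alpha * z)%C + m (alpha ^ 2 * z)%C) * Cmod (em z 1)) * B).
  { apply Rmult_le_pos; [apply Rmult_le_pos; [exact Pp |] | exact B0].
    apply Rplus_le_le_0_compat; apply Rmult_le_pos; lra. }
  assert (X2 : 0 <= Cmod q * (m z + m (alpha * z)%C + m (alpha ^ 2 * z)%C) * B).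
  { apply Rmult_le_pos; [apply Rmult_le_pos; lra | exact B0]. }
  destruct (excluded_middle_informative _).
  + apply Rle_trans with (Cmod p * (m z * Cmod s + (m (alpha * z)%C + m (alpha ^ 2 * z)%C) * Cmod (em z 1)) * B); [| lra].
    unfold FI_plus; fold p; fold s; rewrite Cmod_mult, Rmult_assoc; apply Rmult_le_compat_l; [exact Pp |].
    eapply Rle_trans; [apply Cmod_triangle |]; rewrite Cmod_opp, !Cmod_mult.
    assert (T : Cmod (alpha * hat1 u (alpha * z) + alpha ^ 2 * hat1 u (alpha ^ 2 * z))
      <= m (alpha * z)%C * B + m (alpha ^ 2 * z)%C * B).
    { eapply Rle_trans; [apply Cmod_triangle |]; rewrite !Cmod_mult, Cmod_alpha, Cmod_alpha2; lra. }
    rewrite Rmult_plus_distr_r; apply Rplus_le_compat; nra.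
  + apply Rle_trans with (Cmod q * (m z + m (alpha * z)%C + m (alpha ^ 2 * z)%C) * B); [| lra].
    unfold FI_minus; fold q; rewrite Cmod_mult, Rmult_assoc; apply Rmult_le_compat_l; [exact Pq |].
    eapply Rle_trans; [apply Cmod_triangle |].
    eapply Rle_trans; [apply Rplus_le_compat_r, Cmod_triangle |].
    rewrite (Cmod_mult alpha), (Cmod_mult (alpha ^ 2)), Cmod_alpha, Cmod_alpha2; lra.
Qed.

Lemma filterlim_at_point (f : R -> C) b : filterlim f (at_point b) (locally (f b)).
Proof. intros P HP; apply (locally_singleton _ _ HP). Qed.

(** In the combination of boundary terms, those with [f''(1)] cancel on
    [Gamma^+], and those with [f'(0)] and [f''(0)] on [Gamma^-]. The others
    combine, by [1 + alpha + alpha^2 = 0], to a multiple of [Delta], which the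
    denominator removes. *)
Lemma F_FI_eigen z phi : on_contour Gamma_FI z -> Phi_FI phi ->
  F_FI z (S_op unit_interval phi) = (cube z * F_FI z phi + FI_rem z phi)%C.
Proof.
intros Hz (Hs & P0 & P1 & P2).
destruct (on_FI_Delta z Hz) as [Nz ND].
destruct (smooth_unit_tower phi Hs) as (u & Tu & Eu).
assert (Cu : forall k x, unit_interval x -> continuous (u k) x).
{ intros k x Hx; apply (tower_cont unit_interval); assumption. }
assert (C3 : forall x, unit_interval x -> continuous (fun x => Ci * u 3%nat x)%C x).
{ intros x Hx; ccont; apply Cu, Hx. }
rewrite (F_FI_cases z phi (u 0%nat) (Cu 0%nat) (Eu 0%nat)).
rewrite (F_FI_cases z (S_op unit_interval phi) (fun x => Ci * u 3%nat x)%C C3).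
2: { intros x Hx; unfold S_op; rewrite Eu by exact Hx; reflexivity. }
assert (U0 : u 0%nat 0 = RtoC 0) by (rewrite <- (Eu 0%nat 0 unit_0); exact P0).
assert (U1 : u 0%nat 1 = RtoC 0) by (rewrite <- (Eu 0%nat 1 unit_1); exact P1).
assert (U2 : u 1%nat 1 = RtoC 0) by (rewrite <- (Eu 1%nat 1 unit_1); exact P2).
assert (T : forall mu, hat1 (fun x => Ci * u 3%nat x)%C mu =
  (mu ^ 3 * hat1 (u 0%nat) mu + (Ci * em mu 1 * u 2%nat 1 - Ci * u 2%nat 0 + mu * u 1%nat 0))%C).
{ intros mu.
  rewrite (transform_third int_range_unit u mu (boundary_term u mu 1)).
  - unfold boundary_term; rewrite U0, U1, U2, em_0; f_equal.
    transitivity (Ci * em mu 1 * u 2%nat 1 - Ci * u 2%nat 0 - (Ci * Ci) * mu * u 1%nat 0)%C; [ring |].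
    rewrite Ci_sq; ring.
  - exact Tu.
  - apply hat1_transformable, Cu.
  - apply hat1_transformable, C3.
  - apply filterlim_at_point. }
assert (TA : hat1 (fun x => Ci * u 3%nat x)%C (alpha * z)%C =
  (z ^ 3 * hat1 (u 0%nat) (alpha * z) + (Ci * em (alpha * z) 1 * u 2%nat 1 - Ci * u 2%nat 0 + alpha * z * u 1%nat 0))%C).
{ rewrite T, alpha_mul_cube; reflexivity. }
assert (TB : hat1 (fun x => Ci * u 3%nat x)%C (alpha ^ 2 * z)%C =
  (z ^ 3 * hat1 (u 0%nat) (alpha ^ 2 * z) + (Ci * em (alpha ^ 2 * z) 1 * u 2%nat 1 - Ci * u 2%nat 0 + alpha ^ 2 * z * u 1%nat 0))%C).
{ rewrite T, alpha2_mul_cube; reflexivity. }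
assert (I2 : RtoC (/ (2 * PI)) = (/ RtoC (2 * PI))%C) by (apply RtoC_inv; assert (H := PI_RGT_0); lra).
assert (N2 := RtoC_2PI_neq_0).
assert (S0 := alpha_sum).
assert (SA : (alpha * alpha - alpha ^ 2 = 0)%C) by (simpl; ring).
assert (SB : (alpha ^ 2 * alpha ^ 2 - alpha = 0)%C).
{ transitivity (alpha * (alpha ^ 3) - alpha)%C; [simpl; ring | rewrite alpha_cube; ring]. }
(* [b] stands for [alpha ^ 2]; its three relations to [alpha] enter below as
   factors that are then rewritten to zero *)
unfold FI_rem, cube, FI_plus, FI_minus; rewrite I2.
rewrite TA, TB, (T z), !(Eu _ _ unit_0), !(Eu _ _ unit_1).
set (D := Delta_FI z) in *.
assert (ED : D = (em z 1 + alpha * em (alpha * z) 1 + alpha ^ 2 * em (alpha ^ 2 * z) 1)%C) by reflexivity.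
set (e0 := em z 1) in *; set (e1 := em (alpha * z) 1) in *; set (e2 := em (alpha ^ 2 * z) 1) in *.
set (t0 := hat1 (u 0%nat) z); set (t1 := hat1 (u 0%nat) (alpha * z)); set (t2 := hat1 (u 0%nat) (alpha ^ 2 * z)).
set (b := (alpha ^ 2)%C) in *; clearbody b.
destruct (excluded_middle_informative _).
- transitivity (z ^ 3 * (1 / (RtoC (2 * PI) * D) * (t0 * (alpha * e1 + b * e2) - (alpha * t1 + b * t2) * e0))
    + 1 / (RtoC (2 * PI) * D) * (D * (z * u 1%nat 0 - Ci * u 2%nat 0)
      + (1 + alpha + b) * (Ci * u 2%nat 0 * e0 - z * u 1%nat 0 * e0)
      - ((alpha * alpha - b) + (b * b - alpha)) * (z * u 1%nat 0 * e0)))%C.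
  + unfold Cdiv; rewrite ED at 4; ring.
  + rewrite S0, SA, SB; field; auto.
- transitivity (z ^ 3 * (- e0 / (RtoC (2 * PI) * D) * (t0 + alpha * t1 + b * t2))
    - e0 / (RtoC (2 * PI) * D) * (Ci * D * u 2%nat 1
      + (1 + alpha + b) * (z * u 1%nat 0 - Ci * u 2%nat 0)
      + ((alpha * alpha - b) + (b * b - alpha)) * (z * u 1%nat 0)))%C.
  + unfold Cdiv; rewrite ED at 4; ring.
  + rewrite S0, SA, SB; field; auto.
Qed.

Lemma FI_contours gamma : In gamma Gamma_FI ->
  (exists a b, gamma = sector_path 1 a b /\ a < b /\ (six_rays a /\ six_rays b) /\
     (a = 0 /\ b = PI / 3 \/ a = 2 * PI / 3 /\ b = PI) /\ In gamma Gamma_FI_plus)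
  \/ (gamma = sector_path 1 (4 * PI / 3) (5 * PI / 3) /\ In gamma Gamma_FI_minus).
Proof.
assert (Hpi := PI_RGT_0).
intros [<- | [<- | [<- | []]]].
- left; exists 0, (PI / 3); split; [reflexivity | split; [lra | split; [apply six_FI1 |]]]; simpl; auto.
- left; exists (2 * PI / 3), PI; split; [reflexivity | split; [lra | split; [apply six_FI2 |]]]; simpl; auto.
- right; simpl; auto.
Qed.

(** On [Gamma^-] the exponentials [e^{i lambda x}] and [e^{-i lambda}] combine to
    one with the negative exponent [x - 1], as the lower half-plane requires. *)
Lemma FI_rem_0 phi x gamma : 0 < x < 1 -> In gamma Gamma_FI ->
  path_int gamma (fun z => Cexp (Ci * z * RtoC x) / cube z * FI_rem z phi)%C (RtoC 0).
Proof.
assert (Hpi := PI_RGT_0).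
intros Hx Hg; destruct (FI_contours gamma Hg) as [(a & b & -> & Hab & _ & Hcase & Hin) | [-> Hin]].
- apply (path_int_ext _ (fun z => Cexp (Ci * z * RtoC x) / z ^ 3 *
    (- (RtoC (/ (2 * PI)) * Ci * Derive_on_n unit_interval 2 phi 0)
     + (RtoC (/ (2 * PI)) * Derive_on_n unit_interval 1 phi 0) * z))%C).
  { intros t; unfold FI_rem, cube.
    destruct (excluded_middle_informative (on_contour Gamma_FI_plus (sector_path 1 a b t))) as [_ | N].
    - unfold Cdiv; ring.
    - exfalso; apply N; exists (sector_path 1 a b), t; auto. }
  apply path_int_exp_0; [lra | exact Hab |].
  intros th Hth; assert (0 <= sin th) by (apply sin_ge_0; lra); nra.
- apply (path_int_ext _ (fun z => Cexp (Ci * z * RtoC (x - 1)) / z ^ 3 *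
    (- (RtoC (/ (2 * PI)) * Ci * Derive_on_n unit_interval 2 phi 1) + 0 * z))%C).
  { intros t; unfold FI_rem, cube.
    destruct (excluded_middle_informative
      (on_contour Gamma_FI_plus (sector_path 1 (4 * PI / 3) (5 * PI / 3) t))) as [N | _].
    - exfalso; revert N; apply FI_minus_not_plus; eexists; exists t; split; [exact Hin | reflexivity].
    - set (z := sector_path 1 (4 * PI / 3) (5 * PI / 3) t).
      replace (Cexp (Ci * z * RtoC (x - 1))) with (Cexp (Ci * z * RtoC x) * em z 1)%C.
      + unfold Cdiv; ring.
      + unfold em; rewrite <- Cexp_add; f_equal; rewrite RtoC_minus; ring. }
  apply path_int_exp_0; [lra | lra |].
  intros th Hth; assert (sin th < 0) by (apply sin_lt_0; lra); nra.
Qed.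

Lemma FI_integral_ex phi x gamma : Phi_FI phi -> 0 < x < 1 -> In gamma Gamma_FI -> exists v,
  path_int gamma (fun z => Cexp (Ci * z * RtoC x) * (1 / cube z) * F_FI z (S_op unit_interval phi))%C v.
Proof.
intros (Hs & _) Hx Hg.
destruct (smooth_unit_tower _ (S_unit_smooth phi Hs)) as (u & Tu & Eu).
assert (Cu : forall x, unit_interval x -> continuous (u 0%nat) x).
{ intros y Hy; apply (tower_cont unit_interval); assumption. }
destruct (FI_contours gamma Hg) as [(a & b & -> & Hab & H6 & Hcase & Hin) | [-> Hin]].
- destruct (FI_integrand_plus_ex (u 0%nat) Cu a b x Hab H6 Hcase Hx) as [v Hv]; exists v.
  revert Hv; apply path_int_ext; intros t.
  rewrite (F_FI_plus (u 0%nat) Cu _ _ (Eu 0%nat)); [reflexivity |].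
  eexists; exists t; split; [exact Hin | reflexivity].
- destruct (FI_integrand_minus_ex (u 0%nat) Cu x Hx) as [v Hv]; exists v.
  revert Hv; apply path_int_ext; intros t.
  rewrite (F_FI_minus (u 0%nat) Cu _ _ (Eu 0%nat)); [reflexivity |].
  apply FI_minus_not_plus; eexists; exists t; split; [exact Hin | reflexivity].
Qed.

(** * Completeness on the finite interval *)

Definition omega_FI : C := polar 1 (4 * PI / 3).

(** The [n]-th derivative with respect to [r] of [Delta (omega r x) g(x)]. *)
Definition FI_moment (g : R -> C) (n : nat) (r x : R) : C :=
  (((- Ci * omega_FI * RtoC x) ^ n * em (omega_FI * RtoC r) x
    + alpha * ((- Ci * (alpha * omega_FI) * RtoC x) ^ n * em (alpha * omega_FI * RtoC r) x)
    + alpha ^ 2 * ((- Ci * (alpha ^ 2 * omega_FI) * RtoC x) ^ n * em (alpha ^ 2 * omega_FI * RtoC r) x)) * g x)%C.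

Lemma Cmod_omega : Cmod omega_FI = 1.
Proof. apply Cmod_polar; lra. Qed.

Lemma FI_moment_cont g n r x : continuous g x -> continuous (FI_moment g n r) x.
Proof.
intros Cg; unfold FI_moment, em; ccont; exact Cg.
Qed.

Lemma FI_minus_0 g z : on_contour Gamma_FI_minus z -> FI_minus g z = RtoC 0 ->
  (hat1 g z + alpha * hat1 g (alpha * z) + alpha ^ 2 * hat1 g (alpha ^ 2 * z))%C = RtoC 0.
Proof.
intros Hz H.
destruct (on_FI_Delta z) as [Nz ND].
{ destruct Hz as (gam & t & Hg & E); exists gam, t; split; [apply in_or_app; right; exact Hg | exact E]. }
assert (Ne : em z 1 <> RtoC 0) by apply Cexp_neq_0.
assert (N2 := RtoC_2PI_neq_0).
unfold FI_minus in H.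
set (s := (hat1 g z + alpha * hat1 g (alpha * z) + alpha ^ 2 * hat1 g (alpha ^ 2 * z))%C) in *.
transitivity (- (RtoC (2 * PI) * Delta_FI z / em z 1) * (- em z 1 / (RtoC (2 * PI) * Delta_FI z) * s))%C.
- field; auto.
- rewrite H; ring.
Qed.

(** On the ray of [Gamma^-] through [omega_FI] the functional is, up to a
    nonzero factor, the integral of [Delta (omega r x) g(x)]; it is
    differentiated [n] times with respect to [r]. *)
Lemma FI_moments_0 g : (forall x, unit_interval x -> continuous g x) ->
  (forall r, 1 <= r -> FI_minus g (polar r (4 * PI / 3)) = RtoC 0) ->
  forall n r, 1 <= r -> genC (FI_moment g n r) (at_point 0) (at_point 1) (RtoC 0).
Proof.
intros Cg H0; induction n as [| n IH]; intros r Hr.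
- assert (Hpi := PI_RGT_0).
  set (z := polar r (4 * PI / 3)).
  assert (Ez : z = (omega_FI * RtoC r)%C) by (unfold z, omega_FI; rewrite polar_scal; ring).
  assert (Hz : on_contour Gamma_FI_minus z).
  { exists (sector_path 1 (4 * PI / 3) (5 * PI / 3)), r; split; [left; reflexivity |].
    apply sector_path_r; lra. }
  assert (HS := FI_minus_0 g z Hz (H0 r Hr)).
  rewrite <- HS.
  assert (K := range_plus int_range_unit
   (range_plus int_range_unit (hat1_int g Cg z)
      (range_scal int_range_unit alpha (hat1_int g Cg (alpha * z)%C)))
   (range_scal int_range_unit (alpha ^ 2)%C (hat1_int g Cg (alpha ^ 2 * z)%C))).
  revert K; apply (genC_ext int_range_unit); intros x _.
  unfold FI_moment.
  replace (alpha * omega_FI * RtoC r)%C with (alpha * z)%C by (rewrite Ez; ring).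
  replace (alpha ^ 2 * omega_FI * RtoC r)%C with (alpha ^ 2 * z)%C by (rewrite Ez; ring).
  rewrite <- Ez; simpl; cring.
- apply (gen_derive_0 int_range_unit (fun h => FI_moment g n (r + h)) (FI_moment g (S n) r)
    (fun x => 3 * exp (r + 1) * Cmod (g x)) (RInt (fun x => 3 * exp (r + 1) * Cmod (g x)) 0 1) 1 Rlt_0_1).
  + intros h Hh; apply IH; lra.
  + intros h _ x Hx; apply FI_moment_cont, Cg, Hx.
  + intros x Hx; apply FI_moment_cont, Cg, Hx.
  + intros x Hx; apply cont_Rmult; [apply continuous_const | apply cont_Cmod, Cg, Hx].
  + apply unit_integral; intros x Hx; apply cont_Rmult; [apply continuous_const | apply cont_Cmod, Cg, Hx].
  + intros h x Hh [X0 X1]; rewrite Rplus_0_r.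
    assert (Term : forall nu, Cmod nu = 1 ->
      Cmod ((- Ci * nu * RtoC x) ^ n * em (nu * RtoC (r + h)) x - (- Ci * nu * RtoC x) ^ n * em (nu * RtoC r) x
      - RtoC h * ((- Ci * nu * RtoC x) ^ S n * em (nu * RtoC r) x)) <= h ^ 2 * exp (r + 1)).
    { intros nu Hnu; eapply Rle_trans; [apply em_taylor_2; lra |]; rewrite Hnu, Rmult_1_l.
      apply Rmult_le_compat_l; [nra |].
      rewrite <- (Rmult_1_l (exp (r + 1))); apply Rmult_le_compat; [apply pow_le, X0 | left; apply exp_pos | |].
      - rewrite <- (pow1 (n + 2)); apply pow_incr; lra.
      - apply exp_le_mono.
        assert (B := Im_le_Cmod nu); rewrite Hnu in B.
        assert (Im nu * r <= r) by nra.
        assert (Im nu * r * x <= r) by nra.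
        assert (1 * h * x <= 1) by nra. lra. }
    assert (T0 := Term omega_FI Cmod_omega).
    assert (T1 := Term (alpha * omega_FI)%C ltac:(rewrite Cmod_mult, Cmod_alpha, Cmod_omega; ring)).
    assert (T2 := Term (alpha ^ 2 * omega_FI)%C ltac:(rewrite Cmod_mult, Cmod_alpha2, Cmod_omega; ring)).
    match type of T0 with Cmod ?a <= _ => set (a0 := a) in * end.
    match type of T1 with Cmod ?a <= _ => set (a1 := a) in * end.
    match type of T2 with Cmod ?a <= _ => set (a2 := a) in * end.
    replace (FI_moment g n (r + h) x - FI_moment g n r x - RtoC h * FI_moment g (S n) r x)%C
      with ((a0 + alpha * a1 + alpha ^ 2 * a2) * g x)%C by (unfold FI_moment, a0, a1, a2; ring).
    rewrite Cmod_mult.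
    replace (h ^ 2 * (3 * exp (r + 1) * Cmod (g x))) with (3 * (h ^ 2 * exp (r + 1)) * Cmod (g x)) by ring.
    apply Rmult_le_compat_r; [apply Cmod_ge_0 |].
    eapply Rle_trans; [apply Cmod_triangle |].
    eapply Rle_trans; [apply Rplus_le_compat_r, Cmod_triangle |].
    rewrite (Cmod_mult alpha), (Cmod_mult (alpha ^ 2)), Cmod_alpha, Cmod_alpha2; lra.
Qed.

Lemma cube_separates x0 eta : 0 <= x0 -> 0 < eta -> exists d, 0 < d /\
  forall x, unit_interval x -> eta <= Rabs (x - x0) -> d <= Rabs (x ^ 3 - x0 ^ 3).
Proof.
intros H0 He; exists (eta ^ 3 / 4); split.
{ apply Rdiv_lt_0_compat; [apply pow_lt, He | lra]. }
intros x [Hx _] H.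
replace (x ^ 3 - x0 ^ 3) with ((x - x0) * (x ^ 2 + x * x0 + x0 ^ 2)) by ring.
rewrite Rabs_mult, (Rabs_pos_eq (x ^ 2 + x * x0 + x0 ^ 2)) by nra.
set (a := Rabs (x - x0)) in *.
assert (A2 : a ^ 2 = (x - x0) ^ 2) by apply pow2_abs.
assert (L : a ^ 2 / 4 <= x ^ 2 + x * x0 + x0 ^ 2) by (rewrite A2; nra).
assert (a ^ 3 >= eta ^ 3) by (apply Rle_ge, pow_incr; lra).
apply Rle_trans with (a * (a ^ 2 / 4)).
- replace (a * (a ^ 2 / 4)) with (a ^ 3 / 4) by field; lra.
- apply Rmult_le_compat_l; lra.
Qed.

(** At [r = 1] the derivatives of order [3 k] are, up to a constant factor,
    the moments of [Delta (omega x) g(x)] with respect to the powers of [x^3]. *)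
Lemma complete_FI : complete_system smooth_unit_space Phi_FI Gamma_FI F_FI.
Proof.
intros f (Hs & P0 & P1 & _) HF x Hx; simpl in Hx.
destruct (smooth_unit_tower f Hs) as (u & Tu & Eu).
assert (Cu : forall x, unit_interval x -> continuous (u 0%nat) x).
{ intros y Hy; apply (tower_cont unit_interval); assumption. }
assert (E0 : forall x, unit_interval x -> f x = u 0%nat x) by (intros; apply (Eu 0%nat); assumption).
assert (Hpi := PI_RGT_0).
assert (H0 : forall r, 1 <= r -> FI_minus (u 0%nat) (polar r (4 * PI / 3)) = RtoC 0).
{ intros r Hr.
  assert (Hz : on_contour Gamma_FI_minus (polar r (4 * PI / 3))).
  { exists (sector_path 1 (4 * PI / 3) (5 * PI / 3)), r; split; [left; reflexivity |].
    apply sector_path_r; lra. }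
  rewrite <- (F_FI_minus (u 0%nat) Cu f _ E0).
  - apply HF; destruct Hz as (gam & t & Hg & E); exists gam, t; split; [apply in_or_app; right; exact Hg | exact E].
  - apply FI_minus_not_plus, Hz. }
assert (M := FI_moments_0 (u 0%nat) Cu H0).
destruct (Req_dec x 0) as [-> | N0]; [exact P0 |].
destruct (Req_dec x 1) as [-> | N1]; [exact P1 |].
set (H := fun y => (Delta_FI (omega_FI * RtoC y) * u 0%nat y)%C).
assert (EM : forall y, FI_moment (u 0%nat) 0 1 y = H y).
{ intros y; unfold FI_moment, H, Delta_FI, em; simpl.
  replace (- Ci * (omega_FI * 1) * RtoC y)%C with (- Ci * (omega_FI * RtoC y) * 1)%C by ring.
  replace (- Ci * (alpha * omega_FI * 1) * RtoC y)%C with (- Ci * (alpha * (omega_FI * RtoC y)) * 1)%C by ring.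
  replace (- Ci * (alpha * (alpha * 1) * omega_FI * 1) * RtoC y)%C
    with (- Ci * (alpha * (alpha * 1) * (omega_FI * RtoC y)) * 1)%C by ring.
  ring. }
assert (CH : forall y, unit_interval y -> continuous H y).
{ intros y Hy; apply (continuous_ext (FI_moment (u 0%nat) 0 1)); [exact EM |].
  apply FI_moment_cont, Cu, Hy. }
assert (HM : forall k, genC (fun y => RtoC ((y ^ 3) ^ k) * H y)%C (at_point 0) (at_point 1) (RtoC 0)).
{ intros k.
  set (c := ((- Ci * omega_FI) ^ (3 * k))%C).
  assert (Nc : c <> RtoC 0).
  { apply Cpow_nz; apply Cmult_neq_0; [| apply polar_neq_0; lra].
    intros E; apply (f_equal Cmod) in E; rewrite Cmod_opp, Cmod_Ci, Cmod_0 in E; lra. }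
  assert (K := range_scal int_range_unit (/ c)%C (M (3 * k)%nat 1 (Rle_refl 1))).
  replace (/ c * 0)%C with (RtoC 0) in K by ring.
  revert K; apply (genC_ext int_range_unit); intros y _.
  rewrite <- EM.
  assert (Pw : forall a : C, (a ^ 3 = 1)%C -> ((- Ci * (a * omega_FI) * RtoC y) ^ (3 * k))%C = (c * RtoC ((y ^ 3) ^ k))%C).
  { intros a Ha; unfold c; rewrite !Cpow_mult_r, RtoC_pow.
    rewrite <- Cpow_mult_l; f_equal.
    rewrite RtoC_pow; transitivity (a ^ 3 * ((- Ci * omega_FI) ^ 3 * RtoC y ^ 3))%C; [simpl; ring | rewrite Ha; ring]. }
  assert (A2 : ((alpha ^ 2) ^ 3 = 1)%C).
  { transitivity (alpha ^ 3 * alpha ^ 3)%C; [simpl; ring | rewrite alpha_cube; ring]. }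
  unfold FI_moment; rewrite (Pw alpha alpha_cube), (Pw (alpha ^ 2)%C A2).
  replace (- Ci * omega_FI * RtoC y)%C with (- Ci * (1 * omega_FI) * RtoC y)%C by ring.
  rewrite (Pw (RtoC 1)) by (simpl; ring).
  as_eq_C; simpl; field; exact Nc. }
assert (Z : H x = RtoC 0).
{ unfold unit_interval in Hx.
  apply (landau int_range_unit (fun y => y ^ 3) H (fun y => Cmod (H y)) (RInt (fun y => Cmod (H y)) 0 1) x 1); try assumption.
  - lra.
  - unfold at_point; lra.
  - intros y _; apply ex_derive_continuous_R; auto_derive; easy.
  - intros y Hy; apply cont_Cmod, CH, Hy.
  - intros y [Hy0 Hy1]; split; [apply pow_le, Hy0 | rewrite <- (pow1 3); apply pow_incr; lra].
  - intros eta He; apply cube_separates; [lra | exact He].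
  - intros; apply Rle_refl.
  - apply unit_integral; intros y Hy; apply cont_Cmod, CH, Hy. }
rewrite E0 by exact Hx.
assert (ND : Delta_FI (omega_FI * RtoC x) <> RtoC 0).
{ apply Delta_neq_0_small; unfold unit_interval in Hx.
  rewrite Cmod_mult, Cmod_omega, Cmod_R, Rabs_pos_eq; lra. }
unfold H in Z; destruct (Ceq_dec (u 0%nat x) (RtoC 0)) as [E | E]; [exact E |].
exfalso; revert Z; apply Cmult_neq_0; assumption.
Qed.

Lemma diagonalised_FI :
  (forall lambda : C, on_contour Gamma_FI lambda -> Delta_FI lambda <> RtoC 0) /\
  diagonalised_by I_FI smooth_unit_space (fun _ => smooth_unit_space)
    Phi_FI (S_op unit_interval) Gamma_FI F_FI cube.
Proof.
split; [intros z Hz; apply (on_FI_Delta z Hz) |].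
apply diagonalised_by_intro with FI_rem.
- intros phi H; apply H.
- apply S_unit_linear_operator.
- intros z Hz; split; [auto | split; [| apply dual_F_FI]].
  intros phi Hphi; split; [apply Hphi | apply S_unit_smooth, Hphi].
- intros z _; apply dual_FI_rem.
- intros z phi Hz Hphi; apply F_FI_eigen; assumption.
- intros z Hz; apply Cpow_nz, (on_FI_Delta z Hz).
- intros phi x gamma _ Hx Hg; apply FI_rem_0; assumption.
- intros phi x gamma Hphi Hx Hg; apply FI_integral_ex; assumption.
- apply complete_FI.
Qed.

(** * The half-line *)

Notation hat := (transform (Rbar_locally p_infty)).

Lemma int_range_half : int_range 0 half_line (Rbar_locally p_infty).
Proof. exact (int_range_ray 0). Qed.

Lemma half_0 : half_line 0. Proof. unfold half_line; lra. Qed.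

Lemma cont_exp_decay K kappa (x : R) : continuous (fun x => K * exp (- kappa * x)) x.
Proof. apply ex_derive_continuous_R; auto_derive; easy. Qed.

Lemma gen_exp_decay_scal K kappa : 0 < kappa ->
  is_RInt_gen (fun x => K * exp (- kappa * x)) (at_point 0) (Rbar_locally p_infty) (K * / kappa).
Proof. intros H; apply gen_scal_R, gen_exp_decay, H. Qed.

Lemma cont_inv_sq M (x : R) : half_line x -> continuous (fun x => M * / (x + 1) ^ 2) x.
Proof.
unfold half_line; intros H; apply ex_derive_continuous_R; auto_derive.
assert (0 < (x + 1) * ((x + 1) * 1)) by nra; lra.
Qed.

Lemma gen_inv_sq_half M :
  is_RInt_gen (fun x => M * / (x + 1) ^ 2) (at_point 0) (Rbar_locally p_infty) M.
Proof.
evar_last; [apply gen_scal_R, gen_inv_sq; lra | field].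
Qed.

Lemma le_inv_sq (x a M : R) : 0 <= x -> (1 + x) ^ 2 * a <= M -> a <= M * / (x + 1) ^ 2.
Proof.
intros Hx H; assert (P : 0 < (x + 1) ^ 2) by (apply pow_lt; lra).
apply Rmult_le_reg_l with ((x + 1) ^ 2); [exact P |].
replace ((x + 1) ^ 2 * (M * / (x + 1) ^ 2)) with M by (field; lra).
replace ((x + 1) ^ 2) with ((1 + x) ^ 2) by ring; exact H.
Qed.

Lemma pow_exp_decay n eta : 0 < eta -> exists K, 0 <= K /\
  forall x, 0 <= x -> x ^ n * exp (- eta * x) <= K * exp (- (eta / 2) * x).
Proof.
intros He; destruct (pow_le_exp n (eta / 2)) as (K & HK & H); [lra |].
exists K; split; [exact HK |]; intros x Hx.
replace (exp (- (eta / 2) * x)) with (exp (eta / 2 * x) * exp (- eta * x)) by (rewrite <- exp_plus; f_equal; field).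
rewrite <- Rmult_assoc; apply Rmult_le_compat_r; [left; apply exp_pos | apply H, Hx].
Qed.

Lemma rate_transformable g eta mu : (forall x, half_line x -> continuous g x) -> rate g eta -> Im mu < eta ->
  transformable half_line (Rbar_locally p_infty) g mu.
Proof.
intros Cg (K & HK & HR) Hmu; split; [exact Cg |].
set (h := (eta - Im mu) / 2).
assert (Hh : 0 < h) by (unfold h; lra).
destruct (pow_exp_decay 1 h Hh) as (P & HP & HE).
exists h, (K * (P + 1) * / (h / 2)), (fun x => K * (P + 1) * exp (- (h / 2) * x)).
split; [exact Hh | split; [intros; apply cont_exp_decay | split; [apply gen_exp_decay_scal; lra |]]].
intros x Hx; specialize (HR x Hx); specialize (HE x Hx); rewrite pow_1 in HE; unfold half_line in Hx.
assert (E1 : exp (- h * x) <= exp (- (h / 2) * x)) by (apply exp_le_mono; nra).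
assert (E2 := exp_pos ((Im mu + h) * x)).
apply Rle_trans with ((1 + x) * exp ((Im mu + h) * x) * (K * exp (- eta * x))).
{ apply Rmult_le_compat_l; [nra | exact HR]. }
replace ((1 + x) * exp ((Im mu + h) * x) * (K * exp (- eta * x)))
  with (K * ((1 + x) * (exp ((Im mu + h) * x) * exp (- eta * x)))) by ring.
rewrite <- exp_plus.
replace ((Im mu + h) * x + - eta * x) with (- h * x) by (unfold h; field).
rewrite Rmult_assoc; apply Rmult_le_compat_l; [exact HK | lra].
Qed.

Lemma rate_scal c g eta : rate g eta -> rate (fun x => c * g x)%C eta.
Proof.
intros (K & HK & H); exists (Cmod c * K); split; [apply Rmult_le_pos; [apply Cmod_ge_0 | exact HK] |].
intros x Hx; rewrite Cmod_mult, Rmult_assoc; apply Rmult_le_compat_l; [apply Cmod_ge_0 | apply H, Hx].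
Qed.

Lemma hat_bound g eta : 0 < eta -> (forall x, half_line x -> continuous g x) -> rate g eta ->
  exists K, 0 <= K /\ forall mu, Im mu <= 0 -> Cmod (hat g mu) <= K.
Proof.
intros He Cg (K & HK & HR); exists (K * / eta); split.
{ apply Rmult_le_pos; [exact HK | left; apply Rinv_0_lt_compat, He]. }
intros mu Hmu.
apply (transform_dominated int_range_half g mu (fun x => K * exp (- eta * x))); try assumption.
- intros; apply cont_exp_decay.
- intros x Hx; eapply Rle_trans; [| apply HR, Hx].
  rewrite Cmod_mult, Cmod_em; assert (P := Cmod_ge_0 (g x)).
  assert (exp (Im mu * x) <= 1); [| nra].
  rewrite <- exp_0; apply exp_le_mono; unfold half_line in Hx; nra.
- apply gen_exp_decay_scal, He.
Qed.

Lemma boundary_term_vanishes u eta mu : (forall k, rate (u k) eta) -> Im mu < eta ->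
  filterlim (boundary_term u mu) (Rbar_locally p_infty) (locally (RtoC 0)).
Proof.
intros HR Hmu.
destruct (HR 0%nat) as (K0 & HK0 & R0); destruct (HR 1%nat) as (K1 & HK1 & R1); destruct (HR 2%nat) as (K2 & HK2 & R2).
set (M := K2 + Cmod mu * K1 + Cmod mu ^ 2 * K0).
assert (M0 := Cmod_ge_0 mu).
assert (HM : 0 <= M).
{ unfold M; assert (0 <= Cmod mu * K1) by nra.
  assert (0 <= Cmod mu ^ 2 * K0) by (apply Rmult_le_pos; [apply pow_le |]; assumption). lra. }
apply filterlim_Cmod; [apply Rbar_locally_filter |]; intros e He.
set (kap := eta - Im mu).
assert (Hk : 0 < kap) by (unfold kap; lra).
exists (Rmax 0 ((M + 1) / (kap * e))); intros x Hx.
assert (B1 := Rmax_l 0 ((M + 1) / (kap * e))); assert (B2 := Rmax_r 0 ((M + 1) / (kap * e))).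
assert (X0 : 0 <= x) by lra.
specialize (R0 x X0); specialize (R1 x X0); specialize (R2 x X0).
replace (boundary_term u mu x - 0)%C with (boundary_term u mu x) by ring.
unfold boundary_term; rewrite !Cmod_mult, Cmod_Ci, Rmult_1_l, Cmod_em.
set (E := exp (- eta * x)) in *.
assert (T : Cmod (u 2%nat x + Ci * mu * u 1%nat x - mu ^ 2 * u 0%nat x) <= M * E).
{ eapply Rle_trans; [apply Cmod_triangle |]; rewrite Cmod_opp.
  eapply Rle_trans; [apply Rplus_le_compat_r, Cmod_triangle |].
  rewrite !Cmod_mult, Cmod_Ci, Cmod_pow, Rmult_1_l.
  replace (M * E) with (K2 * E + Cmod mu * (K1 * E) + Cmod mu ^ 2 * (K0 * E)) by (unfold M; ring).
  apply Rplus_le_compat; [apply Rplus_le_compat; [exact R2 |] |]; apply Rmult_le_compat_l; try assumption.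
  apply pow_le, M0. }
apply Rle_lt_trans with (exp (Im mu * x) * (M * E)).
{ apply Rmult_le_compat_l; [left; apply exp_pos | exact T]. }
replace (exp (Im mu * x) * (M * E)) with (M * exp (- (kap * x))).
2: { unfold E; transitivity (M * (exp (Im mu * x) * exp (- eta * x))); [| ring].
     rewrite <- exp_plus; do 2 f_equal; unfold kap; ring. }
assert (L : (M + 1) / (kap * e) < x) by lra.
apply Rlt_div_l in L; [| nra].
rewrite exp_Ropp; assert (X := exp_ineq1_le (kap * x)).
assert (kx : 0 < kap * x).
{ apply Rmult_lt_reg_r with e; [exact He |]; nra. }
apply Rlt_div_l; [lra |]; nra.
Qed.

(** As on the interval, formulas for [F_lambda] that do not depend on whether
    [z] is on the contour. *)
Definition HL_plus (g : R -> C) (z : C) : C :=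
  (1 / RtoC (2 * PI) * (alpha * hat g (alpha * z) + alpha ^ 2 * hat g (alpha ^ 2 * z)))%C.

Definition HL_minus (g : R -> C) (z : C) : C := (1 / RtoC (2 * PI) * hat g z)%C.

Lemma HL_plus_Im r th : sector_edge 1 (PI / 3) (2 * PI / 3) r th ->
  1 <= r /\ 0 < Im (polar r th) /\ Im (alpha * polar r th) <= 0 /\ Im (alpha ^ 2 * polar r th) <= 0.
Proof.
assert (Hpi := PI_RGT_0).
intros He.
assert (Hr : 1 <= r /\ PI / 3 <= th <= 2 * PI / 3).
{ destruct He as [[Hr [-> | ->]] | [-> Hth]]; lra. }
destruct Hr as [Hr Hth]; rewrite alpha_mul_polar, alpha2_mul_polar; simpl.
assert (0 < sin th) by (apply sin_gt_0; lra).
assert (sin (th + 2 * PI / 3) <= 0) by (apply sin_le_0; lra).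
assert (sin (th + 4 * PI / 3) <= 0) by (apply sin_le_0; lra).
repeat split; [exact Hr | nra | nra | nra].
Qed.

Lemma on_HL_plus z : on_contour Gamma_HL_plus z ->
  exists r th, sector_edge 1 (PI / 3) (2 * PI / 3) r th /\ z = polar r th.
Proof.
assert (Hpi := PI_RGT_0).
intros (g & t & [<- | []] & <-).
destruct (sector_path_edge 1 (PI / 3) (2 * PI / 3) ltac:(lra) ltac:(lra) t) as (r & th & He & E).
exists r, th; split; [exact He | exact E].
Qed.

Lemma on_HL_plus_Im z : on_contour Gamma_HL_plus z ->
  0 < Im z /\ Im (alpha * z) <= 0 /\ Im (alpha ^ 2 * z) <= 0 /\ 1 <= Cmod z.
Proof.
intros H; destruct (on_HL_plus z H) as (r & th & He & ->); apply HL_plus_Im in He.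
rewrite Cmod_polar by lra; tauto.
Qed.

Lemma HL_minus_Im delta r th : 0 < delta -> sector_edge delta 0 PI r th ->
  delta <= r /\ 0 <= Im (polar r th) <= delta /\ (Im (polar r th) = 0 \/ r = delta).
Proof.
intros Hd [[Hr [-> | ->]] | [-> Hth]]; simpl.
- rewrite sin_0; lra.
- rewrite sin_PI; lra.
- assert (0 <= sin th) by (apply sin_ge_0; lra); assert (H1 := SIN_bound th).
  repeat split; try lra; nra.
Qed.

Lemma on_HL_minus delta z : 0 < delta -> delta < 1 -> on_contour (Gamma_HL_minus delta) z ->
  0 <= Im z <= delta /\ delta <= Cmod z /\ ~ on_contour Gamma_HL_plus z.
Proof.
intros Hd Hd1 (g & t & [<- | []] & <-).
assert (Hpi := PI_RGT_0).
destruct (sector_path_edge delta 0 PI Hd Hpi t) as (r & th & He & ->).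
apply HL_minus_Im in He; [| exact Hd]; destruct He as (Hr & Him & Hc).
rewrite Cmod_polar by lra; split; [exact Him | split; [exact Hr |]].
intros Hp; apply on_HL_plus_Im in Hp; rewrite Cmod_polar in Hp by lra; lra.
Qed.

Lemma on_HL_cases delta z : on_contour (Gamma_HL delta) z ->
  on_contour Gamma_HL_plus z \/ on_contour (Gamma_HL_minus delta) z.
Proof.
intros (g & t & Hg & E); unfold Gamma_HL in Hg; apply in_app_or in Hg.
destruct Hg as [Hg | Hg]; [left | right]; exists g, t; auto.
Qed.

Lemma on_HL_neq_0 delta z : 0 < delta -> delta < 1 -> on_contour (Gamma_HL delta) z -> z <> RtoC 0.
Proof.
intros Hd Hd1 H E; apply on_HL_cases in H; destruct H as [H | H].
- apply on_HL_plus_Im in H; rewrite E, Cmod_0 in H; lra.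
- apply (on_HL_minus delta z Hd Hd1) in H; rewrite E, Cmod_0 in H; lra.
Qed.

(** A function whose modulus bounds the integrand of [F_HL z f], and which is in
    the Schwartz class when [f] is in [space_HL z]. *)
Definition HL_weighted (z : C) (f : R -> C) : R -> C :=
  if excluded_middle_informative (on_contour Gamma_HL_plus z) then f else exp_weight (Im z) f.

Lemma integrand_HL_bound z f x : 0 <= x -> Cmod (integrand_HL z f x) <= Cmod (HL_weighted z f x).
Proof.
intros Hx; unfold integrand_HL, HL_weighted.
assert (K := inv_2PI_bounds).
assert (E : (1 / RtoC (2 * PI))%C = RtoC (/ (2 * PI))).
{ rewrite RtoC_inv by (assert (H := PI_RGT_0); lra); unfold Cdiv; ring. }
assert (P2 : / (2 * PI) * 2 <= 1).
{ assert (H := PI2_3_2); replace (/ (2 * PI) * 2) with (/ PI) by (field; lra).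
  rewrite <- Rinv_1; apply Rinv_le_contravar; lra. }
destruct (excluded_middle_informative (on_contour Gamma_HL_plus z)) as [Hz | Hz].
- apply on_HL_plus_Im in Hz; destruct Hz as (_ & H1 & H2 & _).
  unfold phi_HL_plus; rewrite E, !Cmod_mult, Cmod_R, Rabs_pos_eq by lra.
  rewrite <- (Rmult_1_l (Cmod (f x))) at 2; apply Rmult_le_compat_r; [apply Cmod_ge_0 |].
  assert (L : forall w, Im w <= 0 -> Cmod (em w x) <= 1).
  { intros w Hw; rewrite Cmod_em, <- exp_0; apply exp_le_mono; nra. }
  assert (T : Cmod (alpha * em (alpha * z) x + alpha ^ 2 * em (alpha ^ 2 * z) x) <= 2).
  { eapply Rle_trans; [apply Cmod_triangle |]; rewrite !Cmod_mult, Cmod_alpha, Cmod_alpha2.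
    assert (Q1 := L _ H1); assert (Q2 := L _ H2); lra. }
  nra.
- unfold phi_HL_minus, exp_weight; rewrite E, !Cmod_mult, !Cmod_R, Cmod_em.
  rewrite (Rabs_pos_eq (/ (2 * PI))), (Rabs_pos_eq (exp _)) by (lra || left; apply exp_pos).
  apply Rmult_le_compat_r; [apply Cmod_ge_0 |].
  assert (Q := exp_pos (Im z * x)); nra.
Qed.

Lemma schwartz_half_ext f g : (forall x, half_line x -> f x = g x) -> schwartz_half f -> schwartz_half g.
Proof.
intros E (h & Hh & F); exists h; split; [exact Hh |]; intros x Hx; rewrite <- E by exact Hx; apply F, Hx.
Qed.

Lemma exp_weight_0 f x : exp_weight 0 f x = f x.
Proof. unfold exp_weight; rewrite Rmult_0_l, exp_0; ring. Qed.

Lemma space_HL_mem z f : mem (space_HL z) f -> schwartz_half f /\ schwartz_half (HL_weighted z f).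
Proof.
unfold space_HL, HL_weighted.
destruct (excluded_middle_informative (on_contour Gamma_HL_plus z \/ Im z = 0)) as [[H | H] | H]; simpl; intros Hf.
- destruct (excluded_middle_informative (on_contour Gamma_HL_plus z)); [auto | contradiction].
- split; [exact Hf |].
  destruct (excluded_middle_informative (on_contour Gamma_HL_plus z)); [exact Hf |].
  rewrite H; apply (schwartz_half_ext f); [intros; symmetry; apply exp_weight_0 | exact Hf].
- destruct (excluded_middle_informative (on_contour Gamma_HL_plus z)); [tauto | exact Hf].
Qed.

Lemma space_HL_semi z f B x : semi_le (space_HL z) 2 B f -> half_line x ->
  (1 + x) ^ 2 * Cmod (HL_weighted z f x) <= 4 * B.
Proof.
intros H Hx.
assert (Q : Cmod (HL_weighted z f x) <= B /\ x ^ 2 * Cmod (HL_weighted z f x) <= B).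
{ unfold space_HL, HL_weighted in *.
  destruct (excluded_middle_informative (on_contour Gamma_HL_plus z \/ Im z = 0)) as [[K | K] | K]; simpl in H.
  - destruct (excluded_middle_informative (on_contour Gamma_HL_plus z)); [| contradiction].
    assert (H0 := H 0%nat 0%nat x ltac:(lia) ltac:(lia) Hx); assert (H2 := H 2%nat 0%nat x ltac:(lia) ltac:(lia) Hx).
    simpl in *; lra.
  - assert (H0 := H 0%nat 0%nat x ltac:(lia) ltac:(lia) Hx); assert (H2 := H 2%nat 0%nat x ltac:(lia) ltac:(lia) Hx).
    rewrite K; destruct (excluded_middle_informative (on_contour Gamma_HL_plus z)); rewrite ?exp_weight_0; simpl in *; lra.
  - destruct (excluded_middle_informative (on_contour Gamma_HL_plus z)); [tauto |].
    assert (H0 := H 0%nat 0%nat x ltac:(lia) ltac:(lia) Hx); assert (H2 := H 2%nat 0%nat x ltac:(lia) ltac:(lia) Hx).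
    simpl in *; lra. }
unfold half_line in Hx; assert (P := Cmod_ge_0 (HL_weighted z f x)).
apply Rle_trans with ((2 + 2 * x ^ 2) * Cmod (HL_weighted z f x)); [apply Rmult_le_compat_r; [exact P | generalize (pow2_ge_0 (1 - x)); lra] | lra].
Qed.

Lemma schwartz_half_decay f : schwartz_half f -> exists M, forall x, half_line x -> (1 + x) ^ 2 * Cmod (f x) <= M.
Proof.
intros Hf; apply schwartz_half_tower in Hf; destruct Hf as (u & [_ Bu] & E).
destruct (Bu 0%nat 0%nat) as [M0 H0]; destruct (Bu 2%nat 0%nat) as [M2 H2].
exists (2 * M0 + 2 * M2); intros x Hx; rewrite E by exact Hx.
specialize (H0 x); specialize (H2 x); unfold half_line in Hx; rewrite pow2_abs in H2; rewrite pow_O in H0.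
assert (P := Cmod_ge_0 (u 0%nat x)).
apply Rle_trans with ((2 + 2 * x ^ 2) * Cmod (u 0%nat x)); [apply Rmult_le_compat_r; [exact P | generalize (pow2_ge_0 (1 - x)); lra] | lra].
Qed.

Lemma integrand_HL_ex z f : mem (space_HL z) f -> exists l, genC (integrand_HL z f) (at_point 0) (Rbar_locally p_infty) l.
Proof.
intros Hf; apply space_HL_mem in Hf; destruct Hf as [Hf Hw].
apply schwartz_half_tower in Hf; destruct Hf as (u & [Tu _] & E).
destruct (schwartz_half_decay _ Hw) as [M HM].
destruct (genC_dominated int_range_half (integrand_HL z (u 0%nat)) (fun x => M * / (x + 1) ^ 2) M) as [l [Hl _]].
- intros x _; unfold integrand_HL, phi_HL_plus, phi_HL_minus, em.
  assert (C0 : continuous (u 0%nat) x) by (apply (tower_cont (fun _ => True)); [exact Tu | exact I]).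
  destruct (excluded_middle_informative (on_contour Gamma_HL_plus z)); ccont; exact C0.
- intros x Hx; apply cont_inv_sq, Hx.
- intros x Hx; replace (integrand_HL z (u 0%nat) x) with (integrand_HL z f x)
    by (unfold integrand_HL; rewrite E by exact Hx; reflexivity).
  eapply Rle_trans; [apply integrand_HL_bound, Hx | apply le_inv_sq; [exact Hx | apply HM, Hx]].
- apply gen_inv_sq_half.
- exists l; revert Hl; apply (genC_ext int_range_half).
  intros x Hx; unfold integrand_HL; rewrite E by exact Hx; reflexivity.
Qed.

Lemma F_HL_val z f l : genC (integrand_HL z f) (at_point 0) (Rbar_locally p_infty) l -> F_HL z f = l.
Proof. apply (is_RInt_gen_unique (V := C_R_CompleteNormedModule)). Qed.

Lemma dual_F_HL z : dual (space_HL z) (F_HL z).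
Proof.
split.
- intros a b f g Hf Hg.
  destruct (integrand_HL_ex z f Hf) as [l Hl]; destruct (integrand_HL_ex z g Hg) as [m Hm].
  rewrite (F_HL_val z f l Hl), (F_HL_val z g m Hm).
  apply F_HL_val.
  assert (H := range_plus int_range_half
    (range_scal int_range_half a Hl)
    (range_scal int_range_half b Hm)).
  revert H; apply (genC_ext int_range_half); intros x _; unfold integrand_HL; cring.
- exists 2%nat, 4; intros f B Hf HB.
  destruct (integrand_HL_ex z f Hf) as [l Hl]; rewrite (F_HL_val z f l Hl).
  apply (genC_bound int_range_half (integrand_HL z f) (fun x => 4 * B * / (x + 1) ^ 2) l); [| exact Hl | apply gen_inv_sq_half].
  intros x Hx; eapply Rle_trans; [apply integrand_HL_bound, Hx |].
  apply le_inv_sq; [exact Hx | apply space_HL_semi; assumption].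
Qed.

Lemma half_linear (f g : R -> C) (a b : C) : schwartz_half f -> schwartz_half g ->
  schwartz_half (fun x => a * f x + b * g x)%C /\
  forall k x, half_line x -> Derive_on_n half_line k (fun x => a * f x + b * g x)%C x
    = (a * Derive_on_n half_line k f x + b * Derive_on_n half_line k g x)%C.
Proof.
rewrite !schwartz_half_tower; intros (u & Su & Eu) (v & Sv & Ev).
assert (T := schwartz_tower_linear u v a b Su Sv).
assert (E0 : forall x, half_line x -> (a * f x + b * g x = a * u 0%nat x + b * v 0%nat x)%C).
{ intros x Hx; rewrite Eu, Ev by exact Hx; reflexivity. }
split; [exists (fun k x => a * u k x + b * v k x)%C; split; assumption |].
intros k x Hx.
rewrite (Derive_on_n_tower half_line (fun k x => a * u k x + b * v k x)%C _ perfect_half (tower_R_half _ (proj1 T)) E0) by exact Hx.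
rewrite (Derive_on_n_tower half_line u f perfect_half (tower_R_half _ (proj1 Su)) Eu) by exact Hx.
rewrite (Derive_on_n_tower half_line v g perfect_half (tower_R_half _ (proj1 Sv)) Ev) by exact Hx.
reflexivity.
Qed.

Lemma S_half_tower f u : schwartz_tower u -> (forall x, half_line x -> f x = u 0%nat x) ->
  forall x, half_line x -> S_op half_line f x = (Ci * u 3%nat x)%C.
Proof.
intros Su Eu x Hx; unfold S_op.
rewrite (Derive_on_n_tower half_line u f perfect_half (tower_R_half _ (proj1 Su)) Eu) by exact Hx; reflexivity.
Qed.

Lemma S_half_linear_operator eps : linear_operator (Phi_HL eps) schwartz_half_space (S_op half_line).
Proof.
split.
- intros f [[Hf _] _]; apply schwartz_half_tower in Hf; destruct Hf as (u & Su & Eu).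
  apply schwartz_half_tower; exists (fun k x => Ci * u (3 + k)%nat x)%C; split.
  + apply schwartz_tower_shift, Su.
  + apply (S_half_tower f u Su Eu).
- intros a b f g [[Hf (M & X & HM)] F0] [[Hg (N & Y & HN)] G0].
  destruct (half_linear f g a b Hf Hg) as [Hs HD].
  split; [split; [split; [exact Hs |] |] |].
  + exists (Cmod a * M + Cmod b * N), (Rmax X Y); intros x Hx Hxy.
    assert (L1 := Rmax_l X Y); assert (L2 := Rmax_r X Y).
    specialize (HM x Hx ltac:(lra)); specialize (HN x Hx ltac:(lra)).
    eapply Rle_trans; [apply Cmod_triangle |]; rewrite !Cmod_mult.
    assert (A := Cmod_ge_0 a); assert (B := Cmod_ge_0 b); nra.
  + rewrite F0, G0; ring.
  + intros x Hx; unfold S_op; rewrite HD by exact Hx; ring.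
Qed.

Definition HL_rem (z : C) (f : R -> C) : C :=
  let w := (Ci * Derive_on_n half_line 2 f 0 - z * Derive_on_n half_line 1 f 0)%C in
  (RtoC (/ (2 * PI)) * (if excluded_middle_informative (on_contour Gamma_HL_plus z) then w else - w))%C.

Lemma dual_HL_rem z : dual schwartz_half_space (HL_rem z).
Proof.
split.
- intros a b f g Hf Hg; simpl in Hf, Hg; destruct (half_linear f g a b Hf Hg) as [_ HD]; unfold HL_rem.
  rewrite !HD by apply half_0.
  destruct (excluded_middle_informative (on_contour Gamma_HL_plus z)); ring.
- exists 2%nat, (Cmod z + 1); intros f B _ HB; simpl in HB.
  assert (B1 := HB 0%nat 1%nat 0 ltac:(lia) ltac:(lia) half_0).
  assert (B2 := HB 0%nat 2%nat 0 ltac:(lia) ltac:(lia) half_0).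
  rewrite pow_O, Rmult_1_l in B1, B2.
  assert (Z0 := Cmod_ge_0 z); unfold HL_rem.
  assert (W : Cmod (Ci * Derive_on_n half_line 2 f 0 - z * Derive_on_n half_line 1 f 0) <= (Cmod z + 1) * B).
  { eapply Rle_trans; [apply Cmod_triangle |]; rewrite Cmod_opp, !Cmod_mult, Cmod_Ci; nra. }
  apply Cmod_inv_2PI.
  destruct (excluded_middle_informative (on_contour Gamma_HL_plus z)); rewrite ?Cmod_opp; exact W.
Qed.

Lemma space_HL_decay delta z u f : 0 < delta -> delta < 1 -> on_contour (Gamma_HL delta) z ->
  schwartz_tower u -> (forall k, exists eta, delta < eta /\ rate (u k) eta) ->
  (forall x, half_line x -> f x = u 0%nat x) -> mem (space_HL z) f.
Proof.
intros Hd Hd1 Hz Su HR E.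
assert (Sf : schwartz_half f) by (apply schwartz_half_tower; exists u; auto).
unfold space_HL.
destruct (excluded_middle_informative (on_contour Gamma_HL_plus z \/ Im z = 0)) as [H | H]; [exact Sf |].
split; [exact Sf |].
apply on_HL_cases in Hz; destruct Hz as [Hz | Hz]; [tauto |].
apply (on_HL_minus delta z Hd Hd1) in Hz.
apply (schwartz_half_weight (Im z) u f); [lra | exact Su | | exact E].
apply weighted_bounds_rate; intros k; destruct (HR k) as (eta & He & Hr); exists eta; split; [lra | exact Hr].
Qed.

Lemma F_HL_plus z f g eta : on_contour Gamma_HL_plus z -> 0 < eta ->
  (forall x, half_line x -> continuous g x) -> rate g eta -> (forall x, half_line x -> f x = g x) ->
  F_HL z f = HL_plus g z.
Proof.
intros Hz He Cg Rg E; apply F_HL_val.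
destruct (on_HL_plus_Im z Hz) as (_ & H1 & H2 & _).
assert (T1 := transform_int int_range_half _ _ (rate_transformable g eta (alpha * z)%C Cg Rg ltac:(lra))).
assert (T2 := transform_int int_range_half _ _ (rate_transformable g eta (alpha ^ 2 * z)%C Cg Rg ltac:(lra))).
assert (H := range_scal int_range_half (1 / RtoC (2 * PI))%C
   (range_plus int_range_half
      (range_scal int_range_half alpha T1)
      (range_scal int_range_half (alpha ^ 2)%C T2))).
revert H; apply (genC_ext int_range_half); intros x Hx.
unfold integrand_HL; destruct (excluded_middle_informative (on_contour Gamma_HL_plus z)); [| contradiction].
rewrite E by exact Hx; unfold phi_HL_plus; cring.
Qed.

Lemma F_HL_minus z f g eta : ~ on_contour Gamma_HL_plus z -> Im z < eta ->
  (forall x, half_line x -> continuous g x) -> rate g eta -> (forall x, half_line x -> f x = g x) ->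
  F_HL z f = HL_minus g z.
Proof.
intros Hz He Cg Rg E; apply F_HL_val.
assert (T := transform_int int_range_half _ _ (rate_transformable g eta z Cg Rg He)).
assert (H := range_scal int_range_half (1 / RtoC (2 * PI))%C T).
revert H; apply (genC_ext int_range_half); intros x Hx.
unfold integrand_HL; destruct (excluded_middle_informative (on_contour Gamma_HL_plus z)); [contradiction |].
rewrite E by exact Hx; unfold phi_HL_minus; cring.
Qed.

Lemma HL_hat_third u eta mu : 0 < eta -> schwartz_tower u -> (forall k, rate (u k) eta) ->
  u 0%nat 0 = RtoC 0 -> Im mu < eta ->
  hat (fun x => Ci * u 3%nat x)%C mu = (mu ^ 3 * hat (u 0%nat) mu + (mu * u 1%nat 0 - Ci * u 2%nat 0))%C.
Proof.
intros He [Tu _] HR U0 Hmu.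
assert (Cu : forall k x, half_line x -> continuous (u k) x).
{ intros k x _; apply (tower_cont (fun _ => True)); [exact Tu | exact I]. }
rewrite (transform_third int_range_half u mu (RtoC 0)).
- f_equal; unfold boundary_term; rewrite U0, em_0.
  transitivity (- Ci * u 2%nat 0 - (Ci * Ci) * mu * u 1%nat 0)%C; [ring | rewrite Ci_sq; ring].
- apply tower_R_half, Tu.
- apply rate_transformable with eta; auto.
- apply rate_transformable with eta; [| apply rate_scal, HR | exact Hmu].
  intros x Hx; ccont; apply Cu, Hx.
- apply boundary_term_vanishes with eta; assumption.
Qed.

Section HalfLine.
Context (eps delta : R) (Hd : 0 < delta) (Hde : delta < eps) (Hd1 : delta < 1).

Lemma Phi_HL_tower phi : Phi_HL eps phi -> exists u eta, delta < eta /\ schwartz_tower u /\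
  (forall x, half_line x -> phi x = u 0%nat x) /\ (forall k, rate (u k) eta) /\ u 0%nat 0 = RtoC 0.
Proof.
intros [Hphi P0]; destruct (exp_decay_tower eps phi) as (u & Su & E & HR); [lra | exact Hphi |].
exists u, ((delta + eps) / 2); split; [lra | split; [exact Su | split; [exact E | split]]].
- intros k; apply HR; lra.
- rewrite <- E by apply half_0; exact P0.
Qed.

Lemma space_HL_Phi z phi : on_contour (Gamma_HL delta) z -> Phi_HL eps phi ->
  mem (space_HL z) phi /\ mem (space_HL z) (S_op half_line phi).
Proof.
intros Hz Hphi; destruct (Phi_HL_tower phi Hphi) as (u & eta & He & Su & E & HR & _); split.
- apply (space_HL_decay delta z u); try assumption; intros k; exists eta; auto.
- apply (space_HL_decay delta z (fun k x => Ci * u (3 + k)%nat x)%C); try assumption.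
  + apply schwartz_tower_shift, Su.
  + intros k; exists eta; split; [exact He | apply rate_scal, HR].
  + apply (S_half_tower phi u Su E).
Qed.

Lemma F_HL_eigen z phi : on_contour (Gamma_HL delta) z -> Phi_HL eps phi ->
  F_HL z (S_op half_line phi) = (cube z * F_HL z phi + HL_rem z phi)%C.
Proof.
intros Hz Hphi; destruct (Phi_HL_tower phi Hphi) as (u & eta & He & Su & E & HR & U0).
assert (Cu : forall k x, half_line x -> continuous (u k) x).
{ intros k x _; apply (tower_cont (fun _ => True)); [apply Su | exact I]. }
set (g := fun x : R => (Ci * u 3%nat x)%C).
assert (C3 : forall x, half_line x -> continuous g x).
{ intros x Hx; unfold g; ccont; apply Cu, Hx. }
assert (R3 : rate g eta) by apply rate_scal, HR.
assert (T : forall mu, Im mu < eta ->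
  hat g mu = (mu ^ 3 * hat (u 0%nat) mu + (mu * u 1%nat 0 - Ci * u 2%nat 0))%C).
{ intros mu Hmu; apply (HL_hat_third u eta mu); assumption || lra. }
assert (ES := S_half_tower phi u Su E).
assert (ED : forall k, Derive_on_n half_line k phi 0 = u k 0).
{ intros k; apply (Derive_on_n_tower half_line u phi perfect_half (tower_R_half _ (proj1 Su)) E), half_0. }
assert (I2 : RtoC (/ (2 * PI)) = (/ RtoC (2 * PI))%C) by (apply RtoC_inv; assert (H := PI_RGT_0); lra).
unfold HL_rem, cube; rewrite !ED, I2.
apply on_HL_cases in Hz; destruct Hz as [Hz | Hz].
- destruct (on_HL_plus_Im z Hz) as (_ & H1 & H2 & _).
  rewrite (F_HL_plus z _ g eta Hz ltac:(lra) C3 R3 ES), (F_HL_plus z _ (u 0%nat) eta Hz ltac:(lra) (Cu 0%nat) (HR 0%nat) E).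
  destruct (excluded_middle_informative (on_contour Gamma_HL_plus z)); [| contradiction].
  unfold HL_plus.
  rewrite (T (alpha * z)%C), (T (alpha ^ 2 * z)%C) by lra.
  rewrite alpha_mul_cube, alpha2_mul_cube.
  assert (S0 := alpha_sum).
  assert (SB : (alpha ^ 2 * alpha ^ 2 = alpha)%C).
  { transitivity (alpha * (alpha ^ 3))%C; [simpl; ring | rewrite alpha_cube; ring]. }
  assert (SA : (alpha ^ 2 = - 1 - alpha)%C).
  { transitivity ((1 + alpha + alpha ^ 2) - 1 - alpha)%C; [ring | rewrite S0; ring]. }
  set (t1 := hat (u 0%nat) (alpha * z)); set (t2 := hat (u 0%nat) (alpha ^ 2 * z)).
  transitivity (z ^ 3 * (1 / RtoC (2 * PI) * (alpha * t1 + alpha ^ 2 * t2))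
    + / RtoC (2 * PI) * ((alpha ^ 2 + alpha ^ 2 * alpha ^ 2) * z * u 1%nat 0 - (alpha + alpha ^ 2) * Ci * u 2%nat 0))%C.
  + unfold Cdiv; simpl; ring.
  + rewrite SB, SA; unfold Cdiv; ring.
- destruct (on_HL_minus delta z Hd Hd1 Hz) as (Him & _ & Np).
  rewrite (F_HL_minus z _ g eta Np ltac:(lra) C3 R3 ES), (F_HL_minus z _ (u 0%nat) eta Np ltac:(lra) (Cu 0%nat) (HR 0%nat) E).
  destruct (excluded_middle_informative (on_contour Gamma_HL_plus z)); [contradiction |].
  unfold HL_minus; rewrite (T z) by lra.
  unfold Cdiv; ring.
Qed.

Lemma HL_contours gamma : In gamma (Gamma_HL delta) ->
  (gamma = sector_path 1 (PI / 3) (2 * PI / 3) /\ forall t, on_contour Gamma_HL_plus (gamma t))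
  \/ (gamma = sector_path delta 0 PI /\ forall t, on_contour (Gamma_HL_minus delta) (gamma t)).
Proof.
intros [<- | [<- | []]].
- left; split; [reflexivity |]; intros t; eexists; exists t; split; [left; reflexivity | reflexivity].
- right; split; [reflexivity |]; intros t; eexists; exists t; split; [left; reflexivity | reflexivity].
Qed.

Lemma HL_rem_0 phi x gamma : 0 < x -> In gamma (Gamma_HL delta) ->
  path_int gamma (fun z => Cexp (Ci * z * RtoC x) / cube z * HL_rem z phi)%C (RtoC 0).
Proof.
assert (Hpi := PI_RGT_0).
intros Hx Hg; destruct (HL_contours gamma Hg) as [[-> Hon] | [-> Hon]].
- apply (path_int_ext _ (fun z => Cexp (Ci * z * RtoC x) / z ^ 3 *
    (RtoC (/ (2 * PI)) * Ci * Derive_on_n half_line 2 phi 0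
     + (- RtoC (/ (2 * PI)) * Derive_on_n half_line 1 phi 0) * z))%C).
  { intros t; unfold HL_rem, cube.
    destruct (excluded_middle_informative (on_contour Gamma_HL_plus (sector_path 1 (PI / 3) (2 * PI / 3) t))) as [_ | N].
    - unfold Cdiv; ring.
    - exfalso; apply N, Hon. }
  apply path_int_exp_0; [lra | lra |].
  intros th Hth; assert (0 <= sin th) by (apply sin_ge_0; lra); nra.
- apply (path_int_ext _ (fun z => Cexp (Ci * z * RtoC x) / z ^ 3 *
    (- RtoC (/ (2 * PI)) * Ci * Derive_on_n half_line 2 phi 0
     + (RtoC (/ (2 * PI)) * Derive_on_n half_line 1 phi 0) * z))%C).
  { intros t; unfold HL_rem, cube.
    destruct (excluded_middle_informative (on_contour Gamma_HL_plus (sector_path delta 0 PI t))) as [N | _].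
    - exfalso; revert N; apply (on_HL_minus delta); auto.
    - unfold Cdiv; ring. }
  apply path_int_exp_0; [lra | lra |].
  intros th Hth; assert (0 <= sin th) by (apply sin_ge_0; lra); nra.
Qed.

Lemma Cmod_inv_2PI_div w B : Cmod w <= B -> Cmod (1 / RtoC (2 * PI) * w) <= B.
Proof.
intros H; replace (1 / RtoC (2 * PI))%C with (RtoC (/ (2 * PI))); [apply Cmod_inv_2PI, H |].
rewrite RtoC_inv by (assert (Q := PI_RGT_0); lra); unfold Cdiv; ring.
Qed.

Lemma HL_integral_ex phi x gamma : Phi_HL eps phi -> 0 < x -> In gamma (Gamma_HL delta) -> exists v,
  path_int gamma (fun z => Cexp (Ci * z * RtoC x) * (1 / cube z) * F_HL z (S_op half_line phi))%C v.
Proof.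
assert (Hpi := PI_RGT_0).
intros Hphi Hx Hg; destruct (Phi_HL_tower phi Hphi) as (u & eta & He & Su & E & HR & U0).
set (g := fun x => (Ci * u 3%nat x)%C).
assert (Cg : forall x, half_line x -> continuous g x).
{ intros y _; unfold g; ccont; apply (tower_cont (fun _ => True)); [apply Su | exact I]. }
assert (Rg : rate g eta) by apply rate_scal, HR.
assert (ES : forall x, half_line x -> S_op half_line phi x = g x) by apply (S_half_tower phi u Su E).
destruct (hat_bound g eta ltac:(lra) Cg Rg) as (K & HK & BK).
assert (Chat : forall z, Im z < eta -> continuous (hat g) z).
{ intros z Hz; apply (transform_cont int_range_half), (rate_transformable g eta); assumption. }
assert (Cout : forall r th, 0 < r -> continuous (fun z => Cexp (Ci * z * RtoC x) * (1 / cube z))%C (polar r th)).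
{ intros r th Hr; unfold cube; ccont; apply Cpow_nz, polar_neq_0, Hr. }
assert (Bound : forall r th w B, delta <= r -> 0 <= sin th -> Cmod w <= B ->
  Cmod (Cexp (Ci * polar r th * RtoC x) * (1 / cube (polar r th)) * w) <= B / delta / r ^ 2).
{ intros r th w B Hr Hth Hw.
  assert (N := polar_neq_0 r th ltac:(lra)).
  assert (W0 := Cmod_ge_0 w).
  rewrite !Cmod_mult.
  assert (B1 : Cmod (Cexp (Ci * polar r th * RtoC x)) <= 1).
  { rewrite Cexp_i_em, Cmod_em, <- exp_0; apply exp_le_mono; simpl.
    assert (0 <= r * sin th) by nra; nra. }
  assert (B2 : Cmod (1 / cube (polar r th)) = / r ^ 3).
  { unfold cube, Cdiv; rewrite Cmult_1_l, Cmod_inv by (apply Cpow_nz, N).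
    rewrite Cmod_pow, Cmod_polar by lra; reflexivity. }
  rewrite B2.
  assert (P3 : 0 < / r ^ 3) by (apply Rinv_0_lt_compat, pow_lt; lra).
  assert (L : / r ^ 3 <= / (delta * r ^ 2)).
  { apply Rinv_le_contravar; [apply Rmult_lt_0_compat; [exact Hd | apply pow_lt; lra] |].
    simpl; apply Rmult_le_compat_r; [nra | exact Hr]. }
  apply Rle_trans with (1 * / (delta * r ^ 2) * B).
  - apply Rmult_le_compat; [| exact W0 | | exact Hw].
    + apply Rmult_le_pos; [apply Cmod_ge_0 | lra].
    + apply Rmult_le_compat; [apply Cmod_ge_0 | lra | exact B1 | exact L].
  - right; field; lra. }
destruct (HL_contours gamma Hg) as [[-> Hon] | [-> Hon]].
- destruct (path_int_sector_ex 1 (PI / 3) (2 * PI / 3) Rlt_0_1 ltac:(lra)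
    (fun z => Cexp (Ci * z * RtoC x) * (1 / cube z) * HL_plus g z)%C ((K + K) / delta)) as [v Hv].
  + intros r th Hedge; destruct (HL_plus_Im r th Hedge) as (Hr & _ & H1 & H2).
    apply (cont_Cmult (fun z => Cexp (Ci * z * RtoC x) * (1 / cube z))%C); [apply Cout; lra |].
    unfold HL_plus; ccont.
    * apply (continuous_comp (fun z => alpha * z)%C (hat g)); [ccont | apply Chat; lra].
    * apply (continuous_comp (fun z => alpha ^ 2 * z)%C (hat g)); [ccont | apply Chat; lra].
  + intros r th Hr Hth.
    destruct (HL_plus_Im r th) as (_ & H0 & H1 & H2); [left; split; assumption |].
    apply Bound; [lra | apply sin_ge_0; lra |].
    apply Cmod_inv_2PI_div; eapply Rle_trans; [apply Cmod_triangle |].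
    rewrite !Cmod_mult, Cmod_alpha, Cmod_alpha2; assert (Q1 := BK _ H1); assert (Q2 := BK _ H2); lra.
  + exists v; revert Hv; apply path_int_ext; intros t.
    rewrite (F_HL_plus _ _ g eta (Hon t) ltac:(lra) Cg Rg ES); reflexivity.
- destruct (path_int_sector_ex delta 0 PI Hd ltac:(lra)
    (fun z => Cexp (Ci * z * RtoC x) * (1 / cube z) * HL_minus g z)%C (K / delta)) as [v Hv].
  + intros r th Hedge; destruct (HL_minus_Im delta r th Hd Hedge) as (Hr & Him & _).
    apply (cont_Cmult (fun z => Cexp (Ci * z * RtoC x) * (1 / cube z))%C); [apply Cout; lra |].
    unfold HL_minus; apply (cont_Cmult (fun _ => 1 / RtoC (2 * PI))%C (hat g)); [apply continuous_const | apply Chat; lra].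
  + intros r th Hr Hth.
    assert (S0 : sin th = 0) by (destruct Hth as [-> | ->]; [apply sin_0 | apply sin_PI]).
    apply Bound; [exact Hr | lra |].
    apply Cmod_inv_2PI_div, BK; simpl; rewrite S0; lra.
  + exists v; revert Hv; apply path_int_ext; intros t.
    destruct (on_HL_minus delta _ Hd Hd1 (Hon t)) as (Him & _ & Np).
    rewrite (F_HL_minus _ _ g eta Np ltac:(lra) Cg Rg ES); reflexivity.
Qed.

End HalfLine.

(** * Completeness on the half-line *)

(** Differentiation of the vanishing transform with respect to [r]; the decay of
    [g] pays for the powers of [x]. *)
Lemma HL_moments_0 g eta : 0 < eta -> (forall x, half_line x -> continuous g x) -> rate g eta ->
  (forall r, 1 <= r -> hat g (RtoC r) = RtoC 0) ->
  forall n r, 1 <= r ->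
    genC (fun x => (- Ci * 1 * RtoC x) ^ n * em (1 * RtoC r) x * g x)%C (at_point 0) (Rbar_locally p_infty) (RtoC 0).
Proof.
intros He Cg Rg H0; induction n as [| n IH]; intros r Hr.
- rewrite <- (H0 r Hr).
  assert (K := transform_int int_range_half g (RtoC r) (rate_transformable g eta (RtoC r) Cg Rg ltac:(simpl; lra))).
  revert K; apply (genC_ext int_range_half); intros x _.
  rewrite (Cmult_1_l (RtoC r)); simpl Cpow; cring.
- destruct Rg as (K & HK & HR).
  destruct (pow_exp_decay (n + 2) (eta / 2)) as (P & HP & HE); [lra |].
  set (G := fun r x => ((- Ci * 1 * RtoC x) ^ n * em (1 * RtoC r) x * g x)%C).
  assert (CG : forall m r x, half_line x -> continuous (fun x => (- Ci * 1 * RtoC x) ^ m * em (1 * RtoC r) x * g x)%C x).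
  { intros m s x Hx; unfold em; ccont; apply Cg, Hx. }
  apply (gen_derive_0 int_range_half (fun h => G (r + h))
    (fun x => (- Ci * 1 * RtoC x) ^ S n * em (1 * RtoC r) x * g x)%C
    (fun x => K * P * exp (- (eta / 2 / 2) * x)) (K * P * / (eta / 2 / 2)) (eta / 2) ltac:(lra)).
  + intros h Hh; apply IH; lra.
  + intros h _ x Hx; apply CG, Hx.
  + intros x Hx; apply CG, Hx.
  + intros; apply cont_exp_decay.
  + apply gen_exp_decay_scal; lra.
  + intros h x Hh Hx; rewrite Rplus_0_r; unfold G.
    replace ((- Ci * 1 * RtoC x) ^ n * em (1 * RtoC (r + h)) x * g x - (- Ci * 1 * RtoC x) ^ n * em (1 * RtoC r) x * g x
      - RtoC h * ((- Ci * 1 * RtoC x) ^ S n * em (1 * RtoC r) x * g x))%C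
    with (((- Ci * 1 * RtoC x) ^ n * em (1 * RtoC (r + h)) x - (- Ci * 1 * RtoC x) ^ n * em (1 * RtoC r) x
      - RtoC h * ((- Ci * 1 * RtoC x) ^ S n * em (1 * RtoC r) x)) * g x)%C by ring.
    rewrite Cmod_mult; unfold half_line in Hx.
    assert (T := em_taylor_2 (RtoC 1) r h x n ltac:(lra) Hx).
    rewrite Cmod_1, !Rmult_1_l in T; simpl Im in T; rewrite !Rmult_0_l, Rplus_0_l in T.
    specialize (HR x Hx); specialize (HE x Hx).
    assert (P2 : 0 <= x ^ (n + 2)) by (apply pow_le, Hx).
    eapply Rle_trans; [apply Rmult_le_compat; [apply Cmod_ge_0 | apply Cmod_ge_0 | exact T | exact HR] |].
    assert (EX : exp (h * x) * exp (- eta * x) <= exp (- (eta / 2) * x)).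
    { rewrite <- exp_plus; apply exp_le_mono; nra. }
    replace (h ^ 2 * (x ^ (n + 2) * exp (h * x)) * (K * exp (- eta * x)))
      with (h ^ 2 * (K * (x ^ (n + 2) * (exp (h * x) * exp (- eta * x))))) by ring.
    apply Rmult_le_compat_l; [nra |].
    rewrite Rmult_assoc; apply Rmult_le_compat_l; [exact HK |].
    eapply Rle_trans; [apply Rmult_le_compat_l; [exact P2 | exact EX] | exact HE].
Qed.

Lemma pow_fact_le_exp N y : 0 <= y -> y ^ N / INR (fact N) <= exp y.
Proof.
intros Hy; eapply Rle_trans; [| apply (exp_ge_taylor y N Hy)].
destruct N as [| N]; [simpl; lra |].
rewrite tech5; assert (0 <= sum_f_R0 (fun k => y ^ k / INR (fact k)) N); [| lra].
apply cond_pos_sum; intros k; apply Rle_div_r; [apply INR_fact_lt_0 |].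
rewrite Rmult_0_l; apply pow_le, Hy.
Qed.

(** Expanding [e^{-c x}] in powers of [x] continues the vanishing moments from
    [s] to [s + c]; the decay of [g] makes the expansion converge when [c] is
    small compared with its rate. *)
Lemma moments_shift g eta s : 0 < eta -> 0 <= s -> (forall x, half_line x -> continuous g x) -> rate g eta ->
  (forall n, genC (fun x => RtoC (x ^ n * exp (- s * x)) * g x)%C (at_point 0) (Rbar_locally p_infty) (RtoC 0)) ->
  forall n, genC (fun x => RtoC (x ^ n * exp (- (s + eta / 8) * x)) * g x)%C (at_point 0) (Rbar_locally p_infty) (RtoC 0).
Proof.
intros He Hs Cg (K & HK & HR) H0 n.
set (c := eta / 8).
assert (HT : forall N m, genC (fun x => exp_taylor N (RtoC (- c * x)) * (RtoC (x ^ m * exp (- s * x)) * g x))%C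
   (at_point 0) (Rbar_locally p_infty) (RtoC 0)).
{ induction N as [| N IH]; intros m.
  - assert (Q := range_scal int_range_half (RtoC 0) (H0 m)).
    rewrite Cmult_0_l in Q.
    revert Q; apply (genC_ext int_range_half); intros x _; simpl; cring.
  - assert (Q := range_plus int_range_half (IH m)
      (range_scal int_range_half (RtoC ((- c) ^ N * / INR (fact N))) (H0 (N + m)%nat))).
    replace (0 + RtoC ((- c) ^ N * / INR (fact N)) * 0)%C with (RtoC 0) in Q by ring.
    revert Q; apply (genC_ext int_range_half); intros x _; simpl exp_taylor.
    rewrite <- RtoC_pow, Rpow_mult_distr, pow_add, !RtoC_mult; cring. }
assert (Cr : forall (h : R -> R), (forall x, continuous h x) -> forall x, half_line x -> continuous (fun x => RtoC (h x) * g x)%C x).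
{ intros h Ch x Hx; apply cont_Cmult; [apply cont_RtoC, Ch | apply Cg, Hx]. }
assert (Cpe : forall m t (x : R), continuous (fun x => x ^ m * exp (- t * x)) x).
{ intros m t x; apply ex_derive_continuous_R; auto_derive; easy. }
destruct (pow_exp_decay n (eta / 2)) as (P & HP & HE); [lra |].
assert (Key : forall N, exists l,
  genC (fun x => RtoC (x ^ n * exp (- (s + c) * x)) * g x)%C (at_point 0) (Rbar_locally p_infty) l /\
  Cmod l <= (/ 2) ^ N * (K * P * / (eta / 4))).
{ intros N.
  destruct (genC_dominated int_range_half
    (fun x => (Cexp (RtoC (- c * x)) - exp_taylor N (RtoC (- c * x))) * (RtoC (x ^ n * exp (- s * x)) * g x))%C
    (fun x => (/ 2) ^ N * (K * P * exp (- (eta / 4) * x))) ((/ 2) ^ N * (K * P * / (eta / 4)))) as [l [Hl Bl]].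
  - intros x Hx; apply cont_Cmult.
    + assert (CT : continuous (fun x => exp_taylor N (RtoC (- c * x))) x).
      { induction N as [| N IHN]; [apply continuous_const |]; simpl exp_taylor.
        apply (cont_Cplus (fun x => exp_taylor N (RtoC (- c * x)))); [exact IHN |].
        ccont; apply cont_Rmult; [apply continuous_const | apply continuous_id]. }
      apply cont_Cminus; [| exact CT].
      ccont; apply cont_Rmult; [apply continuous_const | apply continuous_id].
    + apply Cr; [intros; apply Cpe | exact Hx].
  - intros x _; apply cont_Rmult; [apply continuous_const | apply cont_exp_decay].
  - intros x Hx; unfold half_line in Hx; rewrite !Cmod_mult, Cmod_R.
    assert (Em : Cmod (RtoC (- c * x)) = / 2 * (eta / 4 * x)).
    { rewrite Cmod_R, Rabs_left1 by (unfold c; nra); unfold c; field. }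
    assert (T := Cmod_exp_taylor N (RtoC (- c * x))); rewrite Em, Rpow_mult_distr in T.
    assert (F := pow_fact_le_exp N (eta / 4 * x) ltac:(nra)).
    assert (P2 : 0 < (/ 2) ^ N) by (apply pow_lt; lra).
    (* [c x] is half of [y = eta x / 4], and [y^N / N! <= e^y] *)
    assert (T' : Cmod (Cexp (RtoC (- c * x)) - exp_taylor N (RtoC (- c * x)))
      <= (/ 2) ^ N * (exp (eta / 4 * x) * exp (/ 2 * (eta / 4 * x)))).
    { eapply Rle_trans; [exact T |].
      replace ((/ 2) ^ N * (eta / 4 * x) ^ N / INR (fact N) * exp (/ 2 * (eta / 4 * x)))
        with ((/ 2) ^ N * ((eta / 4 * x) ^ N / INR (fact N) * exp (/ 2 * (eta / 4 * x)))) by (unfold Rdiv; ring).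
      apply Rmult_le_compat_l; [lra |]; apply Rmult_le_compat_r; [left; apply exp_pos | exact F]. }
    assert (E1 := exp_pos (- s * x)); assert (E2 : exp (- s * x) <= 1) by (rewrite <- exp_0; apply exp_le_mono; nra).
    assert (Pn : 0 <= x ^ n) by (apply pow_le, Hx).
    rewrite (Rabs_pos_eq (x ^ n * exp (- s * x))) by nra.
    specialize (HR x Hx); specialize (HE x Hx).
    apply Rle_trans with ((/ 2) ^ N * (exp (eta / 4 * x) * exp (/ 2 * (eta / 4 * x))) * (x ^ n * 1 * (K * exp (- eta * x)))).
    + apply Rmult_le_compat; [apply Cmod_ge_0 | apply Rmult_le_pos; [nra | apply Cmod_ge_0] | exact T' |].
      apply Rmult_le_compat; [nra | apply Cmod_ge_0 | nra | exact HR].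
    + replace ((/ 2) ^ N * (exp (eta / 4 * x) * exp (/ 2 * (eta / 4 * x))) * (x ^ n * 1 * (K * exp (- eta * x))))
        with ((/ 2) ^ N * (K * (x ^ n * (exp (eta / 4 * x) * exp (/ 2 * (eta / 4 * x)) * exp (- eta * x))))) by ring.
      apply Rmult_le_compat_l; [lra |].
      rewrite (Rmult_assoc K P); apply Rmult_le_compat_l; [exact HK |].
      rewrite <- !exp_plus.
      replace (- (eta / 4) * x) with (- (eta / 2 / 2) * x) by field.
      eapply Rle_trans; [| exact HE]; apply Rmult_le_compat_l; [exact Pn |]; apply exp_le_mono; nra.
  - apply gen_scal_R, gen_exp_decay_scal; lra.
  - exists l; split; [| exact Bl].
    assert (Q := range_plus int_range_half Hl (HT N n)).
    rewrite Cplus_0_r in Q.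
    revert Q; apply (genC_ext int_range_half); intros x _.
    replace (exp (- (s + c) * x)) with (exp (- c * x) * exp (- s * x)) by (rewrite <- exp_plus; f_equal; ring).
    rewrite Cexp_RtoC, !RtoC_mult; cring. }
destruct (Key 0%nat) as [l [Hl _]].
enough (E : l = RtoC 0) by (rewrite <- E; exact Hl).
apply Cmod_eq_0, Rle_antisym; [| apply Cmod_ge_0].
apply Rnot_lt_le; intros Hpos.
set (M := K * P * / (eta / 4)) in *.
assert (HM : 0 <= M).
{ apply Rmult_le_pos; [apply Rmult_le_pos; assumption | left; apply Rinv_0_lt_compat; lra]. }
destruct (pow_lt_1_zero (/ 2) ltac:(rewrite Rabs_pos_eq; lra) (Cmod l / (M + 1))) as [N HN].
{ apply Rdiv_lt_0_compat; lra. }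
specialize (HN N (le_n N)); rewrite Rabs_pos_eq in HN by (apply pow_le; lra).
destruct (Key N) as [m [Hm Bm]].
rewrite (genC_unique _ _ _ Hl Hm) in *.
apply Rlt_div_r in HN; [| lra].
assert (0 < (/ 2) ^ N) by (apply pow_lt; lra); nra.
Qed.

Lemma exp_separates c x0 eta : 0 < c -> 0 < eta -> exists d, 0 < d /\
  forall x, half_line x -> eta <= Rabs (x - x0) -> d <= Rabs (exp (- c * x) - exp (- c * x0)).
Proof.
intros Hc He.
assert (E0 := exp_pos (- c * x0)).
assert (E1 : exp (- c * eta) < 1) by (rewrite <- exp_0; apply exp_increasing; nra).
assert (E2 : 1 < exp (c * eta)) by (rewrite <- exp_0; apply exp_increasing; nra).
exists (exp (- c * x0) * Rmin (1 - exp (- c * eta)) (exp (c * eta) - 1)).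
assert (M1 := Rmin_l (1 - exp (- c * eta)) (exp (c * eta) - 1)).
assert (M2 := Rmin_r (1 - exp (- c * eta)) (exp (c * eta) - 1)).
split; [apply Rmult_lt_0_compat; [exact E0 | apply Rmin_glb_lt; lra] |].
intros x _ H.
replace (exp (- c * x)) with (exp (- c * x0) * exp (- c * (x - x0))) by (rewrite <- exp_plus; f_equal; ring).
replace (exp (- c * x0) * exp (- c * (x - x0)) - exp (- c * x0))
  with (exp (- c * x0) * (exp (- c * (x - x0)) - 1)) by ring.
rewrite Rabs_mult, (Rabs_pos_eq (exp (- c * x0))) by lra.
apply Rmult_le_compat_l; [lra |].
destruct (Rle_dec 0 (x - x0)) as [P | P].
- rewrite Rabs_pos_eq in H by exact P.
  assert (exp (- c * (x - x0)) <= exp (- c * eta)) by (apply exp_le_mono; nra).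
  rewrite Rabs_left1; lra.
- rewrite Rabs_left in H by lra.
  assert (exp (c * eta) <= exp (- c * (x - x0))) by (apply exp_le_mono; nra).
  rewrite Rabs_pos_eq; lra.
Qed.

(** Let [g(x) = e^{-ix} f(x)]. The transform of [f] vanishes at the real numbers
    from [1] on, hence so do all moments of [g]. By [moments_shift] those of
    [e^{-sx} g] vanish as well when [s] is a multiple of [eta / 8], and these
    include the moments of [g] with respect to the powers of [e^{-eta x / 8}]. *)
Lemma complete_HL eps delta : 0 < delta -> delta < eps -> delta < 1 ->
  complete_system schwartz_half_space (Phi_HL eps) (Gamma_HL delta) F_HL.
Proof.
intros Hd Hde Hd1 f Hphi HF x Hx; simpl in Hx.
destruct (Phi_HL_tower eps delta Hd Hde f Hphi) as (u & eta & He & Su & E & HR & _).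
assert (Cu : forall y, half_line y -> continuous (u 0%nat) y).
{ intros y _; apply (tower_cont (fun _ => True)); [apply Su | exact I]. }
assert (H0 : forall r, 1 <= r -> hat (u 0%nat) (RtoC r) = RtoC 0).
{ intros r Hr.
  assert (Hz : on_contour (Gamma_HL_minus delta) (RtoC r)).
  { exists (sector_path delta 0 PI), r; split; [left; reflexivity |].
    rewrite sector_path_r by lra; unfold polar; rewrite cos_0, sin_0; unfold RtoC; f_equal; ring. }
  destruct (on_HL_minus delta _ Hd Hd1 Hz) as (_ & _ & Np).
  assert (V : HL_minus (u 0%nat) (RtoC r) = RtoC 0).
  { rewrite <- (F_HL_minus (RtoC r) f (u 0%nat) eta Np ltac:(simpl; lra) Cu (HR 0%nat) E).
    apply HF; destruct Hz as (gam & t & Hg & Et); exists gam, t; split; [apply in_or_app; right; exact Hg | exact Et]. }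
  unfold HL_minus in V; assert (N2 := RtoC_2PI_neq_0).
  transitivity (RtoC (2 * PI) * (1 / RtoC (2 * PI) * hat (u 0%nat) (RtoC r)))%C; [field; exact N2 | rewrite V; ring]. }
set (g := fun y => (em 1 y * u 0%nat y)%C).
assert (Cg : forall y, half_line y -> continuous g y).
{ intros y Hy; apply cont_Cmult; [apply cont_em | apply Cu, Hy]. }
assert (Mg : forall y, Cmod (g y) = Cmod (u 0%nat y)).
{ intros y; unfold g; rewrite Cmod_mult, Cmod_em; simpl; rewrite Rmult_0_l, exp_0; ring. }
assert (Rg : rate g eta).
{ destruct (HR 0%nat) as (K & HK & B); exists K; split; [exact HK |]; intros y Hy; rewrite Mg; apply B, Hy. }
assert (Mom : forall k n, genC (fun y => RtoC (y ^ n * exp (- (INR k * (eta / 8)) * y)) * g y)%C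
  (at_point 0) (Rbar_locally p_infty) (RtoC 0)).
{ induction k as [| k IH]; intros n.
  - assert (K := HL_moments_0 (u 0%nat) eta ltac:(lra) Cu (HR 0%nat) H0 n 1 (Rle_refl 1)).
    assert (Nc : (- Ci <> 0)%C).
    { intros Z; apply (f_equal Cmod) in Z; rewrite Cmod_opp, Cmod_Ci, Cmod_0 in Z; lra. }
    assert (K2 := range_scal int_range_half (/ (- Ci) ^ n)%C K).
    rewrite Cmult_0_r in K2.
    revert K2; apply (genC_ext int_range_half); intros y _.
    simpl INR; rewrite Rmult_0_l, Ropp_0, Rmult_0_l, exp_0, Rmult_1_r, RtoC_pow.
    rewrite !Cmult_1_r, Cpow_mult_l; unfold g.
    as_eq_C; field; apply Cpow_nz, Nc.
  - replace (INR (S k) * (eta / 8)) with (INR k * (eta / 8) + eta / 8) by (rewrite S_INR; ring).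
    apply moments_shift; try assumption; [lra |].
    apply Rmult_le_pos; [apply pos_INR | lra]. }
assert (Z : g x = RtoC 0).
{ destruct Rg as (K & HK & B).
  apply (landau int_range_half (fun y => exp (- (eta / 8) * y)) g (fun y => K * exp (- eta * y)) (K * / eta) x (x + 1)).
  - unfold half_line in Hx; lra.
  - exists (x + 1); intros y Hy; lra.
  - exact Cg.
  - intros y _; apply ex_derive_continuous_R; auto_derive; easy.
  - intros; apply cont_exp_decay.
  - intros y Hy; unfold half_line in Hy; split; [left; apply exp_pos |].
    rewrite <- exp_0; apply exp_le_mono; nra.
  - intros z Hz; apply exp_separates; lra.
  - exact B.
  - apply gen_exp_decay_scal; lra.
  - intros k; assert (Q := Mom k 0%nat).
    revert Q; apply (genC_ext int_range_half); intros y _.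
    f_equal; f_equal; rewrite pow_O, Rmult_1_l.
    induction k as [| k IHk]; [simpl; rewrite Rmult_0_l, Ropp_0, Rmult_0_l; apply exp_0 |].
    rewrite <- tech_pow_Rmult, <- IHk, <- exp_plus, S_INR; f_equal; ring. }
rewrite E by exact Hx.
unfold g in Z; destruct (Ceq_dec (u 0%nat x) (RtoC 0)) as [Q | Q]; [exact Q |].
exfalso; revert Z; apply Cmult_neq_0; [apply Cexp_neq_0 | exact Q].
Qed.

Lemma diagonalised_HL eps delta : 0 < delta -> delta < eps -> delta < 1 ->
  diagonalised_by I_HL schwartz_half_space space_HL (Phi_HL eps) (S_op half_line) (Gamma_HL delta) F_HL cube.
Proof.
intros Hd Hde Hd1; apply diagonalised_by_intro with HL_rem.
- intros phi H; apply H.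
- apply S_half_linear_operator.
- intros z Hz; split; [intros f Hf; apply (space_HL_mem z f Hf) | split; [| apply dual_F_HL]].
  intros phi Hphi; apply (space_HL_Phi eps delta); assumption.
- intros z _; apply dual_HL_rem.
- intros z phi Hz Hphi; apply (F_HL_eigen eps delta); assumption.
- intros z Hz; apply Cpow_nz, (on_HL_neq_0 delta); assumption.
- intros phi x gamma _ Hx Hg; apply (HL_rem_0 delta); assumption.
- intros phi x gamma Hphi Hx Hg; apply (HL_integral_ex eps delta); assumption.
- apply complete_HL; assumption.
Qed.

Theorem theorem3p2 :
  ((forall lambda : C, on_contour Gamma_FI lambda -> Delta_FI lambda <> RtoC 0) /\
   diagonalised_by I_FI smooth_unit_space (fun _ => smooth_unit_space)
     Phi_FI (S_op unit_interval) Gamma_FI F_FI cube)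
  /\
  (forall eps delta : R, 0 < eps -> 0 < delta -> delta < eps -> delta < 1 ->
   (forall (lambda : C) (f : R -> C),
      on_contour (Gamma_HL delta) lambda -> mem (space_HL lambda) f ->
      @ex_RInt_gen C_R_NormedModule (integrand_HL lambda f)
        (at_point 0) (Rbar_locally p_infty)) /\
   diagonalised_by I_HL schwartz_half_space space_HL
     (Phi_HL eps) (S_op half_line) (Gamma_HL delta) F_HL cube).
Proof.
split; [apply diagonalised_FI |].
intros eps delta _ Hd Hde Hd1; split.
- intros lambda f _ Hf; apply integrand_HL_ex, Hf.
- apply diagonalised_HL; assumption.
Qed.
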